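(* Let $\{T_i\}_{i\in\Lambda}$ be a finite iterated function system of affine contractions $T_i(x)=A_ix+t_i$ of $\mathbb{R}^2$ with each $A_i$ a non-singular linear contraction, let $F$ be its attractor and $d$ its affinity dimension. Assume: (Separation) $T_i(F)\cap T_j(F)=\emptyset$ for all $i,j\in\Lambda$ with $i\neq j$; (Positivity) every matrix $A_i$ has strictly positive entries; and that $d\le 1$. Let $\mu$ be the Käenmäki measure, regarded as a measure on $F$. Assume further that the set of $q\ge 2$ for which the $(q-1)$-bunching condition holds is nonempty, where the $(q-1)$-bunching condition is $$\gamma\,\alpha_1(i)^{qd}<\alpha_2(i)^{(q-1)d}\quad\text{for every } i\in\Lambda,$$ and put $q_0:=\sup\{q\ge 2:\text{ the }(q-1)\text{-bunching condition is satisfied}\}$. Then for all $q\in[0,q_0)$ the $L^q$-dimension $D^q(\mu)$ exists and $$D^q(\mu)=d=\dim_{\mathrm H}F,$$ where $\dim_{\mathrm H}$ denotes Hausdorff dimension.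
   Context: Attractor and coding. $F$ is the unique non-empty compact set with $F=\bigcup_{i\in\Lambda}T_i(F)$. Let $\Sigma=\Lambda^{\mathbb N}$. For a finite word $\underline a=a_1\cdots a_k\in\Lambda^k$ write $T_{\underline a}=T_{a_1}\circ\cdots\circ T_{a_k}$, and let $[\underline a]\subset\Sigma$ be the set of sequences beginning with $\underline a$. The coding map $\Pi:\Sigma\to F$ is $\Pi(\underline a)=\lim_{k\to\infty}T_{a_1\cdots a_k}(0)$. For a measure $\mu$ on $\Sigma$, the push-forward $\mu\circ\Pi^{-1}$ on $F$ is also denoted $\mu$. Singular values. For a finite word $\underline a$, $1>\alpha_1(\underline a)\ge\alpha_2(\underline a)>0$ are the singular values of the linear part of $T_{\underline a}$. For $s\in[0,2]$ the singular value function is $\phi^s(\underline a)=\alpha_1(\underline a)^s$ if $s\le1$ and $\phi^s(\underline a)=\alpha_1(\underline a)\alpha_2(\underline a)^{s-1}$ if $s>1$. The affinity dimension is $d=\inf\{s:\sum_{k=1}^\infty\sum_{\underline a\in\Lambda^k}\phi^s(\underline a)<\infty\}$. Käenmäki measure. It is the ergodic shift-invariant Borel probability measure $\mu$ on $\Sigma$ for which there is a constant $C_1$ with $C_1^{-1}\phi^d(a_1\cdots a_n)\le\mu[a_1\cdots a_n]\le C_1\phi^d(a_1\cdots a_n)$ for all finite words, and a constant $C_2$ with $C_2^{-1}\mu[a_1\cdots a_m]\mu[a_{m+1}\cdots a_n]\le\mu[a_1\cdots a_n]\le C_2\,\mu[a_1\cdots a_m]\mu[a_{m+1}\cdots a_n]$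 for all words and $1\le m\le n$ (such a measure is known to exist in this setting). Projective maps and $\gamma$. $\mathbb{PR}^1$ is the set of lines through the origin in $\mathbb R^2$, identified with angles $\theta$. For $i\in\Lambda$, $\phi_i:\mathbb{PR}^1\to\mathbb{PR}^1$ is the map sending the line at angle $\theta$ to its image under $A_i^{-1}$; $\phi_{c_n\cdots c_1}=\phi_{c_n}\circ\cdots\circ\phi_{c_1}$. $\mathcal Q_2\subset\mathbb{PR}^1$ is the negative quadrant (the lines through the origin lying in the closed second and fourth quadrants of the plane). Define $$\gamma:=\exp\ \sup_{\theta\in\mathbb{PR}^1}\ \limsup_{n\to\infty}\frac1n\log\left|\{c_1\cdots c_n\in\Lambda^n:\theta\in\phi_{c_n\cdots c_1}(\mathcal Q_2)\}\right|.$$ $L^q$-dimensions. For a compactly supported Borel probability measure $\mu$ on $\mathbb R^2$ and $\delta>0$, let $\mathcal M_\delta$ be the set of closed $\delta$-mesh squares aligned with the coordinate axes. For $q\ge0$, $q\ne1$, let $M^q_\delta(\mu)=\sum_{Q\in\mathcal M_\delta}\mu(Q)^q$ (with $0^0=0$), and let $\overline D^q(\mu)$ and $\underline D^q(\mu)$ be respectively the limsup and liminf as $\delta\to0$ of $\frac{\log M_\delta^q(\mu)}{(q-1)\log\delta}$. For $q=1$, $\overline D^1(\mu)$ and $\underline D^1(\mu)$ are the limsup and liminf as $\delta\to0$ of $\frac{\sum_{Q\in\mathcal M_\delta}\mu(Q)\log\mu(Q)}{\log\delta}$. When the upper and lower values coincide the common value is $D^q(\mu)$. *)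

(* Defs.v *)
(* Mathematical Components + MathComp-Analysis, over an arbitrary R : realType. *)
From HB Require Import structures.
From mathcomp Require Import all_boot all_order all_algebra.
From mathcomp Require Import all_classical all_reals all_analysis.

Set Implicit Arguments.
Unset Strict Implicit.
Unset Printing Implicit Defensive.

Import Order.TTheory GRing.Theory Num.Theory.
Import numFieldNormedType.Exports.

Local Open Scope classical_set_scope.
Local Open Scope ring_scope.

(* Non-empty finite alphabets: the sigma-algebra generated by a family of
   subsets of nat -> L is only available when L is pointed.  The distinguished
   letter plays no other role. *)
#[short(type="finPointedType")]
HB.structure Definition FinPointed := {T of Finite T & Pointed T}.
HB.instance Definition _ (m : nat) := isPointed.Build 'I_m.+1 ord0.
HB.saturate bool.

Notation plane R := 'cV[R]_2.

(* The library norm on matrices is the sup norm. *)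
Definition enorm {R : realType} (x : plane R) : R :=
  Num.sqrt (x 0 0 ^+ 2 + x 1 0 ^+ 2).

Section IteratedFunctionSystem.
Context {R : realType} {L : finPointedType}.
Implicit Types (A : L -> 'M[R]_2) (t : L -> plane R).
Implicit Types (T : L -> plane R -> plane R) (w : seq L).

Definition linear_contraction (M : 'M[R]_2) : Prop :=
  exists2 c : R, c < 1 & forall x, enorm (M *m x) <= c * enorm x.

Definition affine A t : L -> plane R -> plane R := fun i x => A i *m x + t i.

Definition attractor T (F : set (plane R)) : Prop :=
  [/\ F !=set0, compact F & F = \bigcup_(i in [set: L]) (T i @` F)].

Definition word_map T w : plane R -> plane R :=
  foldr (fun i f => T i \o f) id w.

Definition word_mx A w : 'M[R]_2 := \prod_(i <- w) A i.

Definition coding T (a : nat -> L) : plane R :=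
  lim ((fun k => word_map T (mkseq a k) 0) @ \oo).

Definition sv1 (M : 'M[R]_2) : R :=
  Num.sqrt (sup [set a | eigenvalue (M^T *m M) a]).
Definition sv2 (M : 'M[R]_2) : R :=
  Num.sqrt (inf [set a | eigenvalue (M^T *m M) a]).

Definition sv_function (s : R) (M : 'M[R]_2) : R :=
  if s <= 1 then sv1 M `^ s else sv1 M * sv2 M `^ (s - 1).

(* The infimum of the empty set is +oo. *)
Definition affinity_dim A : \bar R :=
  ereal_inf [set s%:E | s in [set s : R | 0 <= s <= 2 /\
    (\sum_(1 <= k <oo) \sum_(w : k.-tuple L)
       (sv_function s (word_mx A w))%:E < +oo)%E]].

End IteratedFunctionSystem.

Definition cylinder {L : finPointedType} (w : seq L) : set (nat -> L) :=
  [set a | mkseq a (size w) = w].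

(* nat -> L with its Borel sigma-algebra for the product of the discrete
   topologies. *)
Notation symbolic L := (g_sigma_algebraType (range (@cylinder L))).

Definition shift_map {L : finPointedType} (a : nat -> L) : nat -> L :=
  fun n => a n.+1.

Definition kaenmaki_measure {R : realType} {L : finPointedType}
    (A : L -> 'M[R]_2) (d : R) (mu : probability (symbolic L) R) : Prop :=
  [/\ forall E : set (symbolic L), measurable E -> mu (shift_map @^-1` E) = mu E,
      forall E : set (symbolic L), measurable E -> shift_map @^-1` E = E ->
        mu E = 0%E \/ mu E = 1%E,
      exists2 C : R, 0 < C & forall w : seq L,
        ((C^-1 * sv_function d (word_mx A w))%:E <= mu (cylinder w)
           <= (C * sv_function d (word_mx A w))%:E)%E
    & exists2 C : R, 0 < C & forall u v : seq L,
        (C^-1%:E * (mu (cylinder u) * mu (cylinder v)) <= mu (cylinder (u ++ v))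
           <= C%:E * (mu (cylinder u) * mu (cylinder v)))%E].

Section ProjectiveMaps.
Context {R : realType} {L : finPointedType}.
Implicit Types (A : L -> 'M[R]_2) (l : set (plane R)).

Definition line (theta : R) : set (plane R) :=
  [set x : plane R | exists r : R, x 0 0 = r * cos theta /\ x 1 0 = r * sin theta].

Definition proj_line : set (set (plane R)) := range line.

Definition negative_quadrant : set (set (plane R)) :=
  proj_line `&` [set l | forall x : plane R, l x -> x 0 0 * x 1 0 <= 0].

Definition proj_map A (i : L) l : set (plane R) := mulmx (invmx (A i)) @` l.

(* proj_word A [:: c_1; ...; c_n] is phi_(c_n) \o ... \o phi_(c_1). *)
Definition proj_word A (c : seq L) : set (plane R) -> set (plane R) :=
  foldl (fun f i => proj_map A i \o f) id c.

Definition proj_count A l (n : nat) : nat :=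
  #|[pred c : n.-tuple L | `[< (proj_word A c @` negative_quadrant) l >]]|.

Definition gamma A : \bar R :=
  expeR (ereal_sup [set limn_esup (fun n : nat =>
    ((n%:R^-1 : R)%:E * lne (proj_count A l n)%:R%:E)%E) | l in proj_line]).

(* The (q-1)-bunching condition. *)
Definition bunching A (d q : R) : Prop :=
  forall i : L,
    (gamma A * (sv1 (A i) `^ (q * d))%:E < (sv2 (A i) `^ ((q - 1) * d))%:E)%E.

Definition bunching_threshold A (d : R) : \bar R :=
  ereal_sup [set q%:E | q in [set q : R | 2 <= q /\ bunching A d q]].

End ProjectiveMaps.

Section LqDimension.
Context {R : realType}.
(* nu is only evaluated on mesh squares, so any set function will do. *)
Implicit Types (nu : set (plane R) -> \bar R) (q delta : R).

Definition mesh_square delta (p : int * int) : set (plane R) :=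
  [set x : plane R | p.1%:~R * delta <= x 0 0 <= (p.1 + 1)%:~R * delta /\
           p.2%:~R * delta <= x 1 0 <= (p.2 + 1)%:~R * delta].

(* The library has 0 `^ 0 = 1, whence the restriction to charged squares. *)
Definition Lq_moment nu q delta : \bar R :=
  \esum_(p in [set p | nu (mesh_square delta p) != 0%E])
    poweR (nu (mesh_square delta p)) q.

(* An esum is only meaningful for non-negative summands, whence the signs. *)
Definition sum_log nu delta : \bar R :=
  (- \esum_(p in [set: int * int])
       (- (fine (nu (mesh_square delta p)) *
           ln (fine (nu (mesh_square delta p)))))%:E)%E.

Definition Lq_ratio nu q delta : \bar R :=
  if q == 1 then (sum_log nu delta * ((ln delta)^-1)%:E)%E
  else (lne (Lq_moment nu q delta) * (((q - 1) * ln delta)^-1)%:E)%E.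

Definition upper_Lq_dim nu q : \bar R := limf_esup (Lq_ratio nu q) 0^'+.
Definition lower_Lq_dim nu q : \bar R := limf_einf (Lq_ratio nu q) 0^'+.

Definition has_Lq_dim nu q (D : \bar R) : Prop :=
  upper_Lq_dim nu q = D /\ lower_Lq_dim nu q = D.

End LqDimension.

Section HausdorffDimension.
Context {R : realType}.
Implicit Types (E U : set (plane R)) (s delta : R).

Definition diam U : \bar R :=
  ereal_sup [set (enorm (x - y))%:E | x in U & y in U].

Definition diam_pow s U : \bar R :=
  if U == set0 then 0%E else poweR (diam U) s.

Definition hausdorff_content s delta E : \bar R :=
  ereal_inf [set (\sum_(0 <= n <oo) diam_pow s (U n))%E |
    U in [set U : nat -> set (plane R) |
      (forall n, (diam (U n) <= delta%:E)%E) /\ E `<=` \bigcup_n U n]].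

Definition hausdorff_measure s E : \bar R :=
  ereal_sup [set hausdorff_content s delta E | delta in [set delta | 0 < delta]].

Definition hausdorff_dim E : \bar R :=
  ereal_inf [set s%:E | s in [set s | 0 <= s /\ hausdorff_measure s E = 0%E]].

End HausdorffDimension.

(* Main.v *)
Require Import Defs.
From mathcomp Require Import all_boot all_order all_algebra.
From mathcomp Require Import all_classical all_reals all_analysis.
From mathcomp Require Import ring lra.
Import Order.TTheory GRing.Theory Num.Theory.
Import numFieldNormedType.Exports.
Set Implicit Arguments.
Unset Strict Implicit.
Unset Printing Implicit Defensive.
Local Open Scope classical_set_scope.
Local Open Scope ring_scope.

(** The upper bounds come from coverings.  The pieces of the attractor have
    diameter of order sv1 and the sum of sv1 ^ d over a generation is bounded, so
    the Hausdorff dimension is at most d, and at most K * delta ^ (- d) mesh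
    squares carry mass (count_charged).

    The lower bounds all follow from one moment estimate (moment_bound): for a
    bunched exponent p + 1 and every s < d, the sum of nu(Q) ^ (p + 1) over the
    squares Q of side delta is at most a constant times delta ^ (p * s).  After
    discretisation by words of length N it becomes a bound for the energy, the
    sum over words a of m a * (mass of the words b with z b near z a) ^ p.  Words
    are grouped by their common prefix w.  Then z a - z b is the image under
    word_mx A w of a vector v, bounded away from zero by separation, and
    quasi-multiplicativity reduces everything to a bound, uniform in v and n, for
    the sum over w of sv1 w ^ (p * d + d) * (enorm v / enorm (w v)) ^ (p * d).

    That sum is where bunching enters (distortion_sum_bounded).  If v lies in the
    open positive cone, then w v has norm of order sv1 w * enorm v and the sum is
    comparable to the sum of sv1 ^ d.  If it does not, letters are split off one
    at a time.  Each of them costs at most kap, the largest value of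
    sv1 ^ ((p + 1) * d) / sv2 ^ (p * d) over the alphabet, and bunching says that
    kap * gamma < 1.  The vectors that still avoid the cone after K letters
    are those counted in the definition of gamma; compactness of the circle and
    upper semicontinuity of the count yield a bounded number K of letters, depending
    on the direction of v, after which kap ^ K times the count is below a fixed
    th < 1 (uniform_stopping).

    The count of charged squares and the moment of order p + 1 determine the
    exponents of all moments of order between 0 and p + 1 by interpolation with a
    threshold (scale_exponent_sandwich).  At q = 1 the squares must in addition
    have total mass tending to 1 although they overlap along their sides: no
    axis-parallel line carries mass when d > 0, because positivity keeps the
    pulled back lines away from some piece of a fixed generation
    (axis_line_null).  The lower bound for the Hausdorff dimension is the mass
    distribution principle, applied outside the squares of excessive mass, which
    the moment estimate makes rare. *)

(** * Euclidean norm and singular values in the plane *)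

Section EuclideanPlane.
Context {R : realType}.
Implicit Types (x y v : plane R) (M N : 'M[R]_2) (a k : R).

Lemma ord2_ind (P : 'I_2 -> Prop) : P 0 -> P 1 -> forall i, P i.
Proof.
move=> P0 P1 -[[|[|//]] hi].
  by rewrite (_ : Ordinal hi = 0) //; apply/val_inj.
by rewrite (_ : Ordinal hi = 1) //; apply/val_inj.
Qed.

Lemma plane_eq x y : x 0 0 = y 0 0 -> x 1 0 = y 1 0 -> x = y.
Proof.
by move=> h0 h1; apply/matrixP => i j; rewrite (ord1 j); move: i; apply: ord2_ind.
Qed.

Lemma big_ord2 (f : 'I_2 -> R) : \sum_(i < 2) f i = f 0 + f 1.
Proof.
by rewrite big_ord_recl big_ord1; congr (_ + f _); apply/val_inj.
Qed.

Lemma mulmx_col0 M x : (M *m x) 0 0 = M 0 0 * x 0 0 + M 0 1 * x 1 0.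
Proof. by rewrite mxE big_ord2. Qed.

Lemma mulmx_col1 M x : (M *m x) 1 0 = M 1 0 * x 0 0 + M 1 1 * x 1 0.
Proof. by rewrite mxE big_ord2. Qed.

Definition enormsq x : R := x 0 0 ^+ 2 + x 1 0 ^+ 2.

Lemma enormsq_ge0 x : 0 <= enormsq x.
Proof. by rewrite addr_ge0 // sqr_ge0. Qed.

Lemma enorm_ge0 x : 0 <= enorm x.
Proof. exact: sqrtr_ge0. Qed.

Lemma enorm_sqr x : enorm x ^+ 2 = enormsq x.
Proof. by rewrite sqr_sqrtr // enormsq_ge0. Qed.

Lemma enormZ k x : enorm (k *: x) = `|k| * enorm x.
Proof.
rewrite /enorm !mxE !exprMn -mulrDr sqrtrM ?sqr_ge0 //.
by rewrite sqrtr_sqr.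
Qed.

Lemma enormN x : enorm (- x) = enorm x.
Proof. by rewrite -scaleN1r enormZ normrN1 mul1r. Qed.

Lemma enorm0 : enorm (0 : plane R) = 0.
Proof. by rewrite -(scale0r (0 : plane R)) enormZ normr0 mul0r. Qed.

Lemma enorm_eq0 x : (enorm x == 0) = (x == 0).
Proof.
apply/eqP/eqP => [h|->]; last exact: enorm0.
have : enormsq x = 0 by rewrite -enorm_sqr h expr0n.
move/eqP; rewrite paddr_eq0 ?sqr_ge0 // !sqrf_eq0 => /andP[/eqP h0 /eqP h1].
by apply: plane_eq; rewrite ?h0 ?h1 mxE.
Qed.

Lemma enorm_gt0 x : (0 < enorm x) = (x != 0).
Proof. by rewrite lt_neqAle enorm_ge0 andbT eq_sym enorm_eq0. Qed.

Lemma enormD x y : enorm (x + y) <= enorm x + enorm y.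
Proof.
rewrite -(ler_pXn2r (n := 2)) ?nnegrE ?addr_ge0 ?enorm_ge0 //.
rewrite sqrrD !enorm_sqr /enormsq !mxE.
suff : x 0 0 * y 0 0 + x 1 0 * y 1 0 <= enorm x * enorm y by nra.
have h : (x 0 0 * y 0 0 + x 1 0 * y 1 0) ^+ 2 <= (enorm x * enorm y) ^+ 2.
  rewrite exprMn !enorm_sqr /enormsq.
  have := sqr_ge0 (x 0 0 * y 1 0 - x 1 0 * y 0 0); nra.
rewrite (le_trans (ler_norm _)) // -(ler_pXn2r (n := 2)) ?nnegrE ?normr_ge0 //.
  by rewrite real_normK // num_real.
by rewrite mulr_ge0 ?enorm_ge0.
Qed.

Lemma enormB_le y x z : enorm (x - z) <= enorm (x - y) + enorm (y - z).
Proof. by rewrite (le_trans _ (enormD _ _)) // addrA subrK. Qed.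

Lemma coord0_le_enorm x : `|x 0 0| <= enorm x.
Proof.
rewrite -(ler_pXn2r (n := 2)) ?nnegrE ?normr_ge0 ?enorm_ge0 //.
by rewrite real_normK ?num_real // enorm_sqr /enormsq lerDl sqr_ge0.
Qed.

Lemma coord1_le_enorm x : `|x 1 0| <= enorm x.
Proof.
rewrite -(ler_pXn2r (n := 2)) ?nnegrE ?normr_ge0 ?enorm_ge0 //.
by rewrite real_normK ?num_real // enorm_sqr /enormsq lerDr sqr_ge0.
Qed.

Lemma enorm_le_coord x : enorm x <= `|x 0 0| + `|x 1 0|.
Proof.
rewrite -(ler_pXn2r (n := 2)) ?nnegrE ?addr_ge0 ?normr_ge0 ?enorm_ge0 //.
rewrite enorm_sqr /enormsq sqrrD !real_normK ?num_real //.
by rewrite -addrA [_ *+ 2 + _]addrC addrA lerDl mulrn_wge0 // mulr_ge0.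
Qed.

End EuclideanPlane.

Section SingularValues.
Context {R : realType}.
Implicit Types (x y v : plane R) (M N : 'M[R]_2) (a k : R).

(** The hypothesis says that l is a root of the characteristic polynomial of the
    symmetric matrix with rows (a, b) and (b, c). *)
Lemma sym2_eigen (a b c l : R) : (l - a) * (l - c) = b ^+ 2 ->
  exists2 u : R * R, (u.1 * a + u.2 * b = l * u.1) /\ (u.1 * b + u.2 * c = l * u.2)
    & u.1 ^+ 2 + u.2 ^+ 2 = 1.
Proof.
move=> h.
suff [u [h1 h2] h3] : exists2 u : R * R,
  (u.1 * a + u.2 * b = l * u.1) /\ (u.1 * b + u.2 * c = l * u.2)
    & 0 < u.1 ^+ 2 + u.2 ^+ 2.
  pose s := Num.sqrt (u.1 ^+ 2 + u.2 ^+ 2).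
  have s0 : s != 0 by rewrite gt_eqF // sqrtr_gt0.
  exists (u.1 / s, u.2 / s) => /=.
    split; first by rewrite mulrAC (mulrAC u.2) -mulrDl h1 mulrA.
    by rewrite mulrAC (mulrAC u.2) -mulrDl h2 mulrA.
  by rewrite !expr_div_n -mulrDl sqr_sqrtr ?ltW // divff // gt_eqF.
have [b0|b0] := eqVneq b 0.
  move: h; rewrite b0 expr0n /= => /eqP; rewrite mulf_eq0 => /orP[]/eqP h.
    by exists (1, 0) => /=; [split; lra|rewrite expr1n expr0n addr0 ltr01].
  by exists (0, 1) => /=; [split; lra|rewrite expr1n expr0n add0r ltr01].
exists (b, l - a) => /=; first by split; nra.
by rewrite ltr_pwDl ?sqr_ge0 // exprn_even_gt0.
Qed.

(** The matrix with rows (A, -B) and (-B, C) is positive semidefinite of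
    determinant zero.  Up to sign, this is what remains of a symmetric matrix after
    an extreme eigenvalue has been subtracted from its diagonal. *)
Lemma psd_quadratic (A B C u v : R) : 0 <= A -> 0 <= C -> A * C = B ^+ 2 ->
  2 * B * u * v <= A * u ^+ 2 + C * v ^+ 2.
Proof.
move=> hA hC h; have [A0|A0] := eqVneq A 0.
  have -> : B = 0 by apply/eqP; rewrite -sqrf_eq0 -h A0 mul0r.
  by rewrite A0; nra.
have Ap : 0 < A by rewrite lt_neqAle eq_sym A0.
rewrite -(ler_pM2l Ap); have := sqr_ge0 (A * u - B * v); nra.
Qed.

(** The Gram matrix of M has entries a, b, c and eigenvalues lm <= lp; the
    singular values are therefore the extreme values of enorm (M *m x) on the
    unit circle, and both are attained. *)
Section GramEigenvalues.
Variable M : 'M[R]_2.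
Let a := M 0 0 ^+ 2 + M 1 0 ^+ 2.
Let c := M 0 1 ^+ 2 + M 1 1 ^+ 2.
Let b := M 0 0 * M 0 1 + M 1 0 * M 1 1.
Let D := (a - c) ^+ 2 + 4 * b ^+ 2.
Let lp := (a + c + Num.sqrt D) / 2.
Let lm := (a + c - Num.sqrt D) / 2.

Let D_ge0 : 0 <= D.
Proof. exact: addr_ge0 (sqr_ge0 _) (mulr_ge0 (ler0n _ _) (sqr_ge0 _)). Qed.

Let sD2 : Num.sqrt D ^+ 2 = D.
Proof. exact: sqr_sqrtr. Qed.

Let lp_root : (lp - a) * (lp - c) = b ^+ 2.
Proof.
transitivity ((Num.sqrt D ^+ 2 - (a - c) ^+ 2) / 4); first by rewrite /lp; field.
by rewrite sD2 /D; field.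
Qed.

Let lm_root : (lm - a) * (lm - c) = b ^+ 2.
Proof.
transitivity ((Num.sqrt D ^+ 2 - (a - c) ^+ 2) / 4); first by rewrite /lm; field.
by rewrite sD2 /D; field.
Qed.

Let sD_ge : `|a - c| <= Num.sqrt D.
Proof.
rewrite -(ler_pXn2r (n := 2)) ?nnegrE ?normr_ge0 ?sqrtr_ge0 // sD2.
by rewrite real_normK ?num_real // lerDl (mulr_ge0 (ler0n _ _) (sqr_ge0 _)).
Qed.

Let gramE : (M^T *m M) 0 0 = a /\ (M^T *m M) 1 1 = c /\
  (M^T *m M) 0 1 = b /\ (M^T *m M) 1 0 = b.
Proof.
rewrite !mxE !big_ord2 !mxE /a /b /c; split; first by ring.
by split; [ring|split; ring].
Qed.

Let enormsqM x : enormsq (M *m x) = a * x 0 0 ^+ 2 + 2 * b * x 0 0 * x 1 0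
   + c * x 1 0 ^+ 2.
Proof. by rewrite /enormsq mulmx_col0 mulmx_col1 /a /b /c; ring. Qed.

Let upper x : enormsq (M *m x) <= lp * enormsq x.
Proof.
rewrite enormsqM /enormsq.
have := sD_ge; rewrite ler_norml => /andP[h1 h2].
have ha : 0 <= lp - a by rewrite /lp; lra.
have hc : 0 <= lp - c by rewrite /lp; lra.
have := psd_quadratic (x 0 0) (x 1 0) ha hc lp_root; lra.
Qed.

Let lower x : lm * enormsq x <= enormsq (M *m x).
Proof.
rewrite enormsqM /enormsq.
have := sD_ge; rewrite ler_norml => /andP[h1 h2].
have ha : 0 <= a - lm by rewrite /lm; lra.
have hc : 0 <= c - lm by rewrite /lm; lra.
have h : (a - lm) * (c - lm) = b ^+ 2 by rewrite -lm_root; ring.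
have := psd_quadratic (x 0 0) (- x 1 0) ha hc h; lra.
Qed.

Let attained l : (l - a) * (l - c) = b ^+ 2 ->
  eigenvalue (M^T *m M) l /\ exists2 x, enorm x = 1 & enormsq (M *m x) = l.
Proof.
move=> /sym2_eigen[[u v] /= [h1 h2] h3].
have [g00 [g11 [g01 g10]]] := gramE.
split.
  apply/eigenvalueP; exists (\row_j (if j == 0 then u else v)).
    apply/rowP; apply: ord2_ind.
      by rewrite [LHS]mxE [RHS]mxE big_ord2 g00 g10 [in RHS]mxE /= -h1 !(mxE matrix_key).
    by rewrite [LHS]mxE [RHS]mxE big_ord2 g01 g11 [in RHS]mxE /= -h2 !(mxE matrix_key).
  apply/eqP => /rowP h; have := h 0; have := h 1; rewrite !mxE /= => v0 u0.
  by move: h3; rewrite u0 v0 !expr0n addr0 => /eqP; rewrite eq_sym oner_eq0.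
exists (\col_j (if j == 0 then u else v)).
  by rewrite /enorm !mxE /= h3 sqrtr1.
rewrite enormsqM !mxE /=.
transitivity ((u * a + v * b) * u + (u * b + v * c) * v); first by ring.
rewrite h1 h2; transitivity (l * (u ^+ 2 + v ^+ 2)); first by ring.
by rewrite h3 mulr1.
Qed.

Let eigen_bounds l : eigenvalue (M^T *m M) l -> lm <= l <= lp.
Proof.
move=> /eigenvalueP[r hr r0].
have [g00 [g11 [g01 g10]]] := gramE.
have h0 := congr1 (fun s : 'rV_2 => s 0 0) hr.
have h1 := congr1 (fun s : 'rV_2 => s 0 1) hr.
rewrite [LHS]mxE [RHS]mxE big_ord2 g00 g10 in h0.
rewrite [LHS]mxE [RHS]mxE big_ord2 g01 g11 in h1.
have r2 : 0 < enormsq r^T.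
  rewrite -enorm_sqr exprn_gt0 // enorm_gt0; apply: contra_neq r0 => /(congr1 trmx).
  by rewrite trmxK trmx0.
have := upper r^T; have := lower r^T.
have -> : enormsq (M *m r^T) = l * enormsq r^T.
  rewrite enormsqM /enormsq ![in LHS]mxE.
  transitivity ((r 0 0 * a + r 0 1 * b) * r 0 0 + (r 0 0 * b + r 0 1 * c) * r 0 1).
    by ring.
  by rewrite h0 h1 !mxE; ring.
by rewrite !ler_pM2r // => -> ->.
Qed.

Let sv1E : sv1 M = Num.sqrt lp.
Proof.
congr Num.sqrt; apply/eqP; rewrite eq_le; apply/andP; split.
  apply: ge_sup => [|l /= /eigen_bounds /andP[]//].
  by exists lp => /=; case: (attained lp_root).
apply: ub_le_sup; first by exists lp => l /= /eigen_bounds /andP[].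
by case: (attained lp_root).
Qed.

Let sv2E : sv2 M = Num.sqrt lm.
Proof.
congr Num.sqrt; apply/eqP; rewrite eq_le; apply/andP; split.
  apply: ge_inf; first by exists lm => l /= /eigen_bounds /andP[].
  by case: (attained lm_root).
apply: lb_le_inf => [|l /= /eigen_bounds /andP[]//].
by exists lm => /=; case: (attained lm_root).
Qed.

Lemma enorm_mulmx_le x : enorm (M *m x) <= sv1 M * enorm x.
Proof.
rewrite sv1E /enorm -/(enormsq _) -/(enormsq x).
have lp0 : 0 <= lp by case: (attained lp_root) => _ [y _ <-]; exact: enormsq_ge0.
by rewrite -sqrtrM // ler_wsqrtr // upper.
Qed.

Lemma enorm_mulmx_ge x : sv2 M * enorm x <= enorm (M *m x).
Proof.
rewrite sv2E /enorm -/(enormsq _) -/(enormsq x).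
have lm0 : 0 <= lm by case: (attained lm_root) => _ [y _ <-]; exact: enormsq_ge0.
by rewrite -sqrtrM // ler_wsqrtr // lower.
Qed.

Lemma sv1_attained : exists2 x, enorm x = 1 & enorm (M *m x) = sv1 M.
Proof.
rewrite sv1E; case: (attained lp_root) => _ [x x1 h]; exists x => //.
by rewrite -h.
Qed.

Lemma sv2_attained : exists2 x, enorm x = 1 & enorm (M *m x) = sv2 M.
Proof.
rewrite sv2E; case: (attained lm_root) => _ [x x1 h]; exists x => //.
by rewrite -h.
Qed.

End GramEigenvalues.

Lemma sv1_ge0 M : 0 <= sv1 M.
Proof. exact: sqrtr_ge0. Qed.

Lemma unit_vector_neq0 x : enorm x = 1 -> x != 0.
Proof. by move=> h; rewrite -enorm_gt0 h ltr01. Qed.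

Lemma mulmx_unit_neq0 M x : M \in unitmx -> x != 0 -> M *m x != 0.
Proof.
move=> Mu; apply: contra_neq => h.
by rewrite -(mulKmx Mu x) h mulmx0.
Qed.

Lemma sv1_gt0 M : M \in unitmx -> 0 < sv1 M.
Proof.
move=> Mu; have [x x1 <-] := sv1_attained M.
by rewrite enorm_gt0 mulmx_unit_neq0 // unit_vector_neq0.
Qed.

Lemma sv2_gt0 M : M \in unitmx -> 0 < sv2 M.
Proof.
move=> Mu; have [x x1 <-] := sv2_attained M.
by rewrite enorm_gt0 mulmx_unit_neq0 // unit_vector_neq0.
Qed.

Lemma sv1_1 : sv1 (1%:M : 'M[R]_2) = 1.
Proof. by have [x x1 <-] := sv1_attained 1%:M; rewrite mul1mx. Qed.

Lemma sv1M_le M N : sv1 (M *m N) <= sv1 M * sv1 N.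
Proof.
have [x x1 <-] := sv1_attained (M *m N); rewrite -mulmxA.
rewrite (le_trans (enorm_mulmx_le _ _)) // ler_wpM2l ?sv1_ge0 //.
by rewrite (le_trans (enorm_mulmx_le _ _)) // x1 mulr1.
Qed.

(** A unit vector that M stretches most is the image under N of a vector of norm
    at most 1 / sv2 N. *)
Lemma sv1M_ge M N : N \in unitmx -> sv1 M * sv2 N <= sv1 (M *m N).
Proof.
move=> Nu; have [x x1 h] := sv1_attained M.
pose y := invmx N *m x.
have Ny : N *m y = x by rewrite mulKVmx.
have y0 : 0 < enorm y.
  by rewrite enorm_gt0; apply: contra_neq (unit_vector_neq0 x1) => y0; rewrite -Ny y0 mulmx0.
rewrite -(ler_pM2r y0) (le_trans _ (enorm_mulmx_le _ _)) // -mulmxA Ny h -mulrA.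
by rewrite ler_piMr ?sv1_ge0 // -x1 -Ny enorm_mulmx_ge.
Qed.

Lemma sv1_le M k : (forall x, enorm (M *m x) <= k * enorm x) -> sv1 M <= k.
Proof.
by move=> h; have [x x1 <-] := sv1_attained M; rewrite (le_trans (h x)) // x1 mulr1.
Qed.

End SingularValues.

(** * Words and products of positive matrices *)

Lemma fin_pos_lower_bound (R : realFieldType) (T : finType) (f : T -> R) :
  (forall i, 0 < f i) -> exists2 e : R, 0 < e & forall i, e <= f i.
Proof.
move=> f0; pose s := 1 + \sum_i (f i)^-1.
have sum0 (P : pred T) : 0 <= \sum_(i | P i) (f i)^-1.
  by apply: sumr_ge0 => i _; rewrite invr_ge0 ltW.
have s0 : 0 < s by rewrite ltr_pwDl.
exists s^-1 => [|i]; first by rewrite invr_gt0.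
rewrite -[f i]invrK lef_pV2 ?posrE ?invr_gt0 //.
by rewrite /s (bigD1 i) //= addrCA lerDl addr_ge0.
Qed.

Lemma fin_upper_bound (R : realDomainType) (T : finType) (f : T -> R) :
  exists2 e : R, 0 < e & forall i, f i <= e.
Proof.
exists (1 + \sum_i `|f i|) => [|i]; first by rewrite ltr_pwDl // sumr_ge0.
rewrite (le_trans (ler_norm _)) // (bigD1 i) //= addrCA lerDl addr_ge0 //.
exact: sumr_ge0.
Qed.

Section Words.
Context {R : realType} {L : finPointedType}.
Implicit Types (w u v : seq L) (n m : nat).

Fixpoint words n : seq (seq L) :=
  if n is k.+1 then [seq i :: w | i <- enum L, w <- words k] else [:: [::]].

Lemma mem_words n w : (w \in words n) = (size w == n).
Proof.
elim: n w => [|n IH] [|i w] //=.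
  by apply/allpairsP => -[[j v]] /= [].
rewrite eqSS -IH; apply/allpairsP/idP => [[[j v]] /= [_ hv [_ ->]]//|hw].
by exists (i, w); rewrite mem_enum.
Qed.

Lemma size_words n w : w \in words n -> size w = n.
Proof. by rewrite mem_words => /eqP. Qed.

Lemma words_uniq n : uniq (words n).
Proof.
elim: n => [//|n IH] /=; apply: allpairs_uniq => //; first exact: enum_uniq.
by move=> [i u] [j v] _ _ /= [-> ->].
Qed.

Lemma sum_wordsS n (f : seq L -> R) :
  \sum_(w <- words n.+1) f w = \sum_i \sum_(w <- words n) f (i :: w).
Proof. by rewrite /= big_allpairs_dep big_enum. Qed.

Lemma sum_words_cat n m (f : seq L -> R) :
  \sum_(w <- words (n + m)) f w =
  \sum_(u <- words n) \sum_(v <- words m) f (u ++ v).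
Proof.
elim: n f => [|n IH] f; first by rewrite big_seq1.
by rewrite addSn !sum_wordsS; apply: eq_bigr => i _; rewrite IH.
Qed.

(** Letters are split off at the end because the last letter of a word acts on
    vectors first. *)
Lemma sum_words_rcons n (f : seq L -> R) :
  \sum_(w <- words n.+1) f w = \sum_i \sum_(w <- words n) f (rcons w i).
Proof.
rewrite exchange_big -addn1 sum_words_cat; apply: eq_bigr => w _.
rewrite sum_wordsS; apply: eq_bigr => i _.
by rewrite big_seq1 cats1.
Qed.

Lemma size_words_exp n : size (words n) = (#|L| ^ n)%N.
Proof. by elim: n => [//|n IH] /=; rewrite size_allpairs IH expnS cardE. Qed.

End Words.

Section WordMatrices.
Context {R : realType} {L : finPointedType}.
Variable A : L -> 'M[R]_2.
Implicit Types (w u v : seq L).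

Lemma word_mx_nil : word_mx A [::] = 1%:M.
Proof. by rewrite /word_mx big_nil. Qed.

Lemma word_mx_cons i w : word_mx A (i :: w) = A i *m word_mx A w.
Proof. by rewrite /word_mx big_cons. Qed.

Lemma word_mx_cat u v : word_mx A (u ++ v) = word_mx A u *m word_mx A v.
Proof. by rewrite /word_mx big_cat. Qed.

Lemma word_mx_rcons w i : word_mx A (rcons w i) = word_mx A w *m A i.
Proof. by rewrite -cats1 word_mx_cat word_mx_cons word_mx_nil mulmx1. Qed.

Lemma word_mx_unit w : (forall i, A i \in unitmx) -> word_mx A w \in unitmx.
Proof.
move=> Au; elim: w => [|i w IH]; first by rewrite word_mx_nil unitmx1.
by rewrite word_mx_cons unitmx_mul Au IH.
Qed.

Section Maps.
Variable t : L -> plane R.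
Let T := affine A t.

Lemma word_map_cat u v x : word_map T (u ++ v) x = word_map T u (word_map T v x).
Proof. by elim: u => [//|i u IH] /=; rewrite IH. Qed.

Lemma word_mapB w x y :
  word_map T w x - word_map T w y = word_mx A w *m (x - y).
Proof.
elim: w => [|i w IH] /=; first by rewrite word_mx_nil mul1mx.
by rewrite /T /affine word_mx_cons -mulmxA -IH mulmxBr opprD addrACA subrr addr0.
Qed.

End Maps.

Lemma word_mx_ge0 w j k : (forall i j k, 0 < A i j k) -> 0 <= word_mx A w j k.
Proof.
move=> Ap; elim: w j k => [|i w IH] j k.
  by rewrite word_mx_nil mxE ler0n.
by rewrite word_mx_cons mxE sumr_ge0 // => l _; rewrite mulr_ge0 // ltW.
Qed.

(** The ratio of the two entries in a row of a product is controlled by the last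
    factor alone.  Hence no cancellation occurs on a vector with both coordinates
    of the same sign, and it is expanded by the largest entry, up to a constant
    that is uniform over all products. *)
Lemma positive_cone_expansion : (forall i j k, 0 < A i j k) ->
  exists2 c : R, 0 < c & forall w (x : plane R), 0 < x 0 0 * x 1 0 ->
    c * sv1 (word_mx A w) * enorm x <= enorm (word_mx A w *m x).
Proof.
move=> Ap.
have [lo lo0 hlo] := fin_pos_lower_bound
  (f := fun ijk : L * ('I_2 * 'I_2) => A ijk.1 ijk.2.1 ijk.2.2) (fun=> Ap _ _ _).
have [hi hi0 hhi] := fin_upper_bound
  (fun ijk : L * ('I_2 * 'I_2) => A ijk.1 ijk.2.1 ijk.2.2).
have {}hlo i j k : lo <= A i j k := hlo (i, (j, k)).
have {}hhi i j k : A i j k <= hi := hhi (i, (j, k)).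
pose kap := lo / (lo + hi).
have kap0 : 0 < kap by rewrite divr_gt0 // addr_gt0.
have kap1 : kap <= 1 by rewrite ler_pdivrMr ?addr_gt0 // mul1r lerDl ltW.
exists (kap / 2) => [|w x x0]; first by rewrite divr_gt0.
have [->|[i [w' ->]]] : w = [::] \/ exists i w', w = rcons w' i.
  by case/lastP: w => [|w' i]; [left|right; exists i, w'].
  rewrite word_mx_nil sv1_1 mul1mx mulr1 ler_piMl ?enorm_ge0 //.
  by rewrite ler_pdivrMr // mul1r (le_trans kap1) // ler1n.
rewrite word_mx_rcons; set M' := word_mx A w'; set M := M' *m A i.
have M'0 j k : 0 <= M' j k by exact: word_mx_ge0.
have cmp j k l : lo * M j k <= hi * M j l.
  rewrite /M !mxE !big_ord2.
  apply: (@le_trans _ _ (lo * ((M' j 0 + M' j 1) * hi))).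
    by rewrite ler_wpM2l ?(ltW lo0) // mulrDl lerD // ler_wpM2l.
  rewrite mulrCA (mulrC _ hi) mulrCA [_ * lo]mulrC ler_wpM2l ?(ltW hi0) //.
  by rewrite mulrDr ![lo * _]mulrC lerD // ler_wpM2l.
have ratio j k : kap * (M j 0 + M j 1) <= M j k.
  rewrite /kap mulrAC ler_pdivrMr ?addr_gt0 // mulrDr.
  rewrite [leRHS]mulrC mulrDl.
  by move: k; apply: ord2_ind; [rewrite lerD2l|rewrite addrC lerD2l].
have M0 j k : 0 <= M j k.
  by rewrite mxE sumr_ge0 // => l _; rewrite mulr_ge0 // ltW.
have svM : sv1 M <= M 0 0 + M 0 1 + (M 1 0 + M 1 1).
  apply: sv1_le => y; rewrite (le_trans (enorm_le_coord _)) //.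
  rewrite mulmx_col0 mulmx_col1 mulrDl.
  have row j : `|M j 0 * y 0 0 + M j 1 * y 1 0| <= (M j 0 + M j 1) * enorm y.
    rewrite (le_trans (ler_normD _ _)) // !normrM !(ger0_norm (M0 _ _)) mulrDl.
    by rewrite lerD // ler_wpM2l // ?coord0_le_enorm ?coord1_le_enorm.
  by rewrite lerD.
have lowM : kap * (M 0 0 + M 0 1 + (M 1 0 + M 1 1)) * (`|x 0 0| + `|x 1 0|) <=
    2 * enorm (M *m x).
  have row j : kap * (M j 0 + M j 1) * (`|x 0 0| + `|x 1 0|) <=
      `|M j 0 * x 0 0 + M j 1 * x 1 0|.
    have -> : `|M j 0 * x 0 0 + M j 1 * x 1 0| = M j 0 * `|x 0 0| + M j 1 * `|x 1 0|.
      have [xp|xn] := ltrP 0 (x 0 0).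
        move: x0; rewrite pmulr_rgt0 // => yp.
        by rewrite (gtr0_norm xp) (gtr0_norm yp) ger0_norm // addr_ge0 // mulr_ge0 // ltW.
      have xn' : x 0 0 < 0.
        by rewrite lt_neqAle xn andbT; apply: contraTneq x0 => ->; rewrite mul0r ltxx.
      move: x0; rewrite nmulr_rgt0 // => yn.
      rewrite (ltr0_norm xn') (ltr0_norm yn) !mulrN -opprD ler0_norm //.
      by rewrite -oppr_ge0 opprD -!mulrN addr_ge0 // mulr_ge0 // oppr_ge0 ltW.
    by rewrite mulrDr lerD // ler_wpM2r // ratio.
  have h0 := coord0_le_enorm (M *m x); have h1 := coord1_le_enorm (M *m x).
  rewrite mulmx_col0 in h0; rewrite mulmx_col1 in h1.
  rewrite mulr_natl mulr2n [kap * _]mulrDr mulrDl lerD //.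
    exact: le_trans (row 0) h0.
  exact: le_trans (row 1) h1.
rewrite -(ler_pM2l (ltr0n R 2)) (le_trans _ lowM) // mulrA mulrA.
have -> : 2 * (kap / 2) = kap by field.
apply: ler_pM => //; first exact: mulr_ge0 (ltW kap0) (sv1_ge0 _).
- exact: enorm_ge0.
- by rewrite ler_pM2l.
exact: enorm_le_coord.
Qed.

End WordMatrices.

(** * Distortion sums *)

Lemma powR_le (R : realType) (r x y : R) :
  0 <= r -> 0 <= x -> x <= y -> x `^ r <= y `^ r.
Proof. by move=> r0 x0 xy; rewrite ge0_ler_powR ?nnegrE // (le_trans x0). Qed.

Lemma eq_ler (R : numDomainType) (x y : R) : x = y -> x <= y.
Proof. by move=> ->. Qed.

Section DistortionSums.
Context {R : realType} {L : finPointedType}.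
Variable A : L -> 'M[R]_2.
Hypothesis A_unit : forall i, A i \in unitmx.
Hypothesis A_pos : forall i j k, 0 < A i j k.
Variables b d kap C1 : R.
Hypotheses (b0 : 0 <= b) (d0 : 0 <= d) (kap0 : 0 < kap).
Hypothesis A_kap : forall i, sv1 (A i) `^ (b + d) <= kap * sv2 (A i) `^ b.
Hypothesis sum_sv1 : forall n, \sum_(w <- words n) sv1 (word_mx A w) `^ d <= C1.

(** The sum that governs the energy: with b = p * d, the weight
    sv1 ^ (b + d) is of the order of the (p + 1)-st power of the mass of a cylinder,
    and the second factor grows as v is contracted. *)
Definition distortion_sum n (v : plane R) : R :=
  \sum_(w <- words n) sv1 (word_mx A w) `^ (b + d) *
    (enorm v / enorm (word_mx A w *m v)) `^ b.

(** A line lies in the image of the negative quadrant under the projective maps of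
    a word exactly when the product of the matrices sends it into that quadrant, so
    gamma is the exponential growth rate of this count. *)
Definition bad_count n (v : plane R) : nat :=
  count (fun w => (word_mx A w *m v) 0 0 * (word_mx A w *m v) 1 0 <= 0) (words n).

Local Notation W := distortion_sum.

Let bd0 : 0 <= b + d. Proof. exact: addr_ge0. Qed.

Lemma distortion_sum_ge0 n v : 0 <= W n v.
Proof. by apply: sumr_ge0 => w _; rewrite mulr_ge0 ?powR_ge0. Qed.

(** The loss at one letter is at most sv1 ^ (b + d) / sv2 ^ b, whatever the
    direction of v. *)
Lemma distortion_sumS n (v : plane R) : v != 0 -> W n.+1 v <= kap * \sum_i W n (A i *m v).
Proof.
move=> v0; rewrite /W sum_words_rcons mulr_sumr.
apply: ler_sum => i _; rewrite mulr_sumr; apply: ler_sum => w _.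
rewrite word_mx_rcons -mulmxA; set y := A i *m v; set M := word_mx A w.
have y0 : y != 0 by exact: mulmx_unit_neq0.
have ey : 0 < enorm y by rewrite enorm_gt0.
have -> : enorm v / enorm (M *m y) = enorm v / enorm y * (enorm y / enorm (M *m y)).
  by rewrite mulrA divfK // gt_eqF.
have s2 := sv2_gt0 (A_unit i).
have step : sv1 (M *m A i) `^ (b + d) * (enorm v / enorm y) `^ b <=
    kap * sv1 M `^ (b + d).
  have h1 : sv1 (M *m A i) `^ (b + d) <= sv1 M `^ (b + d) * sv1 (A i) `^ (b + d).
    rewrite -powRM ?sv1_ge0 //; apply: powR_le; rewrite ?sv1_ge0 //.
    exact: sv1M_le.
  have h2 : sv2 (A i) `^ b * (enorm v / enorm y) `^ b <= 1.
    have r0 : 0 <= enorm v / enorm y by rewrite divr_ge0 ?enorm_ge0.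
    rewrite -powRM ?(ltW s2) // -[leRHS](congr1 (fun f => f b) (powR1 R)).
    apply: powR_le => //; first by rewrite mulr_ge0 ?(ltW s2).
    by rewrite mulrA ler_pdivrMr // mul1r enorm_mulmx_ge.
  have X0 := powR_ge0 (enorm v / enorm y) b.
  apply: (le_trans (ler_wpM2r X0 h1)).
  have h3 := ler_wpM2l (powR_ge0 (sv1 M) (b + d)) (A_kap i).
  apply: (le_trans (ler_wpM2r X0 h3)).
  rewrite mulrCA -!mulrA ler_pM2l // ler_piMr ?powR_ge0 //.
rewrite powRM ?divr_ge0 ?enorm_ge0 //.
have := ler_wpM2r (powR_ge0 (enorm y / enorm (M *m y)) b) step.
by rewrite -!mulrA.
Qed.

Lemma distortion_sum_iter K n (v : plane R) : v != 0 ->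
  W (K + n) v <= kap ^+ K * \sum_(u <- words K) W n (word_mx A u *m v).
Proof.
elim: K v => [|K IH] v v0.
  by rewrite big_seq1 word_mx_nil !mul1mx mul1r.
rewrite addSn (le_trans (distortion_sumS _ v0)) // exprS -mulrA ler_pM2l //.
rewrite sum_words_rcons [leRHS]mulr_sumr; apply: ler_sum => i _.
have e u : word_mx A (rcons u i) *m v = word_mx A u *m (A i *m v).
  by rewrite word_mx_rcons mulmxA.
have e2 : \sum_(u <- words K) W n (word_mx A (rcons u i) *m v) =
    \sum_(u <- words K) W n (word_mx A u *m (A i *m v)).
  by apply: eq_bigr => u _; rewrite e.
have h := IH (A i *m v) (mulmx_unit_neq0 (A_unit i) v0).
exact: le_trans h (ler_wpM2l (exprn_ge0 K (ltW kap0)) (eq_ler (esym e2))).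
Qed.

(** Inside the cone the contraction is comparable to sv1, and what remains is
    the sum of sv1 ^ d. *)
Lemma distortion_sum_cone : exists2 C2 : R, 0 < C2 &
  forall n (v : plane R), 0 < v 0 0 * v 1 0 -> W n v <= C2.
Proof.
have [c c0 hc] := positive_cone_expansion A_pos.
have C10 : 0 <= C1 by rewrite (le_trans _ (sum_sv1 0%N)) // sumr_ge0 // => w _; rewrite powR_ge0.
exists (c^-1 `^ b * C1 + 1) => [|n v v0].
  by rewrite ltr_wpDl // mulr_ge0 ?powR_ge0.
have vn : v != 0 by apply: contraTneq v0 => ->; rewrite !mxE mul0r ltxx.
rewrite (@le_trans _ _ (c^-1 `^ b * C1)) ?lerDl //.
rewrite (le_trans _ (ler_wpM2l (powR_ge0 _ _) (sum_sv1 n))) //.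
rewrite mulr_sumr; apply: ler_sum => w _.
set M := word_mx A w.
have Mu : M \in unitmx by exact: word_mx_unit.
have s1 := sv1_gt0 Mu.
have Mv : 0 < enorm (M *m v) by rewrite enorm_gt0 mulmx_unit_neq0.
rewrite (@le_trans _ _ (sv1 M `^ (b + d) * (c^-1 * (sv1 M)^-1) `^ b)) //.
  rewrite ler_wpM2l ?powR_ge0 //; apply: powR_le => //.
    by rewrite divr_ge0 ?enorm_ge0.
  rewrite ler_pdivrMr // -invfM mulrC ler_pdivlMr ?mulr_gt0 //.
  by have := hc w v v0; rewrite -/M; lra.
rewrite powRM ?invr_ge0 ?(ltW c0) ?(ltW s1) // mulrCA ler_wpM2l ?powR_ge0 //.
rewrite powRD; last by rewrite (gt_eqF s1) implybT.
by rewrite -(powR_inv1 (ltW s1)) -powRrM mulN1r powRN mulrAC divff ?mul1r // gt_eqF ?powR_gt0.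
Qed.

(** A vector outside the cone costs a factor kap at each letter.  After a suitable
    number K of letters, kap ^ K times the number of words that still leave it
    outside is at most th < 1, and strong induction on n closes up. *)
Lemma distortion_sum_bounded K0 th : th < 1 ->
  (forall v : plane R, v != 0 -> exists K, [/\ (0 < K)%N, (K <= K0)%N &
     kap ^+ K * (bad_count K v)%:R <= th]) ->
  exists2 C : R, 0 < C & forall n (v : plane R), v != 0 -> W n v <= C.
Proof.
move=> th1 hK; have [C2 C20 hC2] := distortion_sum_cone.
pose l : R := 1 + kap * #|L|%:R.
have l1 : 1 <= l by rewrite lerDl mulr_ge0 ?ler0n // ltW.
have l0 : 0 < l by rewrite (lt_le_trans ltr01).
have kapl K : kap ^+ K * (size (@words L K))%:R <= l ^+ K.
  rewrite size_words_exp natrX -exprMn lerXn2r ?nnegrE ?mulr_ge0 ?ler0n ?ltW //.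
  by rewrite ltr_pwDl.
have trivial_bound n v : v != 0 -> W n v <= l ^+ n.
  elim: n v => [|n IH] v v0.
    rewrite /W big_seq1 word_mx_nil sv1_1 powR1 mul1mx divff ?powR1 ?mul1r //.
    by rewrite gt_eqF // enorm_gt0.
  rewrite (le_trans (distortion_sumS _ v0)) //.
  rewrite (@le_trans _ _ (kap * \sum_(i : L) l ^+ n)) //.
    by rewrite ler_pM2l // ler_sum // => i _; apply: IH; exact: mulmx_unit_neq0.
  rewrite sumr_const -mulr_natr [l ^+ n * _]mulrC mulrA exprS.
  by rewrite ler_wpM2r ?exprn_ge0 ?ltW // ltr_pwDl.
have lK K : (K <= K0)%N -> l ^+ K <= l ^+ K0 by move=> h; exact: ler_weXn2l.
pose C := l ^+ K0 + C2 * l ^+ K0 / (1 - th).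
have th1' : 0 < 1 - th by rewrite subr_gt0.
have C0 : 0 < C by rewrite addr_gt0 ?divr_gt0 ?mulr_gt0 ?exprn_gt0.
exists C => // n; elim/ltn_ind: n => n IH v v0.
have [nK|nK] := ltnP n K0.
  rewrite (le_trans (trivial_bound n v v0)) // (le_trans (lK _ (ltnW nK))) //.
  by rewrite lerDl divr_ge0 ?mulr_ge0 ?exprn_ge0 ?ltW.
have [K [K1 KK0 hth]] := hK v v0.
have [m nE] : {m | n = (K + m)%N} by exists (n - K)%N; rewrite subnKC // (leq_trans KK0).
have mn : (m < n)%N by rewrite nE -[X in (X < _)%N]add0n ltn_add2r.
rewrite nE (le_trans (distortion_sum_iter K m v0)) //.
pose bad w := (word_mx A w *m v) 0 0 * (word_mx A w *m v) 1 0 <= 0.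
have bnd : \sum_(u <- words K) W m (word_mx A u *m v) <=
    (bad_count K v)%:R * C + (size (@words L K))%:R * C2.
  rewrite (bigID bad) /= lerD //.
    rewrite /bad_count -sum1_count natr_sum mulr_suml ler_sum // => u _.
    by rewrite mul1r IH // mulmx_unit_neq0 // word_mx_unit.
  rewrite (@le_trans _ _ (\sum_(u <- words K | ~~ bad u) C2)) //.
    by apply: ler_sum => u; rewrite /bad -ltNge => hu; exact: hC2.
  rewrite big_const_seq iter_addr_0 -[leLHS]mulr_natl ler_wpM2r ?(ltW C20) // ler_nat.
  exact: count_size.
rewrite (le_trans (ler_wpM2l (exprn_ge0 K (ltW kap0)) bnd)) // mulrDr !mulrA.
rewrite (@le_trans _ _ (th * C + l ^+ K0 * C2)) //.
  rewrite lerD ?ler_wpM2r ?(ltW C0) ?(ltW C20) //.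
  exact: le_trans (kapl K) (lK _ KK0).
have CE : th * C + l ^+ K0 * C2 + (1 - th) * l ^+ K0 = C.
  by rewrite /C; field; rewrite gt_eqF.
by rewrite -[leRHS]CE lerDl mulr_ge0 ?exprn_ge0 // ltW.
Qed.

End DistortionSums.

(** * The growth rate gamma *)

Section Stopping.
Context {R : realType} {L : finPointedType}.
Variable A : L -> 'M[R]_2.
Hypothesis A_unit : forall i, A i \in unitmx.

Definition angle_vec (th : R) : plane R := \col_j (if j == 0 then cos th else sin th).

Lemma angle_vec0 th : angle_vec th 0 0 = cos th. Proof. by rewrite mxE. Qed.
Lemma angle_vec1 th : angle_vec th 1 0 = sin th. Proof. by rewrite mxE. Qed.

Lemma enorm_angle_vec th : enorm (angle_vec th) = 1.
Proof. by rewrite /enorm angle_vec0 angle_vec1 cos2Dsin2 sqrtr1. Qed.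

Lemma polar_form (x : plane R) :
  exists2 th, - pi <= th <= pi & x = enorm x *: angle_vec th.
Proof.
have [->|x0] := eqVneq x 0.
  by exists 0; rewrite ?enorm0 ?scale0r // oppr_le0 !pi_ge0.
have e0 : 0 < enorm x by rewrite enorm_gt0.
pose c := x 0 0 / enorm x.
have c1 : -1 <= c <= 1.
  rewrite -ler_norml normrM normfV (gtr0_norm e0) ler_pdivrMr // mul1r.
  exact: coord0_le_enorm.
have cE : enorm x * cos (acos c) = x 0 0.
  by rewrite acosK ?in_itv //= mulrC divfK // gt_eqF.
have sE : enorm x * sin (acos c) = `|x 1 0|.
  rewrite sin_acos // -[enorm x in LHS]gtr0_norm // -sqrtr_sqr -sqrtrM ?sqr_ge0 //.
  rewrite -sqrtr_sqr; congr Num.sqrt.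
  rewrite mulrBr mulr1 -exprMn /c [enorm x * _]mulrC divfK ?gt_eqF //.
  by rewrite enorm_sqr /enormsq addrC addKr.
have a0 := acos_ge0 c1; have api := acos_lepi c1.
have [y0|y0] := leP 0 (x 1 0).
  exists (acos c); first by rewrite api (le_trans _ a0) // oppr_le0 pi_ge0.
  by apply: plane_eq; rewrite mxE ?angle_vec0 ?angle_vec1 ?cE // sE ger0_norm.
exists (- acos c); first by rewrite lerN2 api (le_trans _ (pi_ge0 R)) // oppr_le0.
apply: plane_eq; rewrite mxE ?angle_vec0 ?angle_vec1 ?cosN ?cE //.
by rewrite sinN mulrN sE ltr0_norm // opprK.
Qed.

Lemma line_image (M : 'M[R]_2) (k th th' : R) : k != 0 ->
  M *m angle_vec th = k *: angle_vec th' -> mulmx M @` line th = line th'.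
Proof.
move=> k0 h; apply/seteqP; split => y /=.
  move=> [z [r [z0 z1]] <-]; exists (r * k).
  have -> : z = r *: angle_vec th by apply: plane_eq; rewrite !mxE.
  by rewrite -scalemxAr h scalerA !mxE.
move=> [r [y0 y1]]; exists ((r / k) *: angle_vec th).
  by exists (r / k); rewrite !mxE.
rewrite -scalemxAr h scalerA divfK //.
by apply: plane_eq; rewrite !mxE.
Qed.

Lemma proj_word_cons i (c : seq L) (l : set (plane R)) :
  proj_word A (i :: c) l = proj_word A c (proj_map A i l).
Proof.
have gen (g h : set (plane R) -> set (plane R)) l1 l2 : g l1 = h l2 ->
    foldl (fun f i => proj_map A i \o f) g c l1 = foldl (fun f i => proj_map A i \o f) h c l2.
  by elim: c g h => [//|j c IH] g h e /=; apply: IH => /=; rewrite e.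
exact: gen.
Qed.

Lemma proj_wordK (c : seq L) (l : set (plane R)) :
  proj_word A c (mulmx (word_mx A c) @` l) = l.
Proof.
elim: c l => [|i c IH] l.
  rewrite word_mx_nil /proj_word /=; apply/seteqP; split => x /=.
    by move=> [y ly <-]; rewrite mul1mx.
  by move=> lx; exists x; rewrite ?mul1mx.
rewrite proj_word_cons -[RHS]IH; congr (proj_word A c _).
rewrite word_mx_cons /proj_map; apply/seteqP; split => x /=.
  by move=> [_ [y ly <-] <-]; exists y; rewrite // -mulmxA mulKmx.
move=> [y ly <-]; exists (A i *m word_mx A c *m y); first by exists y.
by rewrite -mulmxA mulKmx.
Qed.

(** If a product of the matrices sends the line at angle th to a line in the
    quadrant, then the composition of the inverse projective maps brings that
    line back to the line at angle th. *)
Lemma bad_count_le_proj_count n th :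
  (bad_count A n (angle_vec th) <= proj_count A (line th) n)%N.
Proof.
rewrite /bad_count -size_filter /proj_count cardE -[X in (_ <= X)%N](size_map val).
apply: uniq_leq_size; first by rewrite filter_uniq // words_uniq.
move=> w; rewrite mem_filter mem_words => /andP[bad sw].
apply/mapP; exists (Tuple sw) => //.
rewrite mem_enum inE; apply/asboolP; rewrite /=; apply/asboolP.
have [th' _ hth'] := polar_form (word_mx A w *m angle_vec th).
have k0 : enorm (word_mx A w *m angle_vec th) != 0.
  by rewrite enorm_eq0 mulmx_unit_neq0 ?word_mx_unit // unit_vector_neq0 ?enorm_angle_vec.
have lE := line_image k0 hth'.
exists (line th'); last by rewrite -lE proj_wordK.
rewrite /negative_quadrant /setI /=; split; first by exists th'.
move=> x [r [-> ->]].
move: bad; rewrite hth' !mxE mulrACA pmulr_rle0; last first.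
  by rewrite -expr2 exprn_even_gt0.
by move=> h; rewrite mulrACA mulr_ge0_le0 // -expr2 sqr_ge0.
Qed.

Lemma scale_coord k (x : plane R) i : (k *: x) i 0 = k * x i 0.
Proof. by rewrite mxE. Qed.

Lemma bad_countZ n k v : k != 0 -> bad_count A n (k *: v) = bad_count A n v.
Proof.
move=> k0; apply: eq_count => w /=; rewrite -!scalemxAr !scale_coord mulrACA.
by rewrite pmulr_rle0 // -expr2 exprn_even_gt0.
Qed.

Lemma near_all_seq (T : eqType) (X : topologicalType) (x : X) (s : seq T)
    (P : T -> X -> Prop) : (forall t, t \in s -> \forall y \near x, P t y) ->
  \forall y \near x, forall t, t \in s -> P t y.
Proof.
elim: s => [|a s IH] h; first by near=> y.
have ha := h a (mem_head a s).
have {}IH : \forall y \near x, forall t, t \in s -> P t y.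
  by apply: IH => t ts; apply: h; rewrite inE ts orbT.
by near=> y => t; rewrite inE => /predU1P[->|ts]; [near: y|move: t ts; near: y].
Unshelve. all: by end_near. Qed.

(** The count is upper semicontinuous because the open positive cone is open. *)
Lemma bad_count_usc n th0 :
  \forall th \near th0, (bad_count A n (angle_vec th) <= bad_count A n (angle_vec th0))%N.
Proof.
pose f w th := (word_mx A w *m angle_vec th) 0 0 * (word_mx A w *m angle_vec th) 1 0.
have fc w : continuous (f w).
  move=> th; rewrite /f.
  have -> : (fun th => (word_mx A w *m angle_vec th) 0 0 *
      (word_mx A w *m angle_vec th) 1 0) =
    (fun th => (word_mx A w 0 0 * cos th + word_mx A w 0 1 * sin th) *
      (word_mx A w 1 0 * cos th + word_mx A w 1 1 * sin th)).
    by apply/funext => s; rewrite mulmx_col0 mulmx_col1 !angle_vec0 !angle_vec1.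
  by apply: cvgM; apply: cvgD; apply: cvgM; (try exact: cvg_cst);
    first [exact: continuous_cos|exact: continuous_sin].
have : \forall th \near th0, forall w, w \in words n -> f w th <= 0 -> f w th0 <= 0.
  apply: near_all_seq => w _; have [h|h] := leP (f w th0) 0; first by near=> th.
  have : \forall t \near th0, 0 < f w t by apply: (cvgr_gt _ (fc w th0)).
  by apply: (@filterS _ (nbhs th0)) => t h1; rewrite leNgt h1.
apply: (@filterS _ (nbhs th0)) => th h; rewrite /bad_count -!size_filter.
apply: uniq_leq_size; first by rewrite filter_uniq // words_uniq.
by move=> w; rewrite !mem_filter => /andP[bad ws]; rewrite ws andbT; exact: h.
Unshelve. all: by end_near. Qed.

Variable kap : R.
Hypothesis kap0 : 0 < kap.
Hypothesis gamma_kap : (gamma A * kap%:E < 1)%E.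

(** Since kap < 1 / gamma, the upper growth rate in each single direction is
    strictly below - ln kap. *)
Lemma bad_count_decay th :
  exists2 n, (0 < n)%N & kap ^+ n * (bad_count A n (angle_vec th))%:R < 1.
Proof.
pose u n := ((n%:R^-1 : R)%:E * lne (proj_count A (line th) n)%:R%:E)%E.
have us : (limn_esup u < (- ln kap)%:E)%E.
  move: gamma_kap; rewrite /gamma; set S := ereal_sup _ => hS.
  have : (limn_esup u <= S)%E by apply: ereal_sup_ubound; exists (line th) => //; exists th.
  move=> /le_lt_trans; apply.
  case: S hS => [r| |] /=; last by rewrite ltNyr.
    rewrite -EFinM !lte_fin => h.
    by rewrite -ltr_expR expRN lnK ?posrE // -[_^-1]mul1r ltr_pdivlMr.
  by rewrite mulyr gtr0_sg // mul1e ltNge leey.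
have [_ [V [N _ hN]] <-] := ereal_inf_lt us.
move=> hV.
have uN : (u N.+1 < (- ln kap)%:E)%E.
  apply: le_lt_trans hV; apply: ereal_sup_ubound; exists N.+1 => //.
  by apply: hN => /=.
exists N.+1 => //.
apply: (@le_lt_trans _ _ (kap ^+ N.+1 * (proj_count A (line th) N.+1)%:R)).
  by rewrite ler_wpM2l ?exprn_ge0 ?(ltW kap0) // ler_nat bad_count_le_proj_count.
move: uN; rewrite /u; case: (proj_count A (line th) N.+1) => [|k] uN.
  by rewrite mulr0.
move: uN; rewrite lne_EFin ?ltr0n // -EFinM lte_fin ltr_pdivrMl ?ltr0n // => uN.
rewrite -[ltRHS](@expR0 R) -[ltLHS]lnK ?posrE ?mulr_gt0 ?exprn_gt0 ?ltr0n // ltr_expR.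
rewrite lnM ?posrE ?exprn_gt0 ?ltr0n // lnXn // -[ln kap *+ _]mulr_natl.
by move: uN; rewrite mulrN; lra.
Qed.

(** By compactness of the circle the lengths at which the bad words become rare
    are bounded, with a uniform gain. *)
Lemma uniform_stopping : exists K0, exists2 th : R, th < 1 &
  forall v : plane R, v != 0 -> exists K, [/\ (0 < K)%N, (K <= K0)%N &
     kap ^+ K * (bad_count A K v)%:R <= th].
Proof.
pose P i th := exists K, [/\ (0 < K)%N, (K <= i)%N &
     kap ^+ K * (bad_count A K (angle_vec th))%:R <= 1 - i.+1%:R^-1].
have cpt : compact `[- pi, (pi : R)]%classic by exact: segment_compact.
have near_cov : \forall i \near \oo, `[- pi, (pi : R)]%classic `<=` P i.
  apply: (proj1 (compact_near_coveringP _) cpt) => th0 _.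
  have [n n0 hn] := bad_count_decay th0.
  set a := _ * _ in hn.
  have hi : \forall i \near \oo, (i.+1%:R^-1 : R) <= 1 - a.
    have : \forall i \near \oo, (harmonic i : R) < 1 - a.
      by apply: (cvgr_lt _ (@cvg_harmonic R)); rewrite subr_gt0.
    by apply: filterS => i; rewrite /harmonic => /ltW.
  near=> th i => /=; exists n; split=> //.
    by near: i; exact: nbhs_infty_ge.
  apply: (@le_trans _ _ a).
    rewrite ler_wpM2l ?exprn_ge0 ?(ltW kap0) // ler_nat.
    by near: th; exact: bad_count_usc.
  by rewrite lerBrDr addrC -lerBrDr; near: i.
have [i hi] : exists i, `[- pi, (pi : R)]%classic `<=` P i.
  by case: near_cov => i _ h; exists i; apply: h => /=.
exists i, (1 - i.+1%:R^-1); first by rewrite ltrBlDr ltrDl invr_gt0 ltr0n.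
move=> v v0; have [th hth vE] := polar_form v.
have [|K [K0 Ki h]] := hi th; first by rewrite /= in_itv.
by exists K; split=> //; rewrite vE bad_countZ // enorm_eq0.
Unshelve. all: by end_near. Qed.

End Stopping.

(** * Energy of quasi-multiplicative weights *)

Section PowerSums.
Context {R : realType}.

Lemma powR_sum_le (s : seq R) (p : R) : 0 < p -> (forall x, x \in s -> 0 <= x) ->
  (\sum_(x <- s) x) `^ p <= (size s)%:R `^ p * \sum_(x <- s) x `^ p.
Proof.
move=> p0 s0.
have [M [M0 xM Mp]] : exists M : R, [/\ 0 <= M, forall x, x \in s -> x <= M
    & M `^ p <= \sum_(x <- s) x `^ p].
  elim: s s0 => [|x s IH] s0.
    by exists 0; split=> //; rewrite big_nil powR0 // gt_eqF.
  have [|M [M0 xM Mp]] := IH; first by move=> y ys; apply: s0; rewrite inE ys orbT.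
  have x0 : 0 <= x by apply: s0; exact: mem_head.
  have sum0 : 0 <= \sum_(x <- s) x `^ p by apply: sumr_ge0 => i _; exact: powR_ge0.
  exists (Num.max x M); split.
  - by rewrite le_max x0.
  - by move=> y; rewrite inE le_max => /predU1P[->|/xM ->]; rewrite ?lexx ?orbT.
  rewrite big_cons; have [_|_] := leP x M; last by rewrite lerDl.
  by rewrite (le_trans Mp) // lerDr powR_ge0.
have sum0 : 0 <= \sum_(x <- s) x by rewrite big_seq sumr_ge0.
have sumM : \sum_(x <- s) x <= (size s)%:R * M.
  elim: s xM {s0 Mp sum0} => [|x s IH] xM; first by rewrite big_nil mul0r.
  rewrite big_cons /= -natr1 mulrDl mul1r addrC lerD //.
    by apply: IH => y ys; apply: xM; rewrite inE ys orbT.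
  by apply: xM; exact: mem_head.
rewrite (le_trans (powR_le (ltW p0) sum0 sumM)) // powRM ?ler0n //.
by rewrite ler_wpM2l ?powR_ge0.
Qed.

End PowerSums.

(** A word b different from a leaves it after exactly n letters, for a unique
    n < N. *)
Lemma sum_words_split (R : realType) (L : finPointedType) N (a : seq L)
    (f : seq L -> R) : size a = N ->
  \sum_(b <- words N) f b = f a + \sum_(n < N) \sum_(b <- words (N - n) |
     ohead b != ohead (drop n a)) f (take n a ++ b).
Proof.
elim: N a f => [|N IH] [|i a] f //=.
  by rewrite big_seq1 big_ord0 addr0.
move=> [sa]; rewrite sum_wordsS (bigD1 i) //= (IH a (fun b => f (i :: b)) sa).
rewrite big_ord_recl /= -addrA; congr (_ + _); rewrite addrC; congr (_ + _).
rewrite ?subn0 [RHS]big_mkcond /= [RHS]sum_wordsS [LHS]big_mkcond /=.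
apply: eq_bigr => j _; rewrite -[Some j == Some i]/(j == i).
by case: (j == i) => //=; rewrite big1.
Qed.

Section DiscreteEnergy.
Context {R : realType} {L : finPointedType}.
Variables (A : L -> 'M[R]_2) (m : seq L -> R) (z : seq L -> plane R).
Variables (d p C C1 c0 CW : R).
Hypothesis A_unit : forall i, A i \in unitmx.
Hypothesis d0 : 0 <= d.
Hypothesis p1 : 1 <= p.
Hypothesis m_ge0 : forall w, 0 <= m w.
Hypothesis m_nil : m [::] = 1.
Hypothesis m_rcons : forall w, \sum_i m (rcons w i) = m w.
Hypothesis m_cat : forall u v, m (u ++ v) <= C * (m u * m v).
Hypothesis m_sv1 : forall w, m w <= C1 * sv1 (word_mx A w) `^ d.
Hypothesis zB : forall w a b, z (w ++ a) - z (w ++ b) = word_mx A w *m (z a - z b).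
Hypothesis c00 : 0 < c0.
Hypothesis z_sep : forall i j a b, i != j -> c0 <= enorm (z (i :: a) - z (j :: b)).
Hypothesis distortion : forall n (v : plane R), v != 0 ->
  distortion_sum A (p * d) d n v <= CW.

Let p0 : 0 < p. Proof. exact: lt_le_trans ltr01 p1. Qed.

Lemma sum_m_cat w n : \sum_(v <- words n) m (w ++ v) = m w.
Proof.
elim: n w => [|n IH] w; first by rewrite big_seq1 cats0.
rewrite sum_words_rcons exchange_big /= -[RHS](IH w); apply: eq_bigr => v _.
by rewrite -m_rcons; apply: eq_bigr => i _; rewrite rcons_cat.
Qed.

Lemma sum_m n : \sum_(v <- words n) m v = 1.
Proof. by rewrite -m_nil -(sum_m_cat [::] n). Qed.

Let C_ge0 : 0 <= C.
Proof. by have := m_cat [::] [::]; rewrite m_nil !mulr1; apply: le_trans. Qed.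

Let C1_ge0 : 0 <= C1.
Proof.
have := m_sv1 [::]; rewrite word_mx_nil sv1_1 m_nil powR1 mulr1.
exact: le_trans.
Qed.

Let K := C ^+ 2 * C1 `^ (p + 1) * c0^-1 `^ (p * d).

(** Nearness is converted into a power of r / enorm (word_mx A w *m v): this
    ratio is at least one for points at distance at most r. *)
Lemma energy_term w a b r : 0 <= r -> ohead b != ohead a -> (0 < size a)%N -> (0 < size b)%N ->
    enorm (z (w ++ a) - z (w ++ b)) <= r ->
  m (w ++ a) * (m w `^ (p - 1) * m (w ++ b)) <=
  K * r `^ (p * d) * (m a * m b * (sv1 (word_mx A w) `^ (p * d + d) *
    (enorm (z a - z b) / enorm (word_mx A w *m (z a - z b))) `^ (p * d))).
Proof.
move=> r0 ab sa sb near_ab.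
have cv : c0 <= enorm (z a - z b).
  case: a b sa sb ab {near_ab} => [//|i a] [//|j b] _ _ /= ab.
  by apply: z_sep; apply: contraNneq ab => ->.
set v := z a - z b in cv *.
have ev : 0 < enorm v by exact: lt_le_trans cv.
have v0 : v != 0 by rewrite -enorm_gt0.
set M := word_mx A w.
have eM : 0 < enorm (M *m v) by rewrite enorm_gt0 mulmx_unit_neq0 // word_mx_unit.
rewrite zB -/v -/M in near_ab.
have pd0 : 0 <= p * d by rewrite mulr_ge0 // ltW.
have step1 : m (w ++ a) * (m w `^ (p - 1) * m (w ++ b)) <=
    C ^+ 2 * (m a * m b) * m w `^ (p + 1).
  have -> : m w `^ (p + 1) = m w `^ (p - 1) * (m w * m w).
    have [w0|w0] := eqVneq (m w) 0.
      by rewrite w0 !mulr0 powR0 // gt_eqF // ltr_wpDl // ltW.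
    rewrite -[X in _ * (X * X)]powRr1 // -!powRD ?w0 ?implybT //.
    by congr powR; ring.
  have -> : C ^+ 2 * (m a * m b) * (m w `^ (p - 1) * (m w * m w)) =
    (C * (m w * m a)) * (m w `^ (p - 1) * (C * (m w * m b))) by ring.
  apply: ler_pM => //; first by rewrite mulr_ge0 ?powR_ge0.
  by rewrite ler_wpM2l ?powR_ge0.
have step2 : m w `^ (p + 1) <= C1 `^ (p + 1) * sv1 M `^ (p * d + d).
  have -> : p * d + d = d * (p + 1) by ring.
  rewrite powRrM -powRM ?powR_ge0 //; apply: powR_le => //.
  by rewrite addr_ge0 // ltW.
have step3 : 1 <= c0^-1 `^ (p * d) * r `^ (p * d) *
    (enorm v / enorm (M *m v)) `^ (p * d).
  rewrite -!powRM ?invr_ge0 ?divr_ge0 ?mulr_ge0 ?invr_ge0 ?(ltW c00) ?enorm_ge0 //.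
  rewrite -[leLHS](congr1 (fun f => f (p * d)) (powR1 R)); apply: powR_le => //.
  rewrite mulrA ler_pdivlMr // mul1r (le_trans near_ab) // mulrAC ler_peMl //.
  by rewrite mulrC ler_pdivlMr // mul1r.
apply: (le_trans step1).
have X0 : 0 <= C ^+ 2 * (m a * m b) by rewrite mulr_ge0 ?exprn_ge0 ?mulr_ge0.
apply: (le_trans (ler_wpM2l X0 step2)).
have Y0 : 0 <= C ^+ 2 * (m a * m b) * (C1 `^ (p + 1) * sv1 M `^ (p * d + d)).
  by rewrite mulr_ge0 ?mulr_ge0 ?powR_ge0.
have := ler_wpM2l Y0 step3; rewrite mulr1 => h; apply: (le_trans h).
by apply: eq_ler; rewrite /K; ring.
Qed.

(** Words that leave a after exactly n letters are treated together: with w the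
    common prefix, the difference of the base points is the image under word_mx A w
    of a vector that separation keeps away from zero. *)
Definition energy_slice N r n a : R :=
  \sum_(b <- words (N - n) | (ohead b != ohead (drop n a)) &&
     (enorm (z a - z (take n a ++ b)) <= r)) m (take n a ++ b).

Lemma energy_slice_ge0 N r n a : 0 <= energy_slice N r n a.
Proof. exact: sumr_ge0. Qed.

(** A slice has mass at most m w, so its p-th power is at most m w ^ (p - 1)
    times the slice itself; this makes the estimate linear in the second word, and
    the sum over the prefixes w becomes a distortion sum. *)
Lemma energy_slice_le N r n : (n < N)%N -> 0 <= r ->
  \sum_(a <- words N) m a * energy_slice N r n a `^ p <= K * r `^ (p * d) * CW.
Proof.
move=> nN r0; have [k [k0 NE]] : exists k, (0 < k)%N /\ N = (n + k)%N.
  by exists (N - n)%N; rewrite subn_gt0 subnKC // ltnW.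
have Kr0 : 0 <= K * r `^ (p * d).
  by rewrite mulr_ge0 ?powR_ge0 // mulr_ge0 ?powR_ge0 // mulr_ge0 ?powR_ge0 ?exprn_ge0.
pose v a b := z a - z b.
pose D w a b : R := sv1 (word_mx A w) `^ (p * d + d) *
    (enorm (v a b) / enorm (word_mx A w *m v a b)) `^ (p * d).
have D0 w a b : 0 <= D w a b by rewrite mulr_ge0 ?powR_ge0.
pose sep_sum w a : R := \sum_(b <- words k | ohead b != ohead a) m a * m b * D w a b.
have step w a : w \in words n -> a \in words k ->
  m (w ++ a) * energy_slice N r n (w ++ a) `^ p <= K * r `^ (p * d) * sep_sum w a.
  move=> /size_words sw /size_words sa; set E := energy_slice _ _ _ _.
  have EE : E = \sum_(b <- words k | (ohead b != ohead a) &&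
     (enorm (z (w ++ a) - z (w ++ b)) <= r)) m (w ++ b).
    by rewrite /E /energy_slice NE -{2 4 5}sw take_size_cat // drop_size_cat // sw addKn.
  have E0 : 0 <= E by exact: energy_slice_ge0.
  have Ew : E <= m w.
    rewrite EE -(sum_m_cat w k) big_mkcond /=; apply: ler_sum => b _.
    by case: ifP.
  have Ep : E `^ p <= m w `^ (p - 1) * E.
    rewrite -(mulr_powRB1 E0 p0) mulrC ler_wpM2r //; apply: powR_le => //.
    by rewrite subr_ge0.
  apply: (le_trans (ler_wpM2l (m_ge0 _) Ep)).
  rewrite EE !mulr_sumr big_mkcond /= [leRHS]big_mkcond /= big_seq [leRHS]big_seq.
  apply: ler_sum => b /size_words sb; case: ifP => [/andP[ab near_ab]|_].
    by rewrite ab; apply: energy_term; rewrite ?sa ?sb.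
  case: ifP => [_|_]; last by [].
    exact: mulr_ge0 Kr0 (mulr_ge0 (mulr_ge0 (m_ge0 _) (m_ge0 _)) (D0 _ _ _)).
rewrite NE sum_words_cat.
apply: (@le_trans _ _ (\sum_(w <- words n) \sum_(a <- words k)
    K * r `^ (p * d) * sep_sum w a)).
  rewrite big_seq [leRHS]big_seq; apply: ler_sum => w hw.
  rewrite big_seq [leRHS]big_seq; apply: ler_sum => a ha.
  by rewrite -NE; exact: step.
rewrite exchange_big /=.
apply: (@le_trans _ _ (\sum_(a <- words k) \sum_(b <- words k)
    K * r `^ (p * d) * CW * (m a * m b))); last first.
  under eq_bigr => a _ do rewrite -mulr_sumr -mulr_sumr sum_m mulr1.
  by rewrite -mulr_sumr sum_m mulr1.
rewrite big_seq [leRHS]big_seq; apply: ler_sum => a /size_words sa.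
under eq_bigr do rewrite mulr_sumr.
rewrite exchange_big /= big_mkcond /= big_seq [leRHS]big_seq.
apply: ler_sum => b /size_words sb.
have CW0 : 0 <= CW.
  have one : (\col_j 1 : plane R) != 0.
    by apply/eqP => /matrixP /(_ 0 0); rewrite !mxE => /eqP; rewrite oner_eq0.
  exact: le_trans (distortion_sum_ge0 _ _ _ _ _) (distortion 0%N one).
case: ifP => [ab|_]; last first.
  exact: mulr_ge0 (mulr_ge0 Kr0 CW0) (mulr_ge0 (m_ge0 _) (m_ge0 _)).
have v0 : v a b != 0.
  rewrite /v -enorm_gt0; apply: lt_le_trans c00 _.
  case: a b sa sb ab => [|i a] [|j b] /=; try by move=> h; rewrite -h in k0.
    by move=> _ h; rewrite -h in k0.
  by move=> _ _ ab; apply: z_sep; apply: contraNneq ab => ->.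
rewrite -mulr_sumr -mulr_sumr.
have -> : K * r `^ (p * d) * CW * (m a * m b) = K * r `^ (p * d) * (m a * m b * CW).
  by rewrite [LHS]mulrAC [RHS]mulrA.
apply: (ler_wpM2l Kr0); apply: ler_wpM2l; first exact: mulr_ge0.
exact: distortion v0.
Qed.

(** The total energy at scale r: only a power of the word length is lost in
    separating the scales. *)
Lemma energy_le N r e : 0 <= r -> (forall a, size a = N -> m a <= e) ->
  \sum_(a <- words N) m a * (\sum_(b <- words N | enorm (z a - z b) <= r) m b) `^ p
  <= N.+1%:R `^ p * (e `^ p + N%:R * (K * r `^ (p * d) * CW)).
Proof.
move=> r0 he.
have step a : a \in words N ->
  (\sum_(b <- words N | enorm (z a - z b) <= r) m b) `^ p <=
  N.+1%:R `^ p * (m a `^ p + \sum_(n < N) energy_slice N r n a `^ p).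
  move=> /size_words sa.
  have -> : \sum_(b <- words N | enorm (z a - z b) <= r) m b =
      \sum_(x <- m a :: [seq energy_slice N r n a | n : 'I_N]) x.
    rewrite big_mkcond /= (sum_words_split _ sa) big_cons big_image /=.
    rewrite subrr enorm0 r0; congr (_ + _); apply: eq_bigr => n _.
    by rewrite -big_mkcondr.
  apply: (le_trans (powR_sum_le p0 _)).
    by move=> x; rewrite inE => /predU1P[->//|/mapP[n _ ->]]; exact: energy_slice_ge0.
  by rewrite /= size_map -cardE card_ord big_cons big_image.
apply: (@le_trans _ _ (\sum_(a <- words N) N.+1%:R `^ p *
   (m a * e `^ p + \sum_(n < N) m a * energy_slice N r n a `^ p))).
  rewrite big_seq [leRHS]big_seq; apply: ler_sum => a ha.
  apply: (le_trans (ler_wpM2l (m_ge0 a) (step a ha))).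
  rewrite mulrCA ler_wpM2l ?powR_ge0 // mulrDr mulr_sumr lerD2r ler_wpM2l //.
  by apply: powR_le; rewrite ?(ltW p0) // he // (size_words ha).
rewrite -mulr_sumr ler_wpM2l ?powR_ge0 // big_split /= -mulr_suml sum_m mul1r.
rewrite lerD2l exchange_big /=.
rewrite (le_trans (ler_sum _ (fun (n : 'I_N) _ => energy_slice_le (ltn_ord n) r0))) //.
by rewrite sumr_const card_ord mulr_natl.
Qed.

End DiscreteEnergy.

(** * Geometry of the attractor *)

Section PlaneTopology.
Context {R : realType}.
Implicit Types (x y : plane R) (P : set (plane R)).

Lemma nbhs_enorm x (P : set (plane R)) :
  nbhs x P <-> exists2 e : R, 0 < e & forall y, enorm (x - y) < e -> P y.
Proof.
split.
  move=> /nbhs_ballP[e /= e0 he]; exists e => // y hy; apply: he.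
  split=> // i j; rewrite (ord1 j) /ball /=.
  apply: le_lt_trans hy; move: i; apply: ord2_ind.
    by have := coord0_le_enorm (x - y); rewrite !mxE.
  by have := coord1_le_enorm (x - y); rewrite !mxE.
move=> [e e0 he]; apply/nbhs_ballP; exists (e / 2); first by rewrite /= divr_gt0.
move=> y [_ hy]; apply: he; apply: (le_lt_trans (enorm_le_coord _)).
have h0 := hy 0 0; have h1 := hy 1 0; rewrite /ball /= in h0 h1.
by rewrite !mxE [ltRHS](splitr e) ltrD.
Qed.

Lemma closed_enorm P x : closed P -> (forall e : R, 0 < e -> exists2 y, P y & enorm (x - y) < e) -> P x.
Proof.
move=> cP h; apply: cP => B /nbhs_enorm[e e0 he].
by have [y Py xy] := h e e0; exists y; split => //; exact: he.
Qed.

Lemma not_closed_enorm P x : closed P -> ~ P x ->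
  exists2 e : R, 0 < e & forall y, P y -> e <= enorm (x - y).
Proof.
move=> cP nPx; have : nbhs x (~` P) by apply: open_nbhs_nbhs; split => //; exact: closed_openC.
by move=> /nbhs_enorm[e e0 he]; exists e => // y Py; rewrite leNgt; apply/negP => /he.
Qed.

Lemma compact_closed_plane P : compact P -> closed P.
Proof. by apply: compact_closed; exact: norm_hausdorff. Qed.

(** Monotonicity in n turns a local choice of n into a uniform one. *)
Lemma compact_uniform (P : set (plane R)) (Q : nat -> plane R -> Prop) : compact P ->
  (forall n k x, (n <= k)%N -> Q n x -> Q k x) ->
  (forall x, P x -> exists n, exists2 e : R, 0 < e & forall y, enorm (x - y) < e -> Q n y) ->
  exists n, forall x, P x -> Q n x.
Proof.
move=> cP mono hQ.
have /(_ nat \oo Q _)[] := proj1 (compact_near_coveringP _) cP.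
  move=> x /hQ[n [e e0 he]]; have nx : nbhs x [set y | enorm (x - y) < e].
    by apply/nbhs_enorm; exists e.
  near=> y k => /=; apply: (mono n); first by near: k; exact: nbhs_infty_ge.
  by apply: he; near: y.
by move=> n _ hn; exists n => x; apply: hn => /=.
Unshelve. all: by end_near. Qed.

Lemma compact_enorm_bounded P : compact P -> exists2 B : R, 0 < B & forall x, P x -> enorm x <= B.
Proof.
move=> cP; have [] := @compact_uniform P (fun n x => enorm x <= n.+1%:R) cP.
- by move=> n k x nk /le_trans; apply; rewrite ler_nat.
- move=> x Px; exists (Num.Def.archi_bound (enorm x + 1)); exists 1 => // y xy.
  have -> : y = x - (x - y) by rewrite opprB addrC subrK.
  apply: (le_trans (enormD _ _)); rewrite enormN.
  have := archi_boundP (addr_ge0 (enorm_ge0 x) ler01).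
  rewrite -natr1 => h; apply: (le_trans (lerD (lexx _) (ltW xy))).
  by rewrite (le_trans (ltW h)) // lerDl.
by move=> n hn; exists n.+1%:R.
Qed.

Lemma compact_disjoint_gap (P Q : set (plane R)) : compact P -> compact Q -> P `&` Q = set0 ->
  exists2 e : R, 0 < e & forall (x y : plane R), P x -> Q y -> e <= enorm (x - y).
Proof.
move=> cP cQ PQ.
have [] := @compact_uniform P (fun n x => forall y, Q y -> n.+1%:R^-1 <= enorm (x - y)) cP.
- move=> n k x nk h y Qy; apply: le_trans (h y Qy).
  by rewrite lef_pV2 ?posrE ?ltr0n // ler_nat.
- move=> x Px; have nQx : ~ Q x by move=> Qx; have : (P `&` Q) x by []; rewrite PQ.
  have [e e0 he] := not_closed_enorm (compact_closed_plane cQ) nQx.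
  exists (Num.Def.archi_bound (2 / e)); exists (e / 2) => [|y xy w Qw]; first by rewrite divr_gt0.
  have := archi_boundP (divr_ge0 (ler0n R 2) (ltW e0)).
  set N := Num.Def.archi_bound _ => hN.
  apply: (@le_trans _ _ (e / 2)).
    rewrite -[e / 2]invrK lef_pV2 ?posrE ?ltr0n ?invr_gt0 ?divr_gt0 // invf_div.
    by rewrite (le_trans (ltW hN)) // ler_nat.
  rewrite -(lerD2l (e / 2)) -splitr (le_trans (he w Qw)) //.
  by rewrite (le_trans (enormB_le y x w)) // lerD2r ltW.
by move=> n hn; exists n.+1%:R^-1 => [|x y Px Qy]; [rewrite invr_gt0|exact: hn].
Qed.

End PlaneTopology.

Section SelfAffineGeometry.
Context {R : realType} {L : finPointedType}.
Variables (A : L -> 'M[R]_2) (t : L -> plane R) (F : set (plane R)).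
Hypothesis A_unit : forall i, A i \in unitmx.
Hypothesis A_contr : forall i, linear_contraction (A i).
Hypothesis F_attr : attractor (affine A t) F.
Hypothesis sep : forall i j, i != j ->
     (affine A t i @` F) `&` (affine A t j @` F) = set0.
Local Notation T := (affine A t).

Lemma uniform_contraction : exists c : R, [/\ 0 < c, c < 1 &
  forall w, sv1 (word_mx A w) <= c ^+ size w].
Proof.
have /choice[c hc] : forall i, exists c : R, c < 1 /\
    forall x, enorm (A i *m x) <= c * enorm x.
  by move=> i; have [c c1 h] := A_contr i; exists c.
have [|e e0 he] := @fin_pos_lower_bound R L (fun i => 1 - c i).
  by move=> i; rewrite subr_gt0; case: (hc i).
exists (1 - Num.min e (1 / 2)); split.
- by rewrite subr_gt0 gt_min; apply/orP; right; rewrite ltr_pdivrMr // mul1r ltr1n.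
- by rewrite ltrBlDr ltrDl lt_min e0 /= divr_gt0.
elim=> [|i w IH]; first by rewrite word_mx_nil sv1_1 expr0.
rewrite word_mx_cons exprS (le_trans (sv1M_le _ _)) //.
apply: ler_pM; rewrite ?sv1_ge0 //; apply: sv1_le => x.
rewrite (le_trans ((hc i).2 x)) // ler_wpM2r ?enorm_ge0 //.
have h1 : Num.min e (1 / 2) <= e by rewrite ge_min lexx.
by rewrite lerBrDl -lerBrDr (le_trans h1).
Qed.

Lemma F_nonempty : F !=set0. Proof. by case: F_attr. Qed.
Lemma F_compact : compact F. Proof. by case: F_attr. Qed.

Lemma map_in_F i x : F x -> F (T i x).
Proof. by case: F_attr => _ _ FE Fx; rewrite FE; exists i => //; exists x. Qed.

Lemma word_map_in_F w x : F x -> F (word_map T w x).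
Proof. by move=> Fx; elim: w => [//|i w IH] /=; exact: map_in_F. Qed.

Lemma enorm_word_map w x y :
  enorm (word_map T w x - word_map T w y) <= sv1 (word_mx A w) * enorm (x - y).
Proof. by rewrite word_mapB enorm_mulmx_le. Qed.

Lemma word_map_continuous w : continuous (word_map T w).
Proof.
move=> x P /nbhs_enorm[e e0 he]; apply/nbhs_enorm.
have s0 : 0 < sv1 (word_mx A w) by rewrite sv1_gt0 // word_mx_unit.
exists (e / sv1 (word_mx A w)); first by rewrite divr_gt0.
move=> y xy; apply: he; apply: (le_lt_trans (enorm_word_map _ _ _)).
by rewrite mulrC -ltr_pdivlMr.
Qed.

Lemma word_map_compact w : compact (word_map T w @` F).
Proof.
apply: continuous_compact; last exact: F_compact.
by apply: continuous_subspaceT; exact: word_map_continuous.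
Qed.

Lemma F_diameter : exists2 D : R, 0 < D & forall x y, F x -> F y -> enorm (x - y) <= D.
Proof.
have [B B0 hB] := compact_enorm_bounded F_compact.
exists (B + B) => [|x y Fx Fy]; first by rewrite addr_gt0.
by rewrite (le_trans (enormD _ _)) // enormN lerD // hB.
Qed.

Lemma separation_gap : exists2 c0 : R, 0 < c0 & forall i j x y, i != j -> F x -> F y ->
  c0 <= enorm (T i x - T j y).
Proof.
have /choice[c hc] : forall ij : L * L, exists c : R, 0 < c /\ (ij.1 != ij.2 ->
    forall x y, F x -> F y -> c <= enorm (T ij.1 x - T ij.2 y)).
  move=> [i j] /=; have [->|ij] := eqVneq i j; first by exists 1.
  have [e e0 he] := compact_disjoint_gap (@word_map_compact [:: i]) (@word_map_compact [:: j]) (sep ij).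
  by exists e; split=> // _ x y Fx Fy; apply: he; [exists x|exists y].
have [e e0 he] := @fin_pos_lower_bound R _ c (fun ij => (hc ij).1).
exists e => // i j x y ij Fx Fy.
by apply: le_trans (he (i, j)) _; apply: (hc (i, j)).2.
Qed.

(** The pieces along a code are nested compact sets whose diameters tend to
    zero, so they meet in a single point, the limit that defines the coding. *)
Lemma coding_in_cylinder (a : nat -> L) n :
  exists2 y, F y & coding T a = word_map T (mkseq a n) y.
Proof.
have [z0 Fz0] := F_nonempty.
have [B B0 hB] := compact_enorm_bounded F_compact.
have [c [c0 c1 hc]] := uniform_contraction.
pose z k := word_map T (mkseq a k) z0.
have [y [Fy cly]] : F `&` cluster (z @ \oo) !=set0.
  by apply: F_compact; exists 0%N => // k _; exact: word_map_in_F.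
have yn k : exists2 x, F x & y = word_map T (mkseq a k) x.
  suff [x Fx xy] : (word_map T (mkseq a k) @` F) y by exists x.
  have cl : closed (word_map T (mkseq a k) @` F).
    by apply: compact_closed_plane; exact: word_map_compact.
  apply: cl => B1 B1y.
  apply: cly => //; exists k => // l /= kl.
  have [s ls] : exists s, mkseq a l = mkseq a k ++ s.
    exists (drop k (mkseq a l)); rewrite -[LHS](cat_take_drop k); congr (_ ++ _).
    by rewrite /mkseq -map_take take_iota (minn_idPl kl).
  rewrite /z ls word_map_cat; exists (word_map T s z0) => //.
  exact: word_map_in_F.
have -> : coding T a = y; last exact: yn.
apply: cvg_lim; first exact: norm_hausdorff.
move=> P /nbhs_enorm[e e0 he].
have cN : \forall k \near \oo, c ^+ k * B < e.
  have h : (fun k => c ^+ k * B) @ \oo --> (0 : R).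
    rewrite -(mul0r B); apply: cvgM; last exact: cvg_cst.
    by apply: cvg_expr; rewrite gtr0_norm.
  exact: (cvgr_lt _ h).
apply: filterS cN => k hk; apply: he.
have [x Fx ->] := yn k.
apply: (le_lt_trans (enorm_word_map _ _ _)); rewrite subr0.
apply: le_lt_trans hk; apply: ler_pM; rewrite ?sv1_ge0 ?enorm_ge0 ?hB //.
by rewrite (le_trans (hc _)) // size_mkseq.
Qed.

End SelfAffineGeometry.

(** * Cylinder masses and the coding map *)

Section RealProbability.
Context {R : realType} {dsp : measure_display} {X : measurableType dsp}.
Variable P : probability X R.
Implicit Types E G : set X.

(** Probabilities are finite, so all sums can be carried out in R. *)
Definition pr E : R := fine (P E).

Lemma prE E : measurable E -> P E = (pr E)%:E.
Proof. by move=> mE; rewrite fineK // fin_num_measure. Qed.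

Lemma pr_ge0 E : 0 <= pr E.
Proof. by rewrite fine_ge0. Qed.

Lemma pr_le E G : measurable E -> measurable G -> E `<=` G -> pr E <= pr G.
Proof. by move=> mE mG EG; rewrite -lee_fin -!prE // le_measure // inE. Qed.

Lemma pr_set0 : pr set0 = 0.
Proof. by rewrite /pr measure0. Qed.

Lemma pr_setT : pr setT = 1.
Proof. by rewrite /pr probability_setT. Qed.

Lemma pr_le1 E : measurable E -> pr E <= 1.
Proof. by move=> mE; rewrite -lee_fin -prE // probability_le1. Qed.

Lemma prU E G : measurable E -> measurable G -> E `&` G = set0 ->
  pr (E `|` G) = pr E + pr G.
Proof.
move=> mE mG EG; apply: EFin_inj; rewrite EFinD -!prE ?measureU //.
exact: measurableU.
Qed.

Lemma pr_union_le (I : eqType) (s : seq I) (G : I -> set X) E : measurable E ->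
  (forall i, i \in s -> measurable (G i)) ->
  (forall x, E x -> exists2 i, i \in s & G i x) -> pr E <= \sum_(i <- s) pr (G i).
Proof.
elim: s E => [|i s IH] E mE mG hE.
  rewrite big_nil; have -> : E = set0 by rewrite -subset0 => x /hE[].
  by rewrite pr_set0.
have mi : measurable (G i) by apply: mG; exact: mem_head.
rewrite big_cons (@le_trans _ _ (pr (G i) + pr (E `\` G i))) //.
  have mD : measurable (E `\` G i) by exact: measurableD.
  rewrite -prU //; last by rewrite setIC setDKI.
  apply: pr_le => //; first exact: measurableU.
  by move=> x Ex; have [Gx|Gx] := pselect (G i x); [left|right].
rewrite lerD2l IH //; first exact: measurableD.
  by move=> j js; apply: mG; rewrite inE js orbT.
move=> x [Ex nGx]; have [j] := hE x Ex.
by rewrite inE => /predU1P[->//|js Gx]; exists j.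
Qed.

Lemma pr_sum (I : eqType) (s : seq I) (G : I -> set X) : uniq s ->
  (forall i, i \in s -> measurable (G i)) ->
  (forall i j x, i \in s -> j \in s -> G i x -> G j x -> i = j) ->
  measurable [set x | exists2 i, i \in s & G i x] /\
  pr [set x | exists2 i, i \in s & G i x] = \sum_(i <- s) pr (G i).
Proof.
elim: s => [|i s IH] /=.
  move=> _ _ _; rewrite big_nil.
  have -> : [set x | exists2 i, i \in [::] & G i x] = set0.
    by rewrite -subset0 => x [].
  by rewrite pr_set0; split.
move=> /andP[his us] mG dG.
have mi : measurable (G i) by apply: mG; exact: mem_head.
have [ms es] : measurable [set x | exists2 j, j \in s & G j x] /\
  pr [set x | exists2 j, j \in s & G j x] = \sum_(i <- s) pr (G i).
  apply: IH => // [j js|j k x js ks]; first by apply: mG; rewrite inE js orbT.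
  by apply: dG; rewrite inE ?js ?ks orbT.
have -> : [set x | exists2 j, j \in i :: s & G j x] =
    G i `|` [set x | exists2 j, j \in s & G j x].
  apply/seteqP; split => x /=.
    by move=> [j]; rewrite inE => /predU1P[->|js Gx]; [left|right; exists j].
  move=> [Gx|[j js Gx]]; first by exists i => //; exact: mem_head.
  by exists j; rewrite // inE js orbT.
split; first exact: measurableU.
rewrite prU // ?big_cons ?es // -subset0 => x /= [Gi [j js Gj]].
by move: his; rewrite (dG i j x) ?js // inE ?eqxx ?js ?orbT.
Qed.

End RealProbability.

Section SymbolicMeasure.
Context {R : realType} {L : finPointedType}.
Variables (A : L -> 'M[R]_2) (t : L -> plane R) (F : set (plane R)) (d : R).
Variable mu : probability (symbolic L) R.
Hypothesis A_unit : forall i, A i \in unitmx.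
Hypothesis A_contr : forall i, linear_contraction (A i).
Hypothesis F_attr : attractor (affine A t) F.
Local Notation T := (affine A t).
Local Notation Sigma := (symbolic L).
Local Notation code := (coding T : Sigma -> plane R).

Definition cyl_mass (w : seq L) : R := pr mu (cylinder w : set Sigma).
Local Notation m := cyl_mass.

Lemma measurable_cylinder (w : seq L) : measurable (cylinder w : set Sigma).
Proof. by apply: sub_sigma_algebra; exists w. Qed.

Lemma cyl_mass_ge0 w : 0 <= m w. Proof. exact: pr_ge0. Qed.

Lemma pr_prefix (P : pred (seq L)) n :
  measurable ([set a | P (mkseq a n)] : set Sigma) /\
  pr mu ([set a | P (mkseq a n)] : set Sigma) = \sum_(w <- words n | P w) m w.
Proof.
have := @pr_sum R _ Sigma mu _ [seq w <- words n | P w] (fun w => cylinder w).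
case.
- by rewrite filter_uniq // words_uniq.
- by move=> w _; exact: measurable_cylinder.
- move=> u v a; rewrite !mem_filter => /andP[_ /size_words su] /andP[_ /size_words sv].
  by rewrite /cylinder /= su sv => <- <-.
rewrite big_filter.
have -> : [set a | exists2 w, w \in [seq w <- words n | P w] & cylinder w a] =
    [set a | P (mkseq a n)].
  apply/seteqP; split => a /=.
    by move=> [w]; rewrite mem_filter => /andP[Pw /size_words sw]; rewrite /cylinder /= sw => ->.
  move=> Pa; exists (mkseq a n); first by rewrite mem_filter Pa mem_words size_mkseq eqxx.
  by rewrite /cylinder /= size_mkseq.
by [].
Qed.

Lemma cyl_mass_nil : m [::] = 1.
Proof.
rewrite /m (_ : cylinder [::] = setT) ?pr_setT //.
by apply/seteqP; split.
Qed.

Lemma cyl_mass_rcons w : \sum_i m (rcons w i) = m w.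
Proof.
have [_] := pr_prefix (fun v => take (size w) v == w) (size w).+1.
have -> : [set a | take (size w) (mkseq a (size w).+1) == w] = cylinder w.
  have E (a : nat -> L) : take (size w) (mkseq a (size w).+1) = mkseq a (size w).
    by rewrite /mkseq -map_take take_iota (minn_idPl (leqnSn _)).
  by apply/seteqP; split => a /=; rewrite E /cylinder /= => /eqP.
rewrite -/(m w) => ->; rewrite [RHS]big_mkcond [RHS]sum_words_rcons.
apply: eq_bigr => i _; rewrite (bigD1_seq w) ?words_uniq ?mem_words //=.
rewrite -cats1 take_size_cat // eqxx big_seq_cond big1 ?addr0 // => v.
move=> /andP[/size_words sv vw]; case: ifP => // /eqP.
by rewrite -cats1 -sv take_size_cat // => vw'; rewrite vw' eqxx in vw.
Qed.

Lemma kaenmaki_bounds : d <= 1 -> kaenmaki_measure A d mu ->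
  exists2 C : R, 0 < C & forall w, C^-1 * sv1 (word_mx A w) `^ d <= m w /\
    m w <= C * sv1 (word_mx A w) `^ d.
Proof.
move=> d1 [_ _ [C C0 hC] _]; exists C => // w.
have := hC w; rewrite /sv_function d1 prE ?lee_fin; last exact: measurable_cylinder.
by move=> /andP[].
Qed.

Lemma kaenmaki_quasi_mult : kaenmaki_measure A d mu ->
  exists2 C : R, 0 < C & forall u v, C^-1 * (m u * m v) <= m (u ++ v) /\
    m (u ++ v) <= C * (m u * m v).
Proof.
move=> [_ _ _ [C C0 hC]]; exists C => // u v.
have := hC u v; rewrite !prE; try exact: measurable_cylinder.
by rewrite -!EFinM !lee_fin => /andP[].
Qed.

(** A cylinder of level n can only be coded into Q if its piece of the
    attractor meets Q; for closed Q this is asymptotically sharp. *)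
Definition piece_meets (Q : set (plane R)) (w : seq L) : bool :=
  `[< exists2 y, F y & Q (word_map T w y) >].

Lemma code_piece_meets Q (a : Sigma) n : Q (code a) -> piece_meets Q (mkseq a n).
Proof.
move=> Qa; apply/asboolP.
have [y Fy ya] := coding_in_cylinder A_unit A_contr F_attr a n.
by exists y => //; rewrite -ya.
Qed.

Lemma code_preimageE (Q : set (plane R)) : closed Q ->
  code @^-1` Q = \bigcap_n ([set a | piece_meets Q (mkseq a n)] : set Sigma).
Proof.
move=> cQ; apply/seteqP; split => a /= h; first by move=> n _; exact: code_piece_meets.
apply: (closed_enorm cQ) => e e0.
have [D D0 hD] := F_diameter F_attr.
have [c [c0 c1 hc]] := uniform_contraction A_contr.
have [n hn] : exists n, c ^+ n * D < e.
  have hlim : (fun k => c ^+ k * D) @ \oo --> (0 : R).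
    rewrite -(mul0r D); apply: cvgM; last exact: cvg_cst.
    by apply: cvg_expr; rewrite gtr0_norm.
  have : \forall k \near \oo, c ^+ k * D < e by exact: (cvgr_lt _ hlim).
  by move=> [k _ hk]; exists k; apply: hk => /=.
have /asboolP[y Fy Qy] := h n I.
exists (word_map T (mkseq a n) y) => //.
have [x Fx ->] := coding_in_cylinder A_unit A_contr F_attr a n.
apply: (le_lt_trans (enorm_word_map _ _ _ _ _)); apply: le_lt_trans hn.
apply: ler_pM; rewrite ?sv1_ge0 ?enorm_ge0 ?hD //.
by rewrite (le_trans (hc _)) // size_mkseq.
Qed.

Lemma measurable_code_preimage (Q : set (plane R)) : closed Q ->
  measurable (code @^-1` Q).
Proof.
move=> cQ; rewrite code_preimageE //; apply: bigcap_measurableType => n _.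
by case: (pr_prefix (piece_meets Q) n).
Qed.

Lemma pr_code_le (Q : set (plane R)) n : closed Q ->
  pr mu (code @^-1` Q) <= \sum_(w <- words n | piece_meets Q w) m w.
Proof.
move=> cQ; have [mP <-] := pr_prefix (piece_meets Q) n.
apply: pr_le => //; first exact: measurable_code_preimage.
by move=> a; exact: code_piece_meets.
Qed.

End SymbolicMeasure.

(** * Axis-parallel lines carry no mass *)

Section CrossProduct.
Context {R : realType}.
Implicit Types x y v : plane R.

Definition cross x y : R := x 0 0 * y 1 0 - x 1 0 * y 0 0.

Lemma crossBr x y v : cross x (y - v) = cross x y - cross x v.
Proof. by rewrite /cross !mxE; ring. Qed.

Lemma crossBl x y v : cross (x - y) v = cross x v - cross y v.
Proof. by rewrite /cross !mxE; ring. Qed.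

Lemma cross_le x y : `|cross x y| <= 2 * (enorm x * enorm y).
Proof.
rewrite mulr_natl mulr2n (le_trans (ler_normB _ _)) // !normrM.
by rewrite lerD // ler_pM // ?coord0_le_enorm ?coord1_le_enorm.
Qed.

Lemma coord_mulmxE (M : 'M[R]_2) x j : (M *m x) j 0 = M j 0 * x 0 0 + M j 1 * x 1 0.
Proof. by rewrite mxE big_ord2. Qed.

(** A nonzero linear form has a one-dimensional kernel. *)
Lemma row_kernel_cross (M : 'M[R]_2) j x y : M \in unitmx ->
  (M *m x) j 0 = 0 -> (M *m y) j 0 = 0 -> cross x y = 0.
Proof.
move=> Mu; rewrite !coord_mulmxE => hx hy.
have [M0|M1] : M j 0 != 0 \/ M j 1 != 0.
  apply/orP; rewrite -negb_and; apply/negP => /andP[/eqP M0 /eqP M1].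
  have : (delta_mx 0 j : 'rV_2) *m M = 0.
    rewrite -rowE; apply/rowP; apply: ord2_ind; rewrite !mxE //.
  move=> /(congr1 (mulmx^~ (invmx M))); rewrite mulmxK // mul0mx => /matrixP /(_ 0 j).
  by rewrite !mxE !eqxx => /eqP; rewrite oner_eq0.
- apply: (mulfI M0); rewrite mulr0 /cross.
  transitivity (y 1 0 * (M j 0 * x 0 0 + M j 1 * x 1 0) - x 1 0 * (M j 0 * y 0 0 + M j 1 * y 1 0)).
    by ring.
  by rewrite hx hy !mulr0 subrr.
apply: (mulfI M1); rewrite mulr0 /cross.
transitivity (x 0 0 * (M j 0 * y 0 0 + M j 1 * y 1 0) - y 0 0 * (M j 0 * x 0 0 + M j 1 * x 1 0)).
  by ring.
by rewrite hx hy !mulr0 subrr.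
Qed.

End CrossProduct.

Section NullLines.
Context {R : realType} {L : finPointedType}.
Variables (A : L -> 'M[R]_2) (t : L -> plane R) (F : set (plane R)) (d : R).
Variable mu : probability (symbolic L) R.
Hypothesis A_unit : forall i, A i \in unitmx.
Hypothesis A_contr : forall i, linear_contraction (A i).
Hypothesis F_attr : attractor (affine A t) F.
Hypothesis sep : forall i j, i != j ->
     (affine A t i @` F) `&` (affine A t j @` F) = set0.
Hypothesis A_pos : forall i j k, 0 < A i j k.
Hypothesis d_gt0 : 0 < d.
Local Notation T := (affine A t).
Local Notation Sigma := (symbolic L).
Local Notation code := (coding T : Sigma -> plane R).
Local Notation m := (cyl_mass mu).
Variables (C1 C2 : R).
Hypothesis C10 : 0 < C1.
Hypothesis C20 : 0 < C2.
Hypothesis m_bounds : forall w, C1^-1 * sv1 (word_mx A w) `^ d <= m w /\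
    m w <= C1 * sv1 (word_mx A w) `^ d.
Hypothesis m_mult : forall u v, C2^-1 * (m u * m v) <= m (u ++ v).

Lemma powR_expn (c : R) n : 0 < c -> (c ^+ n) `^ d = (c `^ d) ^+ n.
Proof. by move=> c0; rewrite -(powR_mulrn n (ltW c0)) powRAC powR_mulrn ?powR_ge0. Qed.

Lemma geometric_small (x K e : R) : 0 <= x -> x < 1 -> 0 <= K -> 0 < e -> exists n, K * x ^+ n < e.
Proof.
move=> x0 x1 K0 e0.
have hlim : (fun k => K * x ^+ k) @ \oo --> (0 : R).
  rewrite -(mulr0 K); apply: cvgM; first exact: cvg_cst.
  by apply: cvg_expr; rewrite ger0_norm.
have : \forall k \near \oo, K * x ^+ k < e by exact: (cvgr_lt _ hlim).
by move=> [k _ hk]; exists k; apply: hk => /=.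
Qed.

(** With a single letter every cylinder has mass one, while its larger singular
    value tends to zero. *)
Lemma two_letters : exists i j : L, i != j.
Proof.
apply: contrapT => h.
have L1 (i j : L) : i = j by apply/eqP; apply: contrapT => /negP ij; apply: h; exists i, j.
have m1 w : m w = 1.
  elim/last_ind: w => [|w i IH]; first exact: cyl_mass_nil.
  have := cyl_mass_rcons mu w; rewrite (bigD1 i) //= big1 ?addr0 ?IH //.
  by move=> j; rewrite (L1 j i) eqxx.
have [c [c0 c1 hc]] := uniform_contraction A_contr.
have cd : c `^ d < 1.
  by rewrite -[ltRHS](congr1 (fun f => f d) (powR1 R)) gt0_ltr_powR ?nnegrE ?(ltW c0).
have [n hn] := geometric_small (powR_ge0 c d) cd (ltW C10) ltr01.
have [_] := m_bounds (nseq n point); rewrite m1; apply/negP; rewrite -ltNge.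
apply: le_lt_trans hn; rewrite -powR_expn // ler_pM2l //; apply: powR_le => //.
- exact: ltW.
- exact: sv1_ge0.
by have := hc (nseq n point); rewrite size_nseq.
Qed.

Lemma word_cover n x : F x -> exists2 u, size u = n & exists2 y, F y & x = word_map T u y.
Proof.
elim: n x => [|n IH] x Fx; first by exists [::] => //; exists x.
have [_ _ FE] := F_attr.
have [i _ [y Fy <-]] : (\bigcup_(i in [set: L]) (T i @` F)) x by rewrite -FE.
have [u su [z Fz ->]] := IH y Fy.
exists (i :: u); first by rewrite /= su.
by exists z.
Qed.

(** If the attractor contains the vertices of a triangle, no line meets three
    sufficiently small pieces around them.  If it is contained in a line, the
    pulled back axis-parallel line cuts that line in at most one point, because no
    A_i maps a coordinate axis to itself, and pieces of the first generation are
    disjoint. *)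
Lemma line_misses_piece : exists k, forall w (j : 'I_2) h, exists2 u, size u = k &
  forall y, F y -> word_map T (w ++ u) y j 0 <> h.
Proof.
have hit w j h k : (forall u, size u = k -> exists2 y, F y & word_map T (w ++ u) y j 0 = h) \/
    exists2 u, size u = k & forall y, F y -> word_map T (w ++ u) y j 0 <> h.
  have [h1|h1] := pselect (exists2 u, size u = k & forall y, F y -> word_map T (w ++ u) y j 0 <> h).
    by right.
  left => u su; apply: contrapT => h2; apply: h1; exists u => // y Fy yh.
  by apply: h2; exists y.
have flat w j h x y : word_map T w x j 0 = h -> word_map T w y j 0 = h ->
    (word_mx A w *m (x - y)) j 0 = 0.
  by move=> xh yh; rewrite -(word_mapB A t) mxE [X in _ + X]mxE xh yh subrr.
have [D D0 hD] := F_diameter F_attr.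
have [[z1 [z2 [z3 [F1 F2 F3 ncol]]]]|col] := pselect (exists z1 z2 z3,
    [/\ F z1, F z2, F z3 & cross (z1 - z2) (z1 - z3) != 0]).
  have [c [c0 c1 hc]] := uniform_contraction A_contr.
  have ncol' : 0 < `|cross (z1 - z2) (z1 - z3)| by rewrite normr_gt0.
  have [k hk] := geometric_small (ltW c0) c1 (ltW (mulr_gt0 (ltr0n R 8) (mulr_gt0 D0 D0))) ncol'.
  exists k => w j h; case: (hit w j h k) => // hits; exfalso.
  have near z : F z -> exists2 x, F x & word_map T w x j 0 = h /\ enorm (x - z) <= c ^+ k * D.
    move=> Fz; have [u su [y Fy zy]] := word_cover k Fz.
    have [y' Fy' y'h] := hits u su.
    exists (word_map T u y'); first exact: (word_map_in_F F_attr).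
    split; first by rewrite -word_map_cat.
    rewrite zy (le_trans (enorm_word_map _ _ _ _ _)) //.
    by apply: ler_pM; rewrite ?sv1_ge0 ?enorm_ge0 ?hD // -su hc.
  have [x1 Fx1 [h1 e1]] := near z1 F1; have [x2 Fx2 [h2 e2]] := near z2 F2.
  have [x3 Fx3 [h3 e3]] := near z3 F3.
  have x0 : cross (x1 - x2) (x1 - x3) = 0.
    by apply: (row_kernel_cross (word_mx_unit w A_unit)); apply: flat h1 _.
  have perturb x z x' z' : enorm (x - z) <= c ^+ k * D -> enorm (x' - z') <= c ^+ k * D ->
      enorm ((x - x') - (z - z')) <= 2 * (c ^+ k * D).
    move=> ha hb; have -> : (x - x') - (z - z') = (x - z) - (x' - z').
      by rewrite !opprD !opprK addrACA.
    by rewrite mulr_natl mulr2n (le_trans (enormD _ _)) // enormN lerD.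
  have E : cross (z1 - z2) (z1 - z3) = - (cross ((x1 - x2) - (z1 - z2)) (x1 - x3)
      + cross (z1 - z2) ((x1 - x3) - (z1 - z3))).
    by rewrite (crossBl (x1 - x2) (z1 - z2)) (crossBr _ (x1 - x3) (z1 - z3)) x0; ring.
  have p12 := perturb _ _ _ _ e1 e2; have p13 := perturb _ _ _ _ e1 e3.
  move: hk; rewrite ltNge => /negP; apply.
  rewrite E normrN (le_trans (ler_normD _ _)) //.
  apply: (@le_trans _ _ (2 * (2 * (c ^+ k * D) * D) + 2 * (D * (2 * (c ^+ k * D))))).
    apply: lerD; apply: (le_trans (cross_le _ _)); rewrite ler_pM2l ?ltr0n //.
      by apply: ler_pM; rewrite ?enorm_ge0 ?hD.
    by apply: ler_pM; rewrite ?enorm_ge0 ?hD.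
  by apply: eq_ler; ring.
have {}col x y z : F x -> F y -> F z -> cross (x - y) (x - z) = 0.
  move=> Fx Fy Fz; apply/eqP; apply: contrapT => /negP h; apply: col.
  by exists x, y, z.
have [i [i' ii']] := two_letters.
exists 1%N => w j h; case: (hit w j h 1%N) => // hits; exfalso.
have [y Fy yh] := hits [:: i] erefl; have [y' Fy' y'h] := hits [:: i'] erefl.
rewrite word_map_cat in yh; rewrite word_map_cat in y'h.
set p := word_map T [:: i] y in yh; set p' := word_map T [:: i'] y' in y'h.
have Fp : F p by exact: (word_map_in_F F_attr).
have Fp' : F p' by exact: (word_map_in_F F_attr).
have pp' : p - p' != 0.
  rewrite subr_eq0; apply/eqP => pE.
  have : ((T i @` F) `&` (T i' @` F)) p by split; [exists y|rewrite pE; exists y'].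
  by rewrite sep.
(* every composition fixes the direction of the line carrying F *)
have fixdir u : cross (p - p') (word_mx A u *m (p - p')) = 0.
  rewrite -(word_mapB A t).
  have hx x : F x -> cross (p - p') (p - word_map T u x) = 0.
    by move=> Fx; apply: col => //; exact: (word_map_in_F F_attr).
  have -> : word_map T u p - word_map T u p' =
     (p - word_map T u p') - (p - word_map T u p) by rewrite opprB [RHS]addrC addrA subrK.
  by rewrite crossBr !hx ?subrr.
have wp0 := flat w j h p p' yh y'h.
set v := p - p' in pp' fixdir wp0.
have vj : v j 0 = 0.
  have := mulmx_unit_neq0 (word_mx_unit w A_unit) pp'; set Mv := _ *m v in wp0 *.
  move=> Mv0; have := fixdir w; rewrite -/Mv /cross.
  move: j wp0 {hits yh y'h flat hit} ; apply: ord2_ind => Mj.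
    rewrite Mj mulr0 subr0 => /eqP; rewrite mulf_eq0 => /orP[/eqP//|/eqP M1].
    by case/negP: Mv0; apply/eqP; apply: plane_eq; rewrite ?Mj ?M1 mxE.
  rewrite Mj mulr0 sub0r => /eqP; rewrite oppr_eq0 mulf_eq0 => /orP[/eqP//|/eqP M1].
  by case/negP: Mv0; apply/eqP; apply: plane_eq; rewrite ?Mj ?M1 mxE.
have := fixdir [:: i]; rewrite word_mx_cons word_mx_nil mulmx1 /cross mulmx_col0 mulmx_col1.
have Ai := A_pos i.
move: j vj {hits yh y'h flat hit wp0}; apply: ord2_ind => vj; rewrite vj !mul0r !mulr0.
  rewrite !add0r => /eqP; rewrite oppr_eq0 !mulf_eq0 (gt_eqF (Ai _ _)) /= orbb => /eqP v1.
  by case/negP: pp'; apply/eqP; apply: plane_eq; rewrite ?vj ?v1 mxE.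
rewrite subr0 !addr0 => /eqP; rewrite !mulf_eq0 (gt_eqF (Ai _ _)) /= orbb => /eqP v1.
by case/negP: pp'; apply/eqP; apply: plane_eq; rewrite ?vj ?v1 mxE.
Qed.

Lemma closed_axis_line (j : 'I_2) (h : R) : closed [set x : plane R | x j 0 = h].
Proof.
move=> x cx; apply/eqP; rewrite -subr_eq0 -normr_eq0; apply/negP => /negP n0.
have e0 : 0 < `|x j 0 - h| by rewrite lt_neqAle eq_sym n0 normr_ge0.
have [y [/= yh xy]] : [set x : plane R | x j 0 = h] `&` [set y | enorm (x - y) < `|x j 0 - h|] !=set0.
  by apply: cx; apply/nbhs_enorm; exists `|x j 0 - h|.
move: xy; apply/negP; rewrite -leNgt -yh.
have -> : x j 0 - y j 0 = (x - y) j 0 by rewrite !mxE.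
by move: j {n0 e0 cx yh}; apply: ord2_ind; [exact: coord0_le_enorm|exact: coord1_le_enorm].
Qed.

(** A piece that misses the line removes a fixed proportion of the mass of every
    cylinder, so the mass of the cylinders of generation n * k that meet the line
    decays geometrically. *)
Lemma axis_line_null (j : 'I_2) (h : R) : pr mu (code @^-1` [set x | x j 0 = h]) = 0.
Proof.
have [k hk] := line_misses_piece.
have m0 w : 0 < m w.
  apply: lt_le_trans (m_bounds w).1; rewrite mulr_gt0 ?invr_gt0 // powR_gt0 //.
  by rewrite sv1_gt0 // word_mx_unit.
have [e e0 he] : exists2 e : R, 0 < e & forall u, size u = k -> e <= m u.
  have [e e0 he] := @fin_pos_lower_bound R (k.-tuple L) (fun u => m u) (fun u => m0 u).
  by exists e => // u /eqP su; exact: he (Tuple su).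
pose eta := C2^-1 * e.
have eta0 : 0 < eta by rewrite mulr_gt0 ?invr_gt0.
pose Q := [set x : plane R | x j 0 = h].
pose s n := \sum_(w <- words n | piece_meets A t F Q w) m w.
have s0 n : 0 <= s n by apply: sumr_ge0 => w _; exact: cyl_mass_ge0.
have step n : s (n + k)%N <= (1 - eta) * s n.
  rewrite /s big_mkcond sum_words_cat big_mkcond /= mulr_sumr.
  rewrite [leRHS]big_mkcond /=; apply: ler_sum => w _.
  have meets_cat u : piece_meets A t F Q (w ++ u) -> piece_meets A t F Q w.
    move=> /asboolP[y Fy]; rewrite word_map_cat => Qy; apply/asboolP.
    by exists (word_map T u y) => //; exact: (word_map_in_F F_attr).
  case: ifPn => wQ; last first.
    by rewrite big1 // => u _; case: ifP => // /meets_cat; rewrite (negbTE wQ).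
  have [u su hu] := hk w j h.
  have uw : u \in words k by rewrite mem_words su.
  rewrite -(sum_m_cat (cyl_mass_rcons mu) w k) (bigD1_seq u) ?words_uniq //= [X in X + _]ifF.
    rewrite add0r mulrBl mul1r (bigD1_seq u) ?words_uniq //= lerBrDl.
    apply: (@le_trans _ _ (m (w ++ u) + \sum_(v <- words k | v != u) m (w ++ v))).
      apply: lerD; last by apply: ler_sum => v _; case: ifP => // _; exact: cyl_mass_ge0.
      apply: le_trans (m_mult w u).
      rewrite -(bigD1_seq u) ?words_uniq //= (sum_m_cat (cyl_mass_rcons mu) w k).
      rewrite /eta -mulrA ler_pM2l ?invr_gt0 // [leRHS]mulrC ler_wpM2r ?cyl_mass_ge0 //.
      exact: he.
    exact: lexx.
  by apply/negP => /asboolP[y Fy Qy]; exact: (hu y Fy Qy).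
have eta1 : 0 <= 1 - eta.
  have := le_trans (m_mult [::] [::]) (eq_ler (cyl_mass_nil mu)).
  have [u su _] := hk [::] j h; have := he u su.
  have : m u <= 1 by apply: pr_le1; exact: measurable_cylinder.
  rewrite !cyl_mass_nil !mulr1 subr_ge0 /eta => h1 h2 h3.
  by apply: mulr_ile1 => //; [rewrite invr_ge0 ltW|exact: ltW|exact: le_trans h1].
have sn n : s (n * k)%N <= (1 - eta) ^+ n.
  elim: n => [|n IH].
    rewrite /s mul0n expr0 big_mkcond big_seq1 cyl_mass_nil.
    by case: ifP.
  rewrite mulSn addnC exprS (le_trans (step _)) // ler_wpM2l //.
apply/eqP; rewrite eq_le pr_ge0 andbT leNgt; apply/negP => P0.
have lt1 : 1 - eta < 1 by rewrite ltrBlDr ltrDl.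
have [n] := geometric_small eta1 lt1 ler01 P0.
rewrite mul1r; apply/negP; rewrite -leNgt; apply: le_trans (sn n).
by apply: pr_code_le => //; exact: closed_axis_line.
Qed.

End NullLines.

(** * Mesh squares *)

Section Mesh.
Context {R : realType}.
Implicit Types (delta rho : R) (p k : int * int) (x y : plane R).

Definition near_sq rho delta p x : bool :=
  (`|p.1%:~R * delta - x 0 0| <= rho * delta) && (`|p.2%:~R * delta - x 1 0| <= rho * delta).

Lemma near_sq_mesh rho delta p x y : 0 < delta -> mesh_square delta p x ->
  enorm (x - y) <= rho * delta -> near_sq (rho + 1) delta p y.
Proof.
move=> delta0 [/andP[x0 x0'] /andP[x1 x1']] xy.
have step (q : int) (u v : R) : q%:~R * delta <= u -> u <= (q + 1)%:~R * delta ->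
    `|u - v| <= rho * delta -> `|q%:~R * delta - v| <= (rho + 1) * delta.
  move=> h1 h2 h3; rewrite intrD mulrDl mul1r in h2.
  have -> : q%:~R * delta - v = (q%:~R * delta - u) + (u - v) by rewrite addrA subrK.
  rewrite mulrDl mul1r addrC (le_trans (ler_normD _ _)) // lerD //.
  by rewrite distrC ger0_norm ?subr_ge0 // lerBlDl.
apply/andP; split; [apply: step x0 x0' _|apply: step x1 x1' _]; apply: le_trans xy.
  by have := coord0_le_enorm (x - y); rewrite !mxE.
by have := coord1_le_enorm (x - y); rewrite !mxE.
Qed.

Definition int_box (n : nat) : seq (int * int) :=
  [seq (Posz i - Posz n, Posz j - Posz n) | i <- iota 0 (n.*2.+1), j <- iota 0 (n.*2.+1)].

Lemma mem_int_box n p : (`|p.1| <= n%:Z)%R -> (`|p.2| <= n%:Z)%R -> p \in int_box n.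
Proof.
move: p => [p1 p2] /=.
have H (q : int) : (`|q| <= n%:Z)%R -> exists2 i, i \in iota 0 (n.*2.+1) & q = Posz i - Posz n.
  rewrite ler_norml => /andP[h1 h2]; exists (absz (q + n%:Z)).
    have : ((absz (q + n%:Z))%:Z <= n.*2%:Z)%R.
      rewrite gez0_abs; last by rewrite -lerBlDr sub0r.
      by rewrite -addnn PoszD lerD2r.
    by rewrite mem_iota add0n ltnS lez_nat.
  by rewrite gez0_abs ?addrK // -lerBlDr sub0r.
move=> /H[i hi ->] /H[j hj ->]; apply/allpairsP; exists (i, j) => //.
Qed.

Lemma archi_int (a : R) : exists n : nat, forall q : int, `|q%:~R| <= a -> (`|q| <= n%:Z)%R.
Proof.
exists (Num.Def.archi_bound `|a|) => q hq.
have := archi_boundP (normr_ge0 a) => h.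
rewrite -(ler_int R) intr_norm (le_trans hq) // (le_trans (ler_norm _)) //.
by rewrite ltW.
Qed.

(** The indices of the squares near x lie in a box around that of x, whose size
    does not depend on delta. *)
Lemma count_near_sq rho : exists2 K : R, 0 < K & forall delta x (s : seq (int * int)),
  0 < delta -> uniq s -> {in s, forall p, near_sq rho delta p x} -> (size s)%:R <= K.
Proof.
have [n hn] := archi_int (rho + 1).
exists (size (int_box n)).+1%:R; first by rewrite ltr0n.
move=> delta x s delta0 us hs.
pose k i := Num.floor (x i 0 / delta).
pose f p := (p.1 - k 0, p.2 - k 1).
have finj : injective f.
  by move=> [a b] [a' b'] /= [] /addIr -> /addIr ->.
rewrite ler_nat leqW // -(size_map f); apply: uniq_leq_size.
  by rewrite map_inj_uniq.
move=> q /mapP[p ps ->]; have /andP[h0 h1] := hs p ps.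
have H (u : R) (a : int) : `|a%:~R * delta - u| <= rho * delta ->
    (`|a - Num.floor (u / delta)| <= n%:Z)%R.
  move=> h; apply: hn; rewrite intrB.
  have -> : a%:~R - (Num.floor (u / delta))%:~R =
    (a%:~R - u / delta) + (u / delta - (Num.floor (u / delta))%:~R).
    by rewrite addrA subrK.
  rewrite (le_trans (ler_normD _ _)) // lerD //.
    have -> : a%:~R - u / delta = (a%:~R * delta - u) / delta.
      by rewrite mulrBl mulfK // gt_eqF.
    by rewrite normrM normfV (gtr0_norm delta0) ler_pdivrMr.
  have := floor_itv (u / delta); rewrite intrD => /andP[f1 f2].
  by rewrite ger0_norm ?subr_ge0 // lerBlDl ltW.
by apply: mem_int_box; exact: H.
Qed.

Lemma closed_coord_itv (j : 'I_2) (a b : R) : closed [set x : plane R | a <= x j 0 <= b].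
Proof.
move=> x cx.
have near e : 0 < e -> exists y : plane R, a <= y j 0 <= b /\ `|x j 0 - y j 0| < e.
  move=> e0; have [y [/= hy xy]] : [set x : plane R | a <= x j 0 <= b] `&` [set y | enorm (x - y) < e] !=set0.
    by apply: cx; apply/nbhs_enorm; exists e.
  exists y; split=> //; apply: le_lt_trans xy.
  have -> : x j 0 - y j 0 = (x - y) j 0 by rewrite !mxE.
  by move: j {cx hy}; apply: ord2_ind; [exact: coord0_le_enorm|exact: coord1_le_enorm].
apply/andP; split; rewrite leNgt; apply/negP => h.
  have [|y [/andP[h1 h2]]] := near (a - x j 0); first by rewrite subr_gt0.
  rewrite distrC; move=> /(le_lt_trans (ler_norm _)); rewrite ltrD2r.
  by rewrite ltNge h1.
have [|y [/andP[h1 h2]]] := near (x j 0 - b); first by rewrite subr_gt0.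
by move=> /(le_lt_trans (ler_norm _)); rewrite ltrD2l ltrN2 ltNge h2.
Qed.

Lemma closed_mesh_square delta p : closed (mesh_square delta p).
Proof. by apply: closedI; exact: closed_coord_itv. Qed.

Definition mesh_index delta x : int * int :=
  (Num.floor (x 0 0 / delta), Num.floor (x 1 0 / delta)).

Lemma mesh_indexP delta x : 0 < delta -> mesh_square delta (mesh_index delta x) x.
Proof.
move=> delta0.
have H (u : R) : (Num.floor (u / delta))%:~R * delta <= u <= (Num.floor (u / delta) + 1)%:~R * delta.
  have /andP[f1 f2] := floor_itv (u / delta).
  by rewrite -ler_pdivlMr // f1 -ler_pdivrMr // ltW.
by split; exact: H.
Qed.

End Mesh.

Lemma bernoulli_ineq (R : realDomainType) (b : R) n : 1 <= b -> 1 + n%:R * (b - 1) <= b ^+ n.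
Proof.
move=> b1; elim: n => [|n IH]; first by rewrite mul0r addr0.
rewrite exprS; apply: (@le_trans _ _ (b * (1 + n%:R * (b - 1)))); last first.
  by rewrite ler_wpM2l // (le_trans ler01).
have : 0 <= n%:R * (b - 1) * (b - 1) by rewrite !mulr_ge0 ?subr_ge0.
by rewrite -natr1; lra.
Qed.

(** The number of generations needed to reach scale delta is logarithmic, hence
    negligible against every power of delta. *)
Lemma scale_level (R : realType) (c eta : R) : 0 < c -> c < 1 -> 0 < eta ->
  exists2 C : R, 0 < C & forall delta, 0 < delta -> delta < 1 ->
    exists N, c ^+ N <= delta /\ N.+1%:R <= C * delta `^ (- eta).
Proof.
move=> c0 c1 eta0; pose b := c `^ (- eta).
have b1 : 1 < b.
  rewrite /b powRN -[ltLHS]invr1 ltf_pV2 ?posrE ?powR_gt0 //.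
  by rewrite -[ltRHS](congr1 (fun f => f eta) (powR1 R)) gt0_ltr_powR ?nnegrE ?(ltW c0).
have b10 : 0 < b - 1 by rewrite subr_gt0.
exists (2 + (b - 1)^-1) => [|delta delta0 delta1]; first by rewrite addr_gt0 ?invr_gt0.
have [n0 hn0] := geometric_small (ltW c0) c1 ler01 delta0.
have ex : exists n, c ^+ n <= delta by exists n0; rewrite -[leLHS]mul1r ltW.
exists (ex_minn ex); case: ex_minnP => -[|n] hn min_n.
  by move: (le_lt_trans hn delta1); rewrite expr0 ltxx.
split=> //; have cn : delta < c ^+ n.
  by rewrite ltNge; apply/negP => /min_n; rewrite ltnn.
have bn : b ^+ n <= delta `^ (- eta).
  rewrite /b -powR_mulrn ?powR_ge0 // powRAC powR_mulrn ?(ltW c0) //.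
  rewrite !powRN lef_pV2 ?posrE ?powR_gt0 ?exprn_gt0 //.
  by apply: powR_le; rewrite ?ltW.
rewrite (le_trans _ (ler_wpM2l _ bn)) ?addr_ge0 ?invr_ge0 ?(ltW b10) ?ler0n //.
have := bernoulli_ineq n (ltW b1); rewrite addrC -lerBrDr => h.
have hn1 : n%:R <= (b - 1)^-1 * b ^+ n.
  rewrite mulrC ler_pdivlMr //; apply: (le_trans h); rewrite lerBlDr lerDl //.
have one : 1 <= b ^+ n by rewrite exprn_ege1 // ltW.
rewrite mulrDl -!natr1; lra.
Qed.

(** * Square masses at one scale *)

Section ScaleEstimates.
Context {R : realType} {L : finPointedType}.
Variables (A : L -> 'M[R]_2) (t : L -> plane R) (F : set (plane R)) (d : R).
Variable mu : probability (symbolic L) R.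
Hypothesis A_unit : forall i, A i \in unitmx.
Hypothesis A_contr : forall i, linear_contraction (A i).
Hypothesis F_attr : attractor (affine A t) F.
Hypothesis sep : forall i j, i != j ->
     (affine A t i @` F) `&` (affine A t j @` F) = set0.
Hypothesis d_ge0 : 0 <= d.
Local Notation T := (affine A t).
Local Notation Sigma := (symbolic L).
Local Notation code := (coding T : Sigma -> plane R).
Local Notation m := (cyl_mass mu).
Variables (C1 C2 : R).
Hypothesis C10 : 0 < C1.
Hypothesis C20 : 0 < C2.
Hypothesis m_bounds : forall w, C1^-1 * sv1 (word_mx A w) `^ d <= m w /\
    m w <= C1 * sv1 (word_mx A w) `^ d.
Hypothesis m_mult : forall u v, m (u ++ v) <= C2 * (m u * m v).

Definition square_mass (delta : R) (p : int * int) : R :=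
  pr mu (code @^-1` (mesh_square delta p)).
Local Notation nu := square_mass.

Lemma measurable_square delta p : measurable (code @^-1` (mesh_square delta p)).
Proof.
exact: (measurable_code_preimage mu A_unit A_contr F_attr (@closed_mesh_square R delta p)).
Qed.

Lemma square_mass_ge0 delta p : 0 <= nu delta p. Proof. exact: pr_ge0. Qed.

Lemma square_mass_le1 delta p : nu delta p <= 1.
Proof. by apply: pr_le1; exact: measurable_square. Qed.

Lemma double_counting rho : exists2 K : R, 0 < K & forall delta n (J : seq (int * int))
    (z : seq L -> plane R) (f : seq L -> R), 0 < delta -> uniq J -> (forall w, 0 <= f w) ->
  \sum_(p <- J) \sum_(w <- words n | near_sq rho delta p (z w)) f w <=
    K * \sum_(w <- words n) f w.
Proof.
have [K K0 hK] := @count_near_sq R rho; exists K => // delta n J z f delta0 uJ f0.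
under eq_bigr do rewrite big_mkcond.
rewrite exchange_big /= mulr_sumr; apply: ler_sum => w _.
rewrite -big_mkcond /= -big_filter big_const_seq count_predT iter_addr_0 -[leLHS]mulr_natl.
rewrite ler_wpM2r //; apply: (hK delta (z w)) => //; first by rewrite filter_uniq.
by move=> p; rewrite mem_filter => /andP[].
Qed.

(** All masses at scale delta can be read off from the finitely many base
    points of a generation whose pieces have diameter of order delta. *)
Lemma discretisation : exists c : R, [/\ 0 < c, c < 1,
   forall w, sv1 (word_mx A w) <= c ^+ size w &
   exists2 z : seq L -> plane R, (forall w, F (z w) /\ exists2 x, F x & forall u, z (u ++ w) = word_map T u x) &
   exists2 rho : R, 0 < rho & forall delta N p, 0 < delta -> c ^+ N <= delta ->
     nu delta p <= \sum_(w <- words N | near_sq rho delta p (z w)) m w].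
Proof.
have [c [c0 c1 hc]] := uniform_contraction A_contr; exists c; split=> //.
have [z0 Fz0] := F_nonempty F_attr.
exists (fun w => word_map T w z0).
  move=> w; split; first exact: (word_map_in_F F_attr).
  exists (word_map T w z0) => [|u]; first exact: (word_map_in_F F_attr).
  exact: word_map_cat.
have [D D0 hD] := F_diameter F_attr.
exists (D + 1) => [|delta N p delta0 cN]; first by rewrite addr_gt0.
apply: (@le_trans _ _ (\sum_(w <- words N | piece_meets A t F (mesh_square delta p) w) m w)).
  by apply: pr_code_le => //; exact: closed_mesh_square.
rewrite big_mkcond [leRHS]big_mkcond big_seq [leRHS]big_seq.
apply: ler_sum => w /size_words sw; case: ifP => [/asboolP[y Fy Qy]|_].
  rewrite ifT //; apply: (near_sq_mesh delta0 Qy).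
  rewrite (le_trans (enorm_word_map _ _ _ _ _)) // mulrC.
  apply: ler_pM; rewrite ?sv1_ge0 ?enorm_ge0 ?hD //.
  by rewrite (le_trans (hc w)) // sw.
by case: ifP => // _; exact: cyl_mass_ge0.
Qed.

Lemma sum_mass n : \sum_(w <- words n) m w = 1.
Proof. exact: sum_m (cyl_mass_nil mu) (cyl_mass_rcons mu) n. Qed.

Lemma sum_square_mass_le : exists2 K : R, 0 < K & forall delta J, 0 < delta ->
  uniq J -> \sum_(p <- J) nu delta p <= K.
Proof.
have [c [c0 c1 hc [z _ [rho rho0 hrho]]]] := discretisation.
have [K K0 hK] := double_counting rho; exists K => // delta J delta0 uJ.
have [N hN] := geometric_small (ltW c0) c1 ler01 delta0; rewrite mul1r in hN.
apply: (@le_trans _ _ (\sum_(p <- J) \sum_(w <- words N | near_sq rho delta p (z w)) m w)).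
  by apply: ler_sum => p _; exact: hrho (ltW hN).
apply: (le_trans (hK _ _ _ _ _ delta0 uJ (cyl_mass_ge0 mu))).
by rewrite sum_mass mulr1.
Qed.

(** A square that carries mass contains a coded point; the first cylinder around
    it whose larger singular value drops below delta has mass comparable to
    delta ^ d and stays near the square.  Hence there are few such squares. *)
Lemma count_charged : exists2 K : R, 0 < K & forall delta J, 0 < delta -> delta < 1 ->
  uniq J -> (forall p, p \in J -> 0 < nu delta p) -> (size J)%:R <= K * delta `^ (- d).
Proof.
have [c [c0 c1 hc]] := uniform_contraction A_contr.
have [z0 Fz0] := F_nonempty F_attr.
have [D D0 hD] := F_diameter F_attr.
have [b b0 hb] := @fin_pos_lower_bound R L (fun i => sv2 (A i)) (fun i => sv2_gt0 (A_unit i)).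
have [K K0 hK] := double_counting (D + 1).
exists (K * (C1 * b^-1 `^ d)) => [|delta J delta0 delta1 uJ hJ].
  by rewrite !mulr_gt0 ?powR_gt0 ?invr_gt0.
have [N hN] := geometric_small (ltW c0) c1 ler01 delta0; rewrite mul1r in hN.
pose z w := word_map T w z0.
pose low : R := C1^-1 * (b * delta) `^ d.
have low0 : 0 < low by rewrite mulr_gt0 ?invr_gt0 ?powR_gt0 ?mulr_gt0.
have step p : p \in J -> low <= \sum_(w <- words N | near_sq (D + 1) delta p (z w)) m w.
  move=> /hJ nup.
  have [a Qa] : exists a : Sigma, mesh_square delta p (code a).
    apply: contrapT => h; move: nup.
    have -> : nu delta p = 0; last by rewrite ltxx.
    rewrite /nu (_ : _ @^-1` _ = set0) ?pr_set0 // -subset0 => a Qa.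
    by apply: h; exists a.
  have ex : exists k, sv1 (word_mx A (mkseq a k)) <= delta.
    by exists N; rewrite (le_trans (hc _)) // size_mkseq ltW.
  pose k := ex_minn ex.
  have [hk kN mk] : [/\ sv1 (word_mx A (mkseq a k)) <= delta, (k <= N)%N &
      b * delta <= sv1 (word_mx A (mkseq a k))].
    rewrite /k; case: ex_minnP => l hl min_l; split=> //.
      by apply: min_l; rewrite (le_trans (hc _)) // size_mkseq ltW.
    case: l hl min_l => [|l] hl min_l.
      by move: (le_lt_trans hl delta1); rewrite word_mx_nil sv1_1 ltxx.
    have dl : delta < sv1 (word_mx A (mkseq a l)).
      by rewrite ltNge; apply/negP => /min_l; rewrite ltnn.
    rewrite mkseqS word_mx_rcons (le_trans _ (sv1M_ge _ (A_unit _))) // mulrC.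
    by apply: ler_pM; rewrite ?(ltW delta0) ?(ltW b0) ?(ltW dl).
  set w := mkseq a k in hk mk.
  have sw : size w = k by rewrite size_mkseq.
  apply: (@le_trans _ _ (m w)).
    apply: le_trans (m_bounds w).1; rewrite ler_pM2l ?invr_gt0 //; apply: powR_le => //.
    by rewrite mulr_ge0 ?ltW.
  have [l NE] : {l | N = (k + l)%N} by exists (N - k)%N; rewrite subnKC.
  rewrite -(sum_m_cat (cyl_mass_rcons mu) w l) NE [leRHS]big_mkcond sum_words_cat /=.
  rewrite [leRHS](bigD1_seq w) ?words_uniq ?mem_words ?sw //=.
  apply: (@le_trans _ _ (\sum_(v <- words l) if near_sq (D + 1) delta p (z (w ++ v)) then m (w ++ v) else 0)).
    apply: ler_sum => v _; rewrite ifT //; apply: (near_sq_mesh delta0 Qa).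
    have [y Fy ->] := coding_in_cylinder A_unit A_contr F_attr a k.
    rewrite /z word_map_cat (le_trans (enorm_word_map _ _ _ _ _)) // mulrC.
    by apply: ler_pM; rewrite ?sv1_ge0 ?enorm_ge0 ?hD //; exact: (word_map_in_F F_attr).
  rewrite lerDl sumr_ge0 // => u _; rewrite sumr_ge0 // => v _.
  by case: ifP => // _; exact: cyl_mass_ge0.
have total : (size J)%:R * low <= K.
  apply: (@le_trans _ _ (\sum_(p <- J) \sum_(w <- words N | near_sq (D + 1) delta p (z w)) m w)).
    rewrite -[(size J)%:R](_ : \sum_(p <- J) 1 = _); last by rewrite big_const_seq count_predT iter_addr_0.
    rewrite mulr_suml big_seq [leRHS]big_seq; apply: ler_sum => p pJ.
    by rewrite mul1r; exact: step.
  apply: (le_trans (hK _ _ _ _ _ delta0 uJ (cyl_mass_ge0 mu))).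
  by rewrite sum_mass mulr1.
rewrite -ler_pdivlMr // in total; apply: (le_trans total); apply: eq_ler.
rewrite /low powRM ?(ltW b0) ?(ltW delta0) // powRN -[b^-1]powR_inv1 ?(ltW b0) //.
rewrite -powRrM mulN1r powRN !invfM invrK; ring.
Qed.

Variables (p CW : R).
Hypothesis p1 : 1 <= p.
Hypothesis distortion : forall n (v : plane R), v != 0 ->
  distortion_sum A (p * d) d n v <= CW.

Let p0 : 0 < p. Proof. exact: lt_le_trans p1. Qed.

(** Among the points near a square every pair is at distance of order delta, so
    the moments of the square masses are bounded by the energy at that scale. *)
Lemma moment_bound s : s < d -> exists2 K : R, 0 < K & forall delta J, 0 < delta ->
  delta < 1 -> uniq J -> \sum_(x <- J) nu delta x `^ (p + 1) <= K * delta `^ (p * s).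
Proof.
move=> sd.
have [c [c0 c1 hc [z hz [rho rho0 hrho]]]] := discretisation.
have [K K0 hK] := double_counting rho.
have [g g0 hg] := separation_gap A_unit F_attr sep.
(* (p + 1) powers of the number of generations are lost in the energy *)
pose eta := p * (d - s) / (p + 1).
have pp : 0 < p + 1 by rewrite addr_gt0.
have eta0 : 0 < eta by rewrite divr_gt0 ?mulr_gt0 ?subr_gt0.
have [Ce Ce0 hCe] := scale_level c0 c1 eta0.
have zB w a b : z (w ++ a) - z (w ++ b) = word_mx A w *m (z a - z b).
  have [_ [x _ hx]] := hz a; have [_ [y _ hy]] := hz b.
  have za : z a = x := hx [::]; have zb : z b = y := hy [::].
  by rewrite hx hy word_mapB za zb.
have z_sep i j a b : i != j -> g <= enorm (z (i :: a) - z (j :: b)).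
  have [_ [x Fx hx]] := hz a; have [_ [y Fy hy]] := hz b.
  by move=> ij; rewrite (hx [:: i]) (hy [:: j]); apply: hg.
have m_up w : m w <= C1 * sv1 (word_mx A w) `^ d := (m_bounds w).2.
have energy := energy_le A_unit d_ge0 p1 (cyl_mass_ge0 mu) (cyl_mass_nil mu)
  (cyl_mass_rcons mu) m_mult m_up zB g0 z_sep distortion.
pose K1 := C2 ^+ 2 * C1 `^ (p + 1) * g^-1 `^ (p * d).
have K10 : 0 <= K1 by rewrite /K1 !mulr_ge0 ?powR_ge0 ?exprn_ge0 ?(ltW C20).
rewrite -/K1 in energy; clearbody K1.
have CW0 : 0 <= CW.
  have one : (\col_j 1 : plane R) != 0.
    by apply/eqP => /matrixP /(_ 0 0); rewrite !mxE => /eqP; rewrite oner_eq0.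
  exact: le_trans (distortion_sum_ge0 _ _ _ _ _) (distortion 0%N one).
pose K2 := C1 `^ p + K1 * (4 * rho) `^ (p * d) * CW.
have K20 : 0 < K2.
  by rewrite ltr_pwDl ?powR_gt0 // !mulr_ge0 ?powR_ge0.
exists (K * (Ce `^ (p + 1) * K2)) => [|delta J delta0 delta1 uJ].
  by rewrite !mulr_gt0 ?powR_gt0.
have [N [cN hN]] := hCe delta delta0 delta1.
pose r := 4 * rho * delta.
have r0 : 0 <= r by rewrite !mulr_ge0 // ltW.
pose G a := \sum_(b <- words N | enorm (z a - z b) <= r) m b.
have G0 a : 0 <= G a by apply: sumr_ge0 => b _; exact: cyl_mass_ge0.
have step x : nu delta x `^ (p + 1) <=
    \sum_(a <- words N | near_sq rho delta x (z a)) m a * G a `^ p.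
  have nu0 := square_mass_ge0 delta x; have nle := hrho delta N x delta0 cN.
  have nuE : nu delta x `^ (p + 1) = nu delta x * nu delta x `^ p.
    by rewrite -(mulr_powRB1 nu0 pp) addrK.
  rewrite nuE (le_trans (ler_wpM2r (powR_ge0 _ _) nle)) // mulr_suml.
  apply: ler_sum => a near_a; rewrite ler_wpM2l ?cyl_mass_ge0 //.
  apply: powR_le; rewrite ?(ltW p0) // (le_trans nle) // /G.
  rewrite big_mkcond [leRHS]big_mkcond /=; apply: ler_sum => b _.
  case: ifP => [near_b|_]; last by case: ifP => // _; exact: cyl_mass_ge0.
  rewrite ifT // (le_trans (enorm_le_coord _)) //.
  have tri (u v w : R) : `|u - v| <= rho * delta -> `|u - w| <= rho * delta -> `|v - w| <= 2 * rho * delta.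
    move=> h1 h2; have -> : v - w = (u - w) - (u - v) by rewrite opprB [RHS]addrC addrA subrK.
    by rewrite (le_trans (ler_normB _ _)) // -mulrA mulr_natl mulr2n lerD.
  move: near_a near_b => /andP[a0 a1] /andP[b0 b1].
  have h0 := tri _ _ _ a0 b0; have h1 := tri _ _ _ a1 b1.
  rewrite !mxE; apply: (le_trans (lerD h0 h1)); apply: eq_ler; rewrite /r; ring.
apply: (le_trans (ler_sum _ (fun x _ => step x))).
have f0 w : 0 <= m w * G w `^ p by rewrite mulr_ge0 ?powR_ge0 ?cyl_mass_ge0.
apply: (le_trans (hK _ _ _ _ _ delta0 uJ f0)); rewrite -mulrA ler_pM2l //.
have me a : size a = N -> m a <= C1 * delta `^ d.
  move=> sa; apply: (le_trans (m_up a)); rewrite ler_pM2l //; apply: powR_le => //.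
    exact: sv1_ge0.
  by rewrite (le_trans (hc a)) // sa.
apply: (le_trans (energy N r _ r0 me)).
have dp0 := powR_ge0 delta (p * d).
have N0 : 0 <= (N.+1%:R : R) by rewrite ler0n.
have bound : (C1 * delta `^ d) `^ p + N%:R * (K1 * r `^ (p * d) * CW) <=
    N.+1%:R * (K2 * delta `^ (p * d)).
  have -> : (C1 * delta `^ d) `^ p = C1 `^ p * delta `^ (p * d).
    by rewrite powRM ?powR_ge0 ?(ltW C10) // [p * d]mulrC powRrM.
  have -> : r `^ (p * d) = (4 * rho) `^ (p * d) * delta `^ (p * d).
    by rewrite /r powRM ?mulr_ge0 ?(ltW rho0) ?(ltW delta0).
  rewrite /K2 (mulrDl (C1 `^ p)) mulrDr; apply: lerD.
    by rewrite ler_peMl ?mulr_ge0 ?powR_ge0 // ler1n.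
  rewrite (_ : K1 * (_ * _) * CW = K1 * (4 * rho) `^ (p * d) * CW * delta `^ (p * d)); last by ring.
  by rewrite ler_wpM2r ?ler_nat // !mulr_ge0 ?powR_ge0.
apply: (le_trans (ler_wpM2l (powR_ge0 _ _) bound)).
have -> : N.+1%:R `^ p * (N.+1%:R * (K2 * delta `^ (p * d))) =
    N.+1%:R `^ (p + 1) * (K2 * delta `^ (p * d)).
  by rewrite -(mulr_powRB1 N0 pp) addrK; ring.
have hN1 : N.+1%:R `^ (p + 1) <= Ce `^ (p + 1) * delta `^ (- (p * (d - s))).
  apply: (@le_trans _ _ ((Ce * delta `^ (- eta)) `^ (p + 1))).
    by apply: powR_le => //; exact: ltW.
  rewrite powRM ?powR_ge0 ?(ltW Ce0) // -powRrM mulNr.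
  by rewrite /eta divfK ?lt0r_neq0.
apply: (le_trans (ler_wpM2r _ hN1)); first by rewrite mulr_ge0 // ltW.
apply: eq_ler.
have -> : p * s = - (p * (d - s)) + p * d by ring.
rewrite (@powRD _ delta); last by rewrite (gt_eqF delta0) implybT.
by ring.
Qed.

End ScaleEstimates.

(** * Interpolation between moments *)

Section MomentInterpolation.
Context {R : realType}.
Implicit Types (x a t : R) (xs : seq R).

Definition moment (q : R) xs : R := \sum_(x <- xs) x `^ q.

(** Interpolation between exponents with a free threshold a: below the
    threshold the smaller exponent is used, above it the larger one. *)
Lemma powR_interpolation x a (q1 q q2 : R) : 0 < x -> 0 < a -> q1 <= q -> q <= q2 ->
  x `^ q <= a `^ (q - q1) * x `^ q1 + a `^ (q - q2) * x `^ q2.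
Proof.
move=> x0 a0 q1q qq2.
have split_exp (r : R) : x `^ q = x `^ (q - r) * x `^ r.
  by rewrite -powRD ?subrK // (gt_eqF x0) implybT.
have [xa|ax] := leP x a.
  rewrite [leLHS](split_exp q1) (@le_trans _ _ (a `^ (q - q1) * x `^ q1)) //.
    by rewrite ler_wpM2r ?powR_ge0 // powR_le ?subr_ge0 // ltW.
  by rewrite lerDl mulr_ge0 ?powR_ge0.
rewrite [leLHS](split_exp q2) (@le_trans _ _ (a `^ (q - q2) * x `^ q2)) //.
  rewrite ler_wpM2r ?powR_ge0 // -[q - q2]opprB !powRN lef_pV2 ?posrE ?powR_gt0 //.
  by rewrite powR_le ?subr_ge0 // ltW.
by rewrite lerDr mulr_ge0 ?powR_ge0.
Qed.

Lemma moment_interpolation xs a (q1 q q2 : R) : {in xs, forall x, 0 < x} -> 0 < a ->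
  q1 <= q -> q <= q2 ->
  moment q xs <= a `^ (q - q1) * moment q1 xs + a `^ (q - q2) * moment q2 xs.
Proof.
move=> xs0 a0 q1q qq2; rewrite /moment !mulr_sumr -big_split /=.
by rewrite big_seq [leRHS]big_seq; apply: ler_sum => x /xs0 x0; exact: powR_interpolation.
Qed.

Lemma moment0 xs : moment 0 xs = (size xs)%:R.
Proof.
rewrite /moment (eq_bigr (fun=> 1)); last by move=> x _; rewrite powRr0.
by rewrite big_const_seq count_predT iter_addr_0.
Qed.

Lemma moment1 xs : {in xs, forall x, 0 < x} -> moment 1 xs = \sum_(x <- xs) x.
Proof.
move=> xs0; rewrite /moment big_seq [RHS]big_seq.
by apply: eq_bigr => x /xs0 x0; rewrite powRr1 // ltW.
Qed.

Section OneScale.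
Variables (xs : seq R) (K p : R).
Hypothesis xs0 : {in xs, forall x, 0 < x}.
Hypothesis p0 : 0 < p.
Hypothesis K0 : 0 < K.
Hypothesis mass_ge1 : 1 <= moment 1 xs.
Hypothesis mass_le : moment 1 xs <= K.

Let powR_split (a r u : R) : 0 < a -> a `^ (r + u) = a `^ r * a `^ u.
Proof. by move=> a0; rewrite powRD // (gt_eqF a0) implybT. Qed.

Lemma moment_le_of_count t q : 0 < t -> 0 <= q -> q <= 1 -> (size xs)%:R <= K * t^-1 ->
  moment q xs <= 2 * K * t `^ (q - 1).
Proof.
move=> t0 q0 q1 cnt; apply: (le_trans (moment_interpolation xs0 t0 q0 q1)).
rewrite moment0 subr0 -mulrA mulr_natl mulr2n; apply: lerD.
  apply: (le_trans (ler_wpM2l (powR_ge0 _ _) cnt)); apply: eq_ler.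
  by rewrite (powR_split q (-1) t0) powR_inv1 ?(ltW t0) //; ring.
by rewrite mulrC ler_wpM2r ?powR_ge0.
Qed.

Lemma moment_ge_of_moment t M q : 0 < t -> 0 < M -> q <= 1 ->
  moment (p + 1) xs <= K * t `^ p -> K * M `^ (- p) <= 1 / 2 ->
  1 / 2 * M `^ (q - 1) * t `^ (q - 1) <= moment q xs.
Proof.
move=> t0 M0 q1 mom hM; have a0 : 0 < M * t by rewrite mulr_gt0.
have p1 : 1 <= p + 1 by rewrite lerDr ltW.
have := moment_interpolation xs0 a0 q1 p1.
have -> : 1 - (p + 1) = - p by ring.
move=> /(le_trans mass_ge1) h.
have h2 : (M * t) `^ (- p) * moment (p + 1) xs <= 1 / 2.
  apply: (le_trans (ler_wpM2l (powR_ge0 _ _) mom)).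
  rewrite powRM ?(ltW t0) ?(ltW M0) // [t `^ (- p)]powRN.
  apply: le_trans hM; apply: eq_ler; field.
  by rewrite gt_eqF // powR_gt0.
have h3 : 1 / 2 <= (M * t) `^ (1 - q) * moment q xs by lra.
rewrite -mulrA -powRM ?(ltW t0) ?(ltW M0) // -[q - 1]opprB powRN.
by rewrite ler_pdivrMr ?powR_gt0 // [leRHS]mulrC.
Qed.

Lemma moment_le_of_moment t q : 0 < t -> 1 <= q -> q <= p + 1 ->
  moment (p + 1) xs <= K * t `^ p -> moment q xs <= 2 * K * t `^ (q - 1).
Proof.
move=> t0 q1 qp mom; apply: (le_trans (moment_interpolation xs0 t0 q1 qp)).
rewrite -mulrA mulr_natl mulr2n; apply: lerD.
  by rewrite mulrC ler_wpM2r ?powR_ge0.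
apply: (le_trans (ler_wpM2l (powR_ge0 _ _) mom)); apply: eq_ler.
rewrite (_ : q - 1 = (q - (p + 1)) + p); last by ring.
by rewrite (powR_split (q - (p + 1)) p t0); ring.
Qed.

Lemma moment_ge_of_count t q : 0 < t -> 1 <= q -> (size xs)%:R <= K * t^-1 ->
  1 / 2 * (2 * K)^-1 `^ (q - 1) * t `^ (q - 1) <= moment q xs.
Proof.
move=> t0 q1 cnt; pose e := (2 * K)^-1.
have e0 : 0 < e by rewrite invr_gt0 mulr_gt0.
have a0 : 0 < e * t by rewrite mulr_gt0.
have := moment_interpolation xs0 a0 ler01 q1.
rewrite moment0 subr0 powRr1 ?(ltW a0) // => /(le_trans mass_ge1) h.
have h2 : e * t * (size xs)%:R <= 1 / 2.
  apply: (le_trans (ler_wpM2l (ltW a0) cnt)).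
  by apply: eq_ler; rewrite /e; field; rewrite !gt_eqF.
have h3 : 1 / 2 <= (e * t) `^ (1 - q) * moment q xs by lra.
rewrite -/e -mulrA -powRM ?(ltW t0) ?(ltW e0) //.
rewrite -[1 - q]opprB powRN in h3.
by move: h3; rewrite [leRHS]mulrC ler_pdivlMr ?powR_gt0.
Qed.

(** ln y <= y - 1 at y = t / x. *)
Lemma entropy_le t : 0 < t -> (size xs)%:R <= K * t^-1 ->
  \sum_(x <- xs) - (x * ln x) <= - ln t * moment 1 xs + K.
Proof.
move=> t0 cnt.
apply: (@le_trans _ _ (\sum_(x <- xs) (- ln t * x + t))).
  rewrite big_seq [leRHS]big_seq; apply: ler_sum => x /xs0 x0.
  have := @le_ln1Dx R (t / x - 1).
  rewrite ltrBrDl subrr addrC subrK divr_gt0 // => /(_ isT).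
  rewrite ln_div ?posrE // => h.
  have := ler_wpM2l (ltW x0) h.
  rewrite mulrBr mulrBr mulr1 mulrCA divff ?gt_eqF // mulr1 => h2.
  lra.
rewrite big_split /= -mulr_sumr -moment1 // lerD2l.
rewrite big_const_seq count_predT iter_addr_0 -mulr_natl.
by apply: (le_trans (ler_wpM2r (ltW t0) cnt)); rewrite mulfVK // gt_eqF.
Qed.

(** ln y <= y - 1 at y = (x / t) ^ p, which brings in the moment of order
    p + 1. *)
Lemma entropy_ge t : 0 < t -> t <= 1 -> moment (p + 1) xs <= K * t `^ p ->
  - ln t - p^-1 * K <= \sum_(x <- xs) - (x * ln x).
Proof.
move=> t0 t1 mom.
apply: (@le_trans _ _ (\sum_(x <- xs) (- ln t * x - p^-1 * t `^ (- p) * x `^ (p + 1)))); last first.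
  rewrite big_seq [leRHS]big_seq; apply: ler_sum => x /xs0 x0.
  have r0 : 0 < (x / t) `^ p by apply: powR_gt0; rewrite divr_gt0.
  have := @le_ln1Dx R ((x / t) `^ p - 1).
  rewrite ltrBrDl subrr addrC subrK r0 => /(_ isT).
  rewrite ln_powR ln_div ?posrE // => h.
  have hp : ln x - ln t <= p^-1 * (x / t) `^ p.
    rewrite mulrC ler_pdivlMr // mulrC (le_trans h) // lerBlDr lerDl //.
  have := ler_wpM2l (ltW x0) hp.
  have -> : x * (p^-1 * (x / t) `^ p) = p^-1 * t `^ (- p) * x `^ (p + 1).
    rewrite powRM ?(ltW x0) ?invr_ge0 ?(ltW t0) // powR_split // powRr1 ?(ltW x0) //.
    rewrite -[t^-1]powR_inv1 ?(ltW t0) // -powRrM mulN1r; ring.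
  rewrite mulrBr => h2; lra.
rewrite sumrB -!mulr_sumr -moment1 // -/(moment (p + 1) xs); apply: lerB.
  by rewrite ler_peMr // oppr_ge0 ln_le0.
rewrite -mulrA ler_pM2l ?invr_gt0 //.
apply: (le_trans (ler_wpM2l (powR_ge0 _ _) mom)); apply: eq_ler.
by rewrite powRN; field; rewrite gt_eqF // powR_gt0.
Qed.

End OneScale.

Let lin_lo (x y z w : R) : y + x <= w -> - z <= y -> x - z <= w.
Proof. lra. Qed.

Let lin_hi (x y z w : R) : w <= y + x -> y <= z -> w <= x + z.
Proof. lra. Qed.

(** The exponent read off from the moment of order q at scale delta. *)
Definition scale_exponent (q : R) xs (delta : R) : R :=
  if q == 1 then (\sum_(x <- xs) - (x * ln x)) / - ln delta
  else ln (moment q xs) / ((q - 1) * ln delta).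

Section ScaleExponents.
Variables (xs : R -> seq R) (d p K : R).
Hypothesis d0 : 0 <= d.
Hypothesis p0 : 0 < p.
Hypothesis K0 : 0 < K.
Hypothesis xs0 : forall delta : R, {in xs delta, forall x, 0 < x}.
Hypothesis xs1 : forall delta : R, {in xs delta, forall x, x <= 1}.
Hypothesis mass_ge1 : forall delta : R, 0 < delta -> delta < 1 -> 1 <= moment 1 (xs delta).
Hypothesis mass_le : forall delta : R, 0 < delta -> delta < 1 -> moment 1 (xs delta) <= K.
Hypothesis mass_eq1 : 0 < d -> forall delta : R, 0 < delta -> delta < 1 -> moment 1 (xs delta) = 1.
Hypothesis count_le : forall delta : R, 0 < delta -> delta < 1 ->
  (size (xs delta))%:R <= K * delta `^ (- d).
Hypothesis moment_le : forall s, s < d -> exists2 Ks : R, 0 < Ks &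
  forall delta : R, 0 < delta -> delta < 1 -> moment (p + 1) (xs delta) <= Ks * delta `^ (p * s).

(** Constants in front of powers of delta disappear at the rate 1 / ln delta;
    the sign of q - 1 decides which bound of the moment yields which bound of the
    exponent. *)
Lemma exponent_of_bounds (q c C u v delta M : R) : q != 1 -> 0 < delta -> delta < 1 ->
  0 < c -> 0 < C -> c * (delta `^ u) `^ (q - 1) <= M -> M <= C * (delta `^ v) `^ (q - 1) ->
  forall B X, B = (`|ln c| + `|ln C|) / `|q - 1| -> X = ln M / ((q - 1) * ln delta) ->
  if q < 1 then u - B / - ln delta <= X <= v + B / - ln delta
  else v - B / - ln delta <= X <= u + B / - ln delta.
Proof.
move=> q1 delta0 delta1 c0 C0 lo hi B X BD XD.
have l0 : 0 < - ln delta by rewrite oppr_gt0 ln_lt0 // delta0.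
have q10 : q - 1 != 0 by rewrite subr_eq0.
have nq : 0 < `|q - 1| by rewrite normr_gt0.
have M0 : 0 < M by apply: lt_le_trans lo; rewrite mulr_gt0 ?powR_gt0.
have lo' : ln c + (q - 1) * (u * ln delta) <= ln M.
  have := lo; rewrite -ler_ln ?posrE ?mulr_gt0 ?powR_gt0 //.
  by rewrite lnM ?posrE ?powR_gt0 // !ln_powR.
have hi' : ln M <= ln C + (q - 1) * (v * ln delta).
  have := hi; rewrite -ler_ln ?posrE ?mulr_gt0 ?powR_gt0 //.
  by rewrite lnM ?posrE ?powR_gt0 // !ln_powR.
have cB : - (`|ln c| + `|ln C|) <= ln c.
  by rewrite lerNl (le_trans (ler_norm _)) // normrN lerDl.
have CB : ln C <= `|ln c| + `|ln C| by rewrite (le_trans (ler_norm _)) // lerDr.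
set S := `|ln c| + `|ln C| in BD cB CB.
set l := - ln delta in l0 *; have lE : ln delta = - l by rewrite opprK.
have XE : X * ((q - 1) * l) = - ln M.
  rewrite XD lE mulrN invrN mulrN mulNr divfK // mulf_neq0 // gt_eqF //.
rewrite lE in lo' hi'.
case: ifPn => [qlt|].
  have q1n : q - 1 < 0 by rewrite subr_lt0.
  have BE : B / l * ((1 - q) * l) = S.
    by rewrite BD ltr0_norm // opprB; field; rewrite !gt_eqF // subr_gt0.
  have w0 : 0 < (1 - q) * l by rewrite mulr_gt0 ?subr_gt0.
  have XE' : X * ((1 - q) * l) = ln M by rewrite -[RHS]opprK -XE; ring.
  have eu x : (q - 1) * (x * - l) = x * ((1 - q) * l) by ring.
  rewrite !eu in lo' hi'.
  apply/andP; split; rewrite -(ler_pM2r w0) XE'.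
    by rewrite (mulrBl _ u) BE; exact: lin_lo lo' cB.
  by rewrite (mulrDl v) BE; exact: lin_hi hi' CB.
rewrite -leNgt le_eqVlt eq_sym (negbTE q1) /= => qgt.
have q1n : 0 < q - 1 by rewrite subr_gt0.
have BE : B / l * ((q - 1) * l) = S.
  by rewrite BD gtr0_norm //; field; rewrite !gt_eqF.
have w0 : 0 < (q - 1) * l by rewrite mulr_gt0.
have eu x : (q - 1) * (x * - l) = - (x * ((q - 1) * l)) by ring.
rewrite !eu in lo' hi'.
apply/andP; split; rewrite -(ler_pM2r w0) XE.
  by rewrite (mulrBl _ v) BE lerNr opprB addrC; exact: lin_hi hi' CB.
by rewrite (mulrDl u) BE lerNl opprD; exact: lin_lo lo' cB.
Qed.

Lemma scale_exponent_sandwich q s : 0 <= q -> q <= p + 1 -> s < d ->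
  exists2 B : R, 0 <= B & forall delta : R, 0 < delta -> delta < 1 ->
    s - B / - ln delta <= scale_exponent q (xs delta) delta <= d + B / - ln delta.
Proof.
move=> q0 qp sd; rewrite /scale_exponent.
have [Ks0 Ks00 hKs0] := moment_le sd.
pose Ks := Num.max K Ks0.
have Ksp : 0 < Ks by rewrite lt_max K0.
have mom delta : 0 < delta -> delta < 1 -> moment (p + 1) (xs delta) <= Ks * (delta `^ s) `^ p.
  move=> h0 h1; rewrite -powRrM [s * p]mulrC.
  by rewrite (le_trans (hKs0 _ h0 h1)) // ler_wpM2r ?powR_ge0 // le_max lexx orbT.
have cnt delta : 0 < delta -> delta < 1 -> (size (xs delta))%:R <= Ks * (delta `^ d)^-1.
  move=> h0 h1; rewrite -powRN (le_trans (count_le h0 h1)) //.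
  by rewrite ler_wpM2r ?powR_ge0 // le_max lexx.
have mle delta : 0 < delta -> delta < 1 -> moment 1 (xs delta) <= Ks.
  by move=> h0 h1; rewrite (le_trans (mass_le h0 h1)) // le_max lexx.
have [_|q1] := eqVneq q 1.
  exists (Ks + p^-1 * Ks) => [|delta delta0 delta1].
    by rewrite addr_ge0 ?mulr_ge0 ?invr_ge0 ?ltW.
  have l0 : 0 < - ln delta by rewrite oppr_gt0 ln_lt0 // delta0.
  have t0 u : 0 < delta `^ u by rewrite powR_gt0.
  have lK x : x / - ln delta * - ln delta = x by rewrite divfK // gt_eqF.
  have pK : 0 <= p^-1 * Ks by rewrite mulr_ge0 ?invr_ge0 ?ltW.
  apply/andP; split.
    rewrite -(ler_pM2r l0) mulrBl !lK.
    have [s0|s0] := ltP s 0.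
      apply: (@le_trans _ _ 0).
        by rewrite subr_le0 (@le_trans _ _ 0) ?mulr_le0_ge0 ?(ltW s0) ?(ltW l0) // addr_ge0 // ltW.
      rewrite big_seq sumr_ge0 // => x hx; rewrite -mulrN mulr_ge0 ?(ltW (xs0 hx)) //.
      by rewrite oppr_ge0 ln_le0 // (xs1 hx).
    have t1 : delta `^ s <= 1.
      rewrite -[leRHS](congr1 (fun f => f s) (powR1 R)); apply: powR_le => //; exact: ltW.
    have := entropy_ge (@xs0 delta) p0 (mass_ge1 delta0 delta1) (t0 s) t1 (mom _ delta0 delta1).
    by rewrite ln_powR; lra.
  rewrite -(ler_pM2r l0) mulrDl !lK.
  apply: (le_trans (entropy_le (@xs0 delta) (t0 d) (cnt _ delta0 delta1))).
  have -> : - ln (delta `^ d) * moment 1 (xs delta) = d * - ln delta.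
    rewrite ln_powR; have [d00|dn] := eqVneq d 0; first by rewrite d00; ring.
    by rewrite mass_eq1 // ?lt_neqAle ?d0 ?andbT 1?eq_sym //; ring.
  by rewrite lerD2l lerDl.
have half0 : 0 < 1 / 2 :> R by rewrite divr_gt0.
have [qlt|qge] := ltP q 1.
  pose M := (2 * Ks) `^ p^-1.
  have M0 : 0 < M by rewrite powR_gt0 // mulr_gt0.
  have hM : Ks * M `^ (- p) <= 1 / 2.
    rewrite /M -powRrM mulrN mulVf ?gt_eqF // powR_inv1 ?mulr_ge0 ?(ltW Ksp) //.
    by apply: eq_ler; field; rewrite gt_eqF.
  have c0 : 0 < 1 / 2 * M `^ (q - 1) by exact: mulr_gt0 half0 (powR_gt0 _ M0).
  have C0 : 0 < 2 * Ks by rewrite mulr_gt0.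
  exists ((`|ln (1 / 2 * M `^ (q - 1))| + `|ln (2 * Ks)|) / `|q - 1|).
    by rewrite divr_ge0 ?addr_ge0.
  move=> delta delta0 delta1.
  have t0 u : 0 < delta `^ u by rewrite powR_gt0.
  have := exponent_of_bounds q1 delta0 delta1 c0 C0
    (moment_ge_of_moment (@xs0 delta) p0 (mass_ge1 delta0 delta1) (t0 s) M0 (ltW qlt) (mom _ delta0 delta1) hM)
    (moment_le_of_count (@xs0 delta) (mle _ delta0 delta1) (t0 d) q0 (ltW qlt) (cnt _ delta0 delta1))
    erefl erefl.
  by rewrite qlt.
have c0 : 0 < 1 / 2 * (2 * Ks)^-1 `^ (q - 1).
  by apply: mulr_gt0 half0 (powR_gt0 _ _); rewrite invr_gt0 mulr_gt0.
have C0 : 0 < 2 * Ks by rewrite mulr_gt0.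
exists ((`|ln (1 / 2 * (2 * Ks)^-1 `^ (q - 1))| + `|ln (2 * Ks)|) / `|q - 1|).
  by rewrite divr_ge0 ?addr_ge0.
move=> delta delta0 delta1.
have t0 u : 0 < delta `^ u by rewrite powR_gt0.
have := exponent_of_bounds q1 delta0 delta1 c0 C0
  (moment_ge_of_count (@xs0 delta) Ksp (mass_ge1 delta0 delta1) (t0 d) qge (cnt _ delta0 delta1))
  (moment_le_of_moment (@xs0 delta) (mle _ delta0 delta1) (t0 s) qge qp (mom _ delta0 delta1))
  erefl erefl.
by rewrite ltNge qge.
Qed.

Lemma scale_exponent_near q e : 0 <= q -> q <= p + 1 -> 0 < e ->
  exists2 delta1 : R, 0 < delta1 & forall delta : R, 0 < delta -> delta < delta1 ->
    delta < 1 /\ d - e <= scale_exponent q (xs delta) delta <= d + e.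
Proof.
move=> q0 qp e0.
have e20 : 0 < e / 2 by rewrite divr_gt0.
have sd : d - e / 2 < d by rewrite ltrBlDr ltrDl.
have [B B0 hB] := scale_exponent_sandwich q0 qp sd.
pose delta1 := expR (- (B / (e / 2) + 1)).
have l1 : 0 < B / (e / 2) + 1 by rewrite ltr_wpDl ?divr_ge0 // ltW.
exists delta1 => [|delta delta0 hd]; first exact: expR_gt0.
have dlt : delta < 1.
  by apply: (lt_trans hd); rewrite -[ltRHS](@expR0 R) ltr_expR oppr_lt0.
split=> //.
have l : B / (e / 2) + 1 < - ln delta.
  by rewrite ltrNr -[ltRHS](@expRK R) ltr_ln ?posrE ?expR_gt0.
have l0 := lt_trans l1 l.
have Be : B / - ln delta <= e / 2.
  rewrite ler_pdivrMr // mulrC -ler_pdivrMr // (le_trans _ (ltW l)) // lerDl //.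
have /andP[h1 h2] := hB delta delta0 dlt.
by apply/andP; split; [apply: le_trans h1|apply: (le_trans h2)]; lra.
Qed.

End ScaleExponents.
End MomentInterpolation.

(** * Dimensions as limits of finite sums *)

Section UpperLowerLimits.
Context {R : realType}.

Lemma limf_esup_near (f : R -> \bar R) (G : set_system R) {FG : ProperFilter G} (l : R) :
  (forall e : R, 0 < e -> \forall x \near G, ((l - e)%:E <= f x <= (l + e)%:E)%E) ->
  limf_esup f G = l%:E.
Proof.
move=> h; apply/eqP; rewrite eq_le; apply/andP; split.
  apply/lee_addgt0Pr => e e0; rewrite -EFinD.
  apply: (@le_trans _ _ (ereal_sup (f @` [set x | ((l - e)%:E <= f x <= (l + e)%:E)%E]))).
    apply: ereal_inf_lbound; exists [set x | ((l - e)%:E <= f x <= (l + e)%:E)%E] => //.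
    exact: h.
  by apply: ge_ereal_sup => _ [x /= /andP[_ hx] <-].
apply: le_ereal_inf_tmp => _ [V GV <-]; apply/lee_subgt0Pr => e e0.
have [x [Vx /andP[hx _]]] := filter_ex (filterI GV (h e e0)).
by rewrite -EFinB (le_trans hx) // ereal_sup_ubound //; exists x.
Qed.

Lemma limf_einf_near (f : R -> \bar R) (G : set_system R) {FG : ProperFilter G} (l : R) :
  (forall e : R, 0 < e -> \forall x \near G, ((l - e)%:E <= f x <= (l + e)%:E)%E) ->
  limf_einf f G = l%:E.
Proof.
move=> h; rewrite /limf_einf (@limf_esup_near _ _ _ (- l)) ?oppeK //.
  by rewrite EFinN oppeK.
move=> e e0; apply: filterS (h e e0) => x /andP[h1 h2].
apply/andP; split.
  by rewrite leeNr -EFinN opprD !opprK.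
by rewrite leeNl -EFinN opprD opprK.
Qed.

End UpperLowerLimits.

Section FiniteMoments.
Context {R : realType}.
Variables (nu : set (plane R) -> \bar R) (w : int * int -> R) (delta : R).
Variable J : seq (int * int).
Hypothesis uJ : uniq J.
Hypothesis nuE : forall x, nu (mesh_square delta x) = (w x)%:E.
Hypothesis w0 : forall x, 0 <= w x.
Hypothesis w1 : forall x, w x <= 1.
Hypothesis JP : forall x, (x \in J) = (w x != 0).
Local Notation xs := [seq w x | x <- J].

Lemma esum_charged (f : int * int -> R) (S : set (int * int)) : S = [set` J] -> (forall x, 0 <= f x) ->
  (\esum_(x in S) (f x)%:E)%E = (\sum_(x <- J) f x)%:E.
Proof.
move=> -> f0; rewrite esum_fset.
- by rewrite -fsbig_seq // sumEFin.
- exact: finite_seq.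
by move=> x _; rewrite lee_fin.
Qed.

Lemma Lq_moment_finite q : Lq_moment nu q delta = (moment q xs)%:E.
Proof.
rewrite /Lq_moment /moment big_map -(@esum_charged (fun x => w x `^ q) [set p | nu (mesh_square delta p) != 0%E]).
- by apply: eq_esum => x _; rewrite nuE poweR_EFin.
- by apply/seteqP; split => x /=; rewrite nuE JP.
by move=> x; exact: powR_ge0.
Qed.

Lemma sum_log_finite : sum_log nu delta = (- \sum_(x <- xs) - (x * ln x))%:E.
Proof.
have f0 x : 0 <= - (w x * ln (w x)).
  by rewrite -mulrN mulr_ge0 // oppr_ge0 ln_le0.
rewrite /sum_log big_map EFinN; congr (- _)%E.
rewrite -(@esum_charged (fun x => - (w x * ln (w x))) [set` J]) // [RHS]esum_mkcond.
apply: eq_esum => x _; rewrite nuE /= mem_setE.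
case: ifPn => //; rewrite JP negbK => /eqP ->.
by rewrite mul0r oppr0.
Qed.

Lemma Lq_ratio_finite q : 0 < delta -> delta < 1 -> 1 <= moment 1 xs ->
  Lq_ratio nu q delta = (scale_exponent q xs delta)%:E.
Proof.
move=> delta0 delta1 mass1; rewrite /Lq_ratio /scale_exponent.
case: ifP => _; first by rewrite sum_log_finite -EFinM invrN mulrN mulNr.
rewrite Lq_moment_finite lne_EFin //.
have [x xJ] : exists x, x \in xs.
  case E : xs mass1 => [|x s]; last by exists x; exact: mem_head.
  by rewrite /moment big_nil ler10.
rewrite /moment (big_rem x) //= ltr_pwDl ?sumr_ge0 //; last first.
  by move=> y _; exact: powR_ge0.
apply: powR_gt0; move: xJ => /mapP[y yJ ->].
by rewrite lt_neqAle w0 andbT eq_sym -JP.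
Qed.

End FiniteMoments.

Section Charged.
Context {R : realType} {L : finPointedType}.
Variables (A : L -> 'M[R]_2) (t : L -> plane R) (F : set (plane R)).
Variable mu : probability (symbolic L) R.
Hypothesis A_unit : forall i, A i \in unitmx.
Hypothesis A_contr : forall i, linear_contraction (A i).
Hypothesis F_attr : attractor (affine A t) F.
Local Notation T := (affine A t).
Local Notation Sigma := (symbolic L).
Local Notation code := (coding T : Sigma -> plane R).
Local Notation nu := (square_mass A t mu).

Lemma code_in_F (a : Sigma) : F (code a).
Proof. by have [y Fy ->] := coding_in_cylinder A_unit A_contr F_attr a 0. Qed.

Lemma meeting_squares delta : 0 < delta -> exists2 J : seq (int * int), uniq J &
  forall a x, mesh_square delta x (code a) -> x \in J.
Proof.
move=> delta0.
have [B B0 hB] := compact_enorm_bounded (F_compact F_attr).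
have [n hn] := archi_int (B / delta + 1).
exists (undup (int_box n)); first exact: undup_uniq.
move=> a x Qa; rewrite mem_undup.
have : near_sq (B / delta + 1) delta x 0.
  apply: (near_sq_mesh delta0 Qa); rewrite subr0 divfK ?gt_eqF //.
  by apply: hB; exact: code_in_F.
have H (q : int) : `|q%:~R * delta - 0| <= (B / delta + 1) * delta -> (`|q| <= n%:Z)%R.
  by rewrite subr0 normrM (gtr0_norm delta0) ler_pM2r // => h; exact: hn.
rewrite /near_sq !mxE => /andP[/H h0 /H h1].
exact: mem_int_box.
Qed.

Lemma charged_squares delta : exists J : seq (int * int), 0 < delta ->
  [/\ uniq J, forall x, (x \in J) = (nu delta x != 0) & 1 <= \sum_(x <- J) nu delta x].
Proof.
have [delta0|] := ltP 0 delta; last by exists [::].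
have [J uJ hJ] := meeting_squares delta0.
exists [seq x <- J | nu delta x != 0] => _; split.
- by rewrite filter_uniq.
- move=> x; rewrite mem_filter; case: eqP => //= nux.
  apply: contrapT => /negP h; apply: nux.
  rewrite /square_mass (_ : _ @^-1` _ = set0) ?pr_set0 // -subset0 => a Qa.
  by case/negP: h; exact: hJ Qa.
rewrite big_filter -[leLHS](pr_setT mu).
apply: (@le_trans _ _ (\sum_(x <- J) nu delta x)).
  apply: (@pr_union_le R _ Sigma mu _ _ (fun x => code @^-1` (mesh_square delta x)) setT measurableT).
    by move=> x _; exact: (measurable_square mu A_unit A_contr F_attr).
  move=> a _; exists (mesh_index delta (code a)); last exact: mesh_indexP.
  exact: hJ (mesh_indexP _ delta0).
rewrite [leLHS](bigID (fun x => nu delta x != 0)) /= gerDl.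
by rewrite big1 // => x; rewrite negbK => /eqP.
Qed.

(** If no grid line carries mass, overlapping boundaries do not matter. *)
Lemma sum_square_mass_le1 delta J : 0 < delta -> uniq J ->
  (forall j h, pr mu (code @^-1` [set x | x j 0 = h]) = 0) ->
  \sum_(x <- J) nu delta x <= 1.
Proof.
move=> delta0 uJ null.
pose Q x := code @^-1` (mesh_square delta x).
pose l0 (x : int * int) := code @^-1` [set y : plane R | y 0 0 = (x.1 + 1)%:~R * delta].
pose l1 (x : int * int) := code @^-1` [set y : plane R | y 1 0 = (x.2 + 1)%:~R * delta].
have mQ x : measurable (Q x) by exact: (measurable_square mu A_unit A_contr F_attr).
have ml0 x : measurable (l0 x).
  exact: (measurable_code_preimage mu A_unit A_contr F_attr (@closed_axis_line R 0 _)).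
have ml1 x : measurable (l1 x).
  exact: (measurable_code_preimage mu A_unit A_contr F_attr (@closed_axis_line R 1 _)).
pose E x := Q x `\` (l0 x `|` l1 x).
have mE x : measurable (E x) by apply: measurableD => //; exact: measurableU.
have nuE x : nu delta x <= pr mu (E x).
  have := @pr_union_le R _ Sigma mu _ [:: 0; 1; 2]%N (fun k => nth (E x) [:: l0 x; l1 x; E x] k) (Q x) (mQ x).
  rewrite !big_cons big_nil /= !null !add0r addr0; apply.
    by move=> k; rewrite !inE => /or3P[] /eqP -> /=.
  move=> a Qa; have [h0|h0] := pselect (l0 x a); first by exists 0%N.
  have [h1|h1] := pselect (l1 x a); first by exists 1%N.
  by exists 2%N => //; split => // -[].
apply: (@le_trans _ _ (\sum_(x <- J) pr mu (E x))); first exact: ler_sum.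
have disj x y a : x \in J -> y \in J -> E x a -> E y a -> x = y.
  move=> _ _.
  have H (q r : int) (u : R) : q%:~R * delta <= u <= (q + 1)%:~R * delta -> u <> (q + 1)%:~R * delta ->
      r%:~R * delta <= u <= (r + 1)%:~R * delta -> u <> (r + 1)%:~R * delta -> q = r.
    move=> /andP[a1 a2] /eqP a3 /andP[b1 b2] /eqP b3.
    have ua : u < (q + 1)%:~R * delta by rewrite lt_neqAle a3.
    have ub : u < (r + 1)%:~R * delta by rewrite lt_neqAle b3.
    have := le_lt_trans a1 ub; have := le_lt_trans b1 ua.
    by rewrite !ltr_pM2r // !ltr_int !ltzD1 => h1 h2; apply/eqP; rewrite eq_le h1 h2.
  move=> [[x0 x1] nx] [[y0 y1] ny]; rewrite [x]surjective_pairing [y]surjective_pairing.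
  congr (_, _).
    by apply: (H _ _ _ x0 _ y0) => e; [apply: nx|apply: ny]; left.
  by apply: (H _ _ _ x1 _ y1) => e; [apply: nx|apply: ny]; right.
have [mS <-] := @pr_sum R _ Sigma mu _ J E uJ (fun x _ => mE x) disj.
exact: pr_le1.
Qed.

End Charged.

(** * Upper bound for the Hausdorff dimension *)

Section Diameter.
Context {R : realType}.
Implicit Types (U : set (plane R)) (D e s : R).

Lemma diam_le U D : (forall x y, U x -> U y -> enorm (x - y) <= D) -> (diam U <= D%:E)%E.
Proof.
move=> h; apply: ge_ereal_sup => _ [x Ux [y Uy <-]].
by rewrite lee_fin; exact: h.
Qed.

Lemma diam_finite U e : U !=set0 -> (diam U <= e%:E)%E ->
  exists2 D : R, diam U = D%:E & [/\ 0 <= D, D <= e & forall x y, U x -> U y -> enorm (x - y) <= D].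
Proof.
move=> [x0 Ux0] dU.
have ub x y : U x -> U y -> ((enorm (x - y))%:E <= diam U)%E.
  by move=> Ux Uy; apply: ereal_sup_ubound; exists x => //; exists y.
have d0 : (0 <= diam U)%E by have := ub x0 x0 Ux0 Ux0; rewrite subrr enorm0.
move: ub dU d0; case: (diam U) => [D| |] //= ub; rewrite ?lee_fin => De D0.
by exists D => //; split=> // x y Ux Uy; rewrite -lee_fin; exact: ub.
Qed.

Lemma diam_pow_ge0 s U : (0 <= diam_pow s U)%E.
Proof. by rewrite /diam_pow; case: ifP => // _; exact: poweR_ge0. Qed.

Lemma diam_pow_le s U D : 0 <= s -> 0 <= D ->
  (forall x y, U x -> U y -> enorm (x - y) <= D) -> (diam_pow s U <= (D `^ s)%:E)%E.
Proof.
move=> s0 D0 h; rewrite /diam_pow; case: eqP => [_|/eqP U0]; first by rewrite lee_fin powR_ge0.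
have [D' -> [D'0 D'D _]] := diam_finite (proj1 (set0P _) U0) (diam_le h).
by rewrite poweR_EFin lee_fin powR_le.
Qed.

Lemma nneseries_le (u : nat -> \bar R) (B : \bar R) : (forall n, (0 <= u n)%E) ->
  (forall n, (\sum_(0 <= k < n) u k <= B)%E) -> (\sum_(0 <= k <oo) u k <= B)%E.
Proof.
move=> u0 h; apply: lime_le; first by apply: is_cvg_nneseries => n _ _; exact: u0.
by near=> n; exact: h.
Unshelve. all: by end_near. Qed.

Lemma partial_sum_nth (X : Type) (l : seq X) (x0 : X) (g : X -> \bar R) n :
  g x0 = 0%E -> (forall x, (0 <= g x)%E) ->
  (\sum_(0 <= k < n) g (nth x0 l k) <= \sum_(x <- l) g x)%E.
Proof.
move=> g0 gp; elim: l n => [|x l IH] n.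
  by rewrite big_nil big1 // => k _; rewrite nth_nil.
case: n => [|n]; first by rewrite big_geq // sume_ge0.
by rewrite big_nat_recl //= big_cons leeD2l.
Qed.

Lemma geometric_series_le (K r : R) : 0 <= K -> 0 <= r -> r < 1 ->
  (\sum_(0 <= k <oo) (K * r ^+ k)%:E <= (K / (1 - r))%:E)%E.
Proof.
move=> K0 r0 r1; have r10 : 0 < 1 - r by rewrite subr_gt0.
apply: nneseries_le => n; first by rewrite lee_fin mulr_ge0 ?exprn_ge0.
rewrite sumEFin lee_fin -mulr_sumr ler_wpM2l // -[leRHS]mul1r ler_pdivlMr //.
elim: n => [|n IH]; first by rewrite big_geq // mul0r.
suff -> : (\sum_(0 <= k < n.+1) r ^+ k) * (1 - r) = 1 - r ^+ n.+1.
  by rewrite gerBl exprn_ge0.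
elim: n {IH} => [|n IH]; first by rewrite big_nat1 expr0 expr1 mul1r.
by rewrite big_nat_recr //= mulrDl IH !exprS; ring.
Qed.

End Diameter.

Section HausdorffUpper.
Context {R : realType} {L : finPointedType}.
Variables (A : L -> 'M[R]_2) (t : L -> plane R) (F : set (plane R)) (d C1 : R).
Hypothesis A_unit : forall i, A i \in unitmx.
Hypothesis A_contr : forall i, linear_contraction (A i).
Hypothesis F_attr : attractor (affine A t) F.
Hypothesis d0 : 0 <= d.
Hypothesis C10 : 0 < C1.
Hypothesis sum_sv1 : forall n, \sum_(w <- words n) sv1 (word_mx A w) `^ d <= C1.
Local Notation T := (affine A t).

(** The pieces of generation n cover the attractor, and the sum of sv1 ^ s over
    them is at most c ^ (n * (s - d)) times the bounded sum of sv1 ^ d. *)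
Lemma hausdorff_measure_attractor_null s : d < s -> hausdorff_measure s F = 0%E.
Proof.
move=> ds; have s0 : 0 < s by exact: le_lt_trans ds.
have [c [c0 c1 hc]] := uniform_contraction A_contr.
have [D D0 hD] := F_diameter F_attr.
apply/eqP; rewrite eq_le; apply/andP; split; last first.
  apply: (@le_trans _ _ (hausdorff_content s 1 F)); last first.
    by apply: ereal_sup_ubound; exists 1 => //=.
  apply: le_ereal_inf_tmp => _ [U _ <-].
  by apply: nneseries_ge0 => n _ _; exact: diam_pow_ge0.
apply: ge_ereal_sup => _ [delta /= delta0 <-].
apply/lee_addgt0Pr => e e0; rewrite add0e.
have cs0 : 0 <= c `^ (s - d) by exact: powR_ge0.
have cs1 : c `^ (s - d) < 1.
  by rewrite -[ltRHS](congr1 (fun f => f (s - d)) (powR1 R)) gt0_ltr_powR ?nnegrE ?subr_gt0 ?(ltW c0).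
have KD : 0 <= D `^ s * C1 by rewrite mulr_ge0 ?powR_ge0 ?ltW.
have [n1 hn1] := geometric_small cs0 cs1 KD e0.
have [n2 hn2] := geometric_small (ltW c0) c1 (ltW D0) delta0.
pose n := maxn n1 n2.
pose l := [seq word_map T w @` F | w <- words n].
have size_le w x y : w \in words n -> (word_map T w @` F) x -> (word_map T w @` F) y ->
    enorm (x - y) <= sv1 (word_mx A w) * D.
  move=> _ [x' Fx' <-] [y' Fy' <-]; rewrite (le_trans (enorm_word_map _ _ _ _ _)) //.
  by rewrite ler_wpM2l ?sv1_ge0 // hD.
have cn w : w \in words n -> sv1 (word_mx A w) <= c ^+ n.
  by move=> /size_words <-; exact: hc.
apply: (@le_trans _ _ (\sum_(0 <= k <oo) diam_pow s (nth set0 l k))%E).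
  apply: ereal_inf_lbound; exists (fun k => nth set0 l k) => //; split.
    move=> k; have [kl|kl] := ltnP k (size l); last first.
      by rewrite nth_default // diam_le.
    have /mapP[w wn ->] := mem_nth set0 kl.
    apply: diam_le => x y hx hy; rewrite (le_trans (size_le w x y wn hx hy)) //.
    apply: le_trans (ltW hn2); rewrite mulrC ler_wpM2l ?(ltW D0) //.
    rewrite (le_trans (cn w wn)) // ler_wiXn2l ?(ltW c0) ?(ltW c1) //.
    exact: leq_maxr.
  move=> x Fx; have [w sw [y Fy xE]] := word_cover F_attr n Fx.
  have wn : w \in words n by rewrite mem_words sw.
  exists (index w (words n)) => //.
  by rewrite (nth_map [::]) ?index_mem // nth_index //; exists y.
apply: nneseries_le => [k|k]; first exact: diam_pow_ge0.
apply: (@le_trans _ _ (\sum_(U <- l) diam_pow s U)%E).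
  apply: partial_sum_nth => [|U]; last exact: diam_pow_ge0.
  by rewrite /diam_pow eqxx.
rewrite big_map (@le_trans _ _ (\sum_(w <- words n) ((sv1 (word_mx A w) * D) `^ s)%:E)%E) //.
  rewrite big_seq [leRHS]big_seq; apply: lee_sum => w wn.
  by apply: diam_pow_le => [||x y]; [exact: ltW|rewrite mulr_ge0 ?sv1_ge0 ?ltW|exact: size_le].
rewrite sumEFin lee_fin; apply: le_trans (ltW hn1).
apply: (@le_trans _ _ (\sum_(w <- words n) D `^ s * (c `^ (s - d)) ^+ n * sv1 (word_mx A w) `^ d)).
  rewrite big_seq [leRHS]big_seq; apply: ler_sum => w wn.
  have s1 : 0 < sv1 (word_mx A w) by rewrite sv1_gt0 // word_mx_unit.
  rewrite powRM ?(ltW s1) ?(ltW D0) // mulrC -mulrA ler_wpM2l ?powR_ge0 //.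
  rewrite -{1}(subrK d s) (@powRD _ _ (s - d) d); last by rewrite (gt_eqF s1) implybT.
  rewrite ler_wpM2r ?powR_ge0 //.
  rewrite -powR_expn //.
  by apply: powR_le; rewrite ?(ltW s1) ?subr_ge0 ?(ltW ds) ?cn.
rewrite -mulr_sumr.
apply: (@le_trans _ _ (D `^ s * (c `^ (s - d)) ^+ n * C1)).
  by rewrite ler_wpM2l ?mulr_ge0 ?exprn_ge0 ?powR_ge0.
rewrite mulrAC ler_wpM2l // ler_wiXn2l ?(ltW cs1) //.
exact: leq_maxl.
Qed.

Lemma hausdorff_dim_le : (hausdorff_dim F <= d%:E)%E.
Proof.
apply/lee_addgt0Pr => e e0; rewrite -EFinD; apply: ereal_inf_lbound.
exists (d + e) => //; split; first by rewrite addr_ge0 // ltW.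
by apply: hausdorff_measure_attractor_null; rewrite ltrDl.
Qed.

End HausdorffUpper.

(** * Lower bound for the Hausdorff dimension *)

Section HausdorffLower.
Context {R : realType} {L : finPointedType}.
Variables (A : L -> 'M[R]_2) (t : L -> plane R) (F : set (plane R)) (d p : R).
Variable mu : probability (symbolic L) R.
Hypothesis A_unit : forall i, A i \in unitmx.
Hypothesis A_contr : forall i, linear_contraction (A i).
Hypothesis F_attr : attractor (affine A t) F.
Hypothesis p0 : 0 < p.
Local Notation T := (affine A t).
Local Notation Sigma := (symbolic L).
Local Notation code := (coding T : Sigma -> plane R).
Local Notation nu := (square_mass A t mu).
Hypothesis moment_le : forall s, s < d -> exists2 K : R, 0 < K &
  forall (delta : R) (J : seq (int * int)), 0 < delta -> delta < 1 -> uniq J ->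
    \sum_(x <- J) nu delta x `^ (p + 1) <= K * delta `^ (p * s).

Let h k : R := 2^-1 ^+ k.

Let h0 k : 0 < h k. Proof. by rewrite exprn_gt0 // invr_gt0. Qed.

Let half1 : (2^-1 : R) < 1. Proof. by rewrite invf_lt1 // ltr1n. Qed.

Let half0 : 0 < (2^-1 : R). Proof. by rewrite invr_gt0. Qed.

Let h1 k : (0 < k)%N -> h k < 1.
Proof. by move=> k0; rewrite exprn_ilt1 ?ltW // -lt0n. Qed.

(** The error term e takes care of sets of diameter zero, to which no scale is
    comparable. *)
Lemma dyadic_scale (s s1 D e : R) k0 : 0 <= s -> s <= s1 -> 0 < s1 -> 0 <= D -> D <= h k0 -> 0 < e ->
  exists2 k, (k0 <= k)%N & D <= h k /\ (h k) `^ s1 <= 2 `^ s1 * (D `^ s + e).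
Proof.
move=> s0 ss1 s10 D0 Dk0 e0.
have two1 : 1 <= 2 `^ s1.
  by rewrite -[leLHS](congr1 (fun f => f s1) (powR1 R)) powR_le ?(ltW s10) ?ler1n.
have [Dz|Dn] := eqVneq D 0.
  have x1 : 2^-1 `^ s1 < 1 :> R.
    by rewrite -[ltRHS](congr1 (fun f => f s1) (powR1 R)) gt0_ltr_powR ?nnegrE ?(ltW half0).
  have [n hn] := geometric_small (powR_ge0 _ s1) x1 ler01 e0; rewrite mul1r in hn.
  exists (maxn k0 n); first exact: leq_maxl.
  split; first by rewrite Dz ltW.
  rewrite /h powR_expn //; apply: (@le_trans _ _ e); last first.
    by rewrite (@le_trans _ _ (D `^ s + e)) ?lerDr ?powR_ge0 // ler_peMl // addr_ge0 ?powR_ge0 // ltW.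
  apply: le_trans (ltW hn); rewrite ler_wiXn2l ?powR_ge0 ?(ltW x1) //.
  exact: leq_maxr.
have Dp : 0 < D by rewrite lt_neqAle eq_sym Dn.
have ex : exists k, h k < D.
  by have [n hn] := geometric_small (ltW half0) half1 ler01 Dp; exists n; rewrite mul1r in hn.
pose k := ex_minn ex.
have [hk mk] : h k < D /\ forall j, h j < D -> (k <= j)%N by rewrite /k; case: ex_minnP.
have k0k : (k0 < k)%N.
  rewrite ltnNge; apply/negP => kk0; have : h k0 <= h k.
    by rewrite ler_wiXn2l ?(ltW half0) ?(ltW half1).
  by move=> /(le_trans Dk0)/le_lt_trans/(_ hk); rewrite ltxx.
case: k k0k hk mk => // j k0j hj mj; exists j; first by rewrite -ltnS.
have Dj : D <= h j by rewrite leNgt; apply/negP => /mj; rewrite ltnn.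
split=> //.
have hjD : h j <= 2 * D.
  by move: hj; rewrite /h exprS ltr_pdivrMl // => /ltW.
have D1 : D <= 1.
  by rewrite (le_trans Dj) // exprn_ile1 ?ltW.
apply: (@le_trans _ _ ((2 * D) `^ s1)).
  by apply: powR_le => //; exact: ltW.
rewrite powRM ?(ltW Dp) // ler_wpM2l ?powR_ge0 //.
apply: (@le_trans _ _ (D `^ s)); last by rewrite lerDl ltW.
by apply: ger_powR => //; rewrite Dp.
Qed.

(** Mass distribution: away from squares of too large mass, which are rare by
    the moment bound, a set of diameter D has mass of order at most D ^ s. *)
Lemma hausdorff_measure_attractor_pos s : 0 <= s -> s < d -> hausdorff_measure s F <> 0%E.
Proof.
move=> s0 sd H0.
(* squares of mass above delta ^ s1 are bad; the moment bound is used at s2 *)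
pose s1 := (s + d) / 2; pose s2 := (s1 + d) / 2.
have ss1 : s < s1 by rewrite /s1; lra.
have s12 : s1 < s2 by rewrite /s2 /s1; lra.
have s2d : s2 < d by rewrite /s2 /s1; lra.
have s10 : 0 < s1 by exact: le_lt_trans ss1.
have [K K0 hK] := moment_le s2d.
have [K9 K90 hK9] := @count_near_sq R 2.
pose J0 k := @meeting_squares R L A t F A_unit A_contr F_attr (h k) (h0 k).
have /choice[J hJ] k : exists J : seq (int * int), uniq J /\
    forall a x, mesh_square (h k) x (code a) -> x \in J.
  by have [J uJ hJ] := J0 k; exists J.
pose r := 2^-1 `^ (p * (s2 - s1)) : R.
have ps : 0 < p * (s2 - s1) by rewrite mulr_gt0 // subr_gt0.
have r0 : 0 <= r by exact: powR_ge0.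
have r1 : r < 1.
  by rewrite -[ltRHS](congr1 (fun f => f (p * (s2 - s1))) (powR1 R)) gt0_ltr_powR ?nnegrE ?(ltW half0).
have r10 : 0 < 1 - r by rewrite subr_gt0.
pose Q k x := code @^-1` (mesh_square (h k) x).
have mQ k x : measurable (Q k x) by exact: (measurable_square mu A_unit A_contr F_attr).
pose union k (s : seq (int * int)) : set Sigma := [set a | exists2 x, x \in s & Q k x a].
have mU k s' : measurable (union k s').
  elim: s' => [|x s' IH].
    by rewrite (_ : union k [::] = set0) // -subset0 => a [].
  rewrite (_ : union k (x :: s') = Q k x `|` union k s'); first exact: measurableU.
  apply/seteqP; split => a /=.
    by move=> [y]; rewrite inE => /predU1P[->|ys] Qa; [left|right; exists y].
  by move=> [Qa|[y ys Qa]]; [exists x; rewrite ?mem_head|exists y; rewrite // inE ys orbT].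
pose bad k := [seq x <- J k | (h k) `^ s1 < nu (h k) x].
have pr_bad k : (0 < k)%N -> pr mu (union k (bad k)) <= K * r ^+ k.
  move=> k0; apply: (@le_trans _ _ (\sum_(x <- bad k) nu (h k) x)).
    exact: (@pr_union_le R _ Sigma mu _ _ (Q k) _ (mU k _)).
  apply: (@le_trans _ _ (\sum_(x <- J k) (h k) `^ (- (p * s1)) * nu (h k) x `^ (p + 1))).
    rewrite /bad big_filter big_mkcond /=; apply: ler_sum => x _.
    case: ifP => [hx|_]; last by rewrite mulr_ge0 ?powR_ge0.
    have nu0 : 0 < nu (h k) x by apply: lt_trans hx; rewrite powR_gt0.
    rewrite -(mulr_powRB1 (ltW nu0) (addr_gt0 p0 ltr01)) addrK mulrCA ler_peMr ?(ltW nu0) //.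
    rewrite powRN ler_pdivlMl ?powR_gt0 // mulr1 mulrC powRrM.
    by apply: powR_le; rewrite ?powR_ge0 ?(ltW hx) ?(ltW p0).
  rewrite -mulr_sumr; have [uJ _] := hJ k.
  apply: (le_trans (ler_wpM2l (powR_ge0 _ _) (hK _ _ (h0 k) (h1 k0) uJ))).
  rewrite mulrCA -powRD; last by rewrite (gt_eqF (h0 k)) implybT.
  rewrite (_ : - (p * s1) + p * s2 = p * (s2 - s1)); last by ring.
  by rewrite /h powR_expn.
pose C := K9 * 2 `^ s1.
have C0 : 0 < C by rewrite mulr_gt0 ?powR_gt0.
have q0 : 0 < 4^-1 * (1 - r) by rewrite mulr_gt0 ?invr_gt0.
have [k1 hk1] := geometric_small r0 r1 (ltW K0) q0.
pose k0 := k1.+1.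
pose eta := (8 * C)^-1.
have eta0 : 0 < eta by rewrite invr_gt0 mulr_gt0.
have cover : exists2 U : nat -> set (plane R),
    (forall n, (diam (U n) <= (h k0)%:E)%E) /\ F `<=` \bigcup_n U n &
    (\sum_(0 <= n <oo) diam_pow s (U n) < ((4 * C)^-1)%:E)%E.
  have : (hausdorff_content s (h k0) F < ((4 * C)^-1)%:E)%E.
    apply: (@le_lt_trans _ _ (hausdorff_measure s F)).
      by apply: ereal_sup_ubound; exists (h k0) => //=.
    by rewrite H0 lte_fin invr_gt0 mulr_gt0.
  by move=> /ereal_inf_lt[_ [U hU <-] hlt]; exists U.
have [U [dU FU] sumU] := cover.
have /choice[V hV] n : exists V : set Sigma, [/\ measurable V,
    forall a, U n (code a) -> V a \/ exists2 k, (k0 <= k)%N & union k (bad k) a &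
    ((pr mu V)%:E <= C%:E * (diam_pow s (U n) + (eta * 2^-1 ^+ n)%:E))%E].
  have en : 0 < eta * 2^-1 ^+ n by rewrite mulr_gt0 // exprn_gt0.
  have [U0|/eqP U0] := pselect (U n = set0).
    exists set0; split=> // [a|]; first by rewrite U0.
    by rewrite pr_set0 mule_ge0 ?lee_fin ?(ltW C0) ?adde_ge0 ?diam_pow_ge0 ?lee_fin ?(ltW en).
  have [D dD [D0 Dh hD]] := diam_finite (proj1 (set0P _) U0) (dU n).
  have [k k0k [Dk hk]] := dyadic_scale s0 (ltW ss1) s10 D0 Dh en.
  have [y0 Uy0] := proj1 (set0P _) U0.
  pose G := [seq x <- J k | (nu (h k) x <= (h k) `^ s1) && near_sq 2 (h k) x y0].
  exists (union k G); split=> // [a Ua|].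
    have [uJ JP] := hJ k.
    have Qx := mesh_indexP (code a) (h0 k); set x := mesh_index _ _ in Qx.
    have xJ : x \in J k by exact: JP Qx.
    have [good|isbad] := leP (nu (h k) x) ((h k) `^ s1).
      left; exists x => //; rewrite mem_filter xJ good /= andbT.
      have := near_sq_mesh (h0 k) Qx (_ : enorm (code a - y0) <= 1 * h k).
      by apply; rewrite mul1r (le_trans (hD _ _ Ua Uy0)).
    by right; exists k => //; exists x => //; rewrite mem_filter xJ isbad.
  rewrite /diam_pow (negbTE U0) dD poweR_EFin -EFinD -EFinM lee_fin.
  apply: (@le_trans _ _ (\sum_(x <- G) nu (h k) x)).
    exact: (@pr_union_le R _ Sigma mu _ _ (Q k) _ (mU k _)).
  apply: (@le_trans _ _ (K9 * (h k) `^ s1)); last by rewrite /C -mulrA ler_pM2l.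
  apply: (@le_trans _ _ (\sum_(x <- G) (h k) `^ s1)).
    by rewrite /G !big_filter; apply: ler_sum => x /andP[].
  rewrite big_const_seq count_predT iter_addr_0 -[leLHS]mulr_natl ler_wpM2r ?powR_ge0 //.
  apply: (hK9 (h k) y0) => //; first by rewrite filter_uniq //; case: (hJ k).
  by move=> x; rewrite mem_filter => /andP[/andP[]].
pose H n := union (k0 + n)%N (bad (k0 + n)%N) `|` V n.
have mH n : measurable (H n) by apply: measurableU => //; case: (hV n).
have covered : [set: Sigma] `<=` \bigcup_n H n.
  move=> a _; have [n _ Una] := FU _ (code_in_F A_unit A_contr F_attr a).
  have [_ /(_ a Una)[Va|[k k0k ba]] _] := hV n; first by exists n => //; right.
  by exists (k - k0)%N => //; left; rewrite subnKC.
have : (1 <= \sum_(0 <= n <oo) mu (H n))%E.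
  rewrite -(probability_setT mu).
  exact: (@measure_sigma_subadditive _ R Sigma mu _ H mH measurableT covered).
apply/negP; rewrite -ltNge.
pose u n : \bar R := (K * r ^+ k0 * r ^+ n)%:E.
pose v n : \bar R := (C * eta * 2^-1 ^+ n)%:E.
(* at each n: the bad squares of one scale, and the set assigned to U n *)
have term n : (mu (H n) <= u n + v n + C%:E * diam_pow s (U n))%E.
  have [mV _ prV] := hV n.
  have mB := mU (k0 + n)%N (bad (k0 + n)%N).
  apply: (@le_trans _ _ (mu (union (k0 + n)%N (bad (k0 + n)%N)) + mu (V n))%E).
    exact: measureU2.
  rewrite -addeA; apply: leeD.
    rewrite (prE mu mB) lee_fin -mulrA -exprD; exact: pr_bad.
  rewrite (prE mu mV) (le_trans prV) // ge0_muleDr ?diam_pow_ge0 //.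
    by rewrite addeC -EFinM mulrA.
  by rewrite lee_fin mulr_ge0 ?exprn_ge0 // ltW.
have u0 n : (0 <= u n)%E by rewrite lee_fin !mulr_ge0 ?exprn_ge0 // ltW.
have v0 n : (0 <= v n)%E by rewrite lee_fin !mulr_ge0 ?exprn_ge0 // ltW.
have w0 n : (0 <= C%:E * diam_pow s (U n))%E.
  by rewrite mule_ge0 ?diam_pow_ge0 // lee_fin ltW.
apply: (@le_lt_trans _ _ (\sum_(0 <= n <oo) (u n + v n + C%:E * diam_pow s (U n)))%E).
  by apply: lee_nneseries => n _ //; exact: measure_ge0.
rewrite nneseriesD => [|n _ _|n _ _]; [|by rewrite adde_ge0|by []].
rewrite nneseriesD => [|n _ _|n _ _]; [|by []|by []].
rewrite nneseriesZl => [|n _]; last exact: diam_pow_ge0.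
have su : (\sum_(0 <= n <oo) u n <= (4^-1)%:E)%E.
  apply: (le_trans (geometric_series_le _ r0 r1)); first exact: mulr_ge0 (ltW K0) (exprn_ge0 _ r0).
  rewrite lee_fin ler_pdivrMr // /k0 exprS (le_trans _ (ltW hk1)) // ler_pM2l //.
  by rewrite ler_piMl ?exprn_ge0 // ltW.
have sv : (\sum_(0 <= n <oo) v n <= (4^-1)%:E)%E.
  apply: (le_trans (geometric_series_le _ (ltW half0) half1)).
    exact: mulr_ge0 (ltW C0) (ltW eta0).
  rewrite lee_fin /eta; apply: eq_ler; field.
  by rewrite !gt_eqF //; lra.
have sw : (C%:E * \sum_(0 <= n <oo) diam_pow s (U n) <= (4^-1)%:E)%E.
  apply: (le_trans (lee_wpmul2l _ (ltW sumU))); first by rewrite lee_fin ltW.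
  by rewrite -EFinM lee_fin; apply: eq_ler; field; rewrite gt_eqF.
apply: (le_lt_trans (leeD (leeD su sv) sw)).
by rewrite -!EFinD lte_fin; lra.
Qed.

Lemma hausdorff_dim_ge : (d%:E <= hausdorff_dim F)%E.
Proof.
apply: le_ereal_inf_tmp => _ [s [s0 H0] <-]; rewrite lee_fin leNgt; apply/negP => sd.
exact: (hausdorff_measure_attractor_pos s0 sd).
Qed.

End HausdorffLower.

(** * Conclusion *)

Lemma affinity_dim_ge0 (R : realType) (L : finPointedType) (A : L -> 'M[R]_2) (d : R) :
  affinity_dim A = d%:E -> 0 <= d.
Proof.
by move=> hd; rewrite -lee_fin -hd; apply: le_ereal_inf_tmp => _ [s /= [/andP[s0 _] _] <-]; rewrite lee_fin.
Qed.

(** The alphabet is finite, so the strict inequalities for the single letters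
    hold with one constant. *)
Lemma bunching_constant (R : realType) (L : finPointedType) (A : L -> 'M[R]_2) (d q : R) :
  (forall i, A i \in unitmx) -> bunching A d q ->
  exists kap : R, [/\ 0 < kap, (gamma A * kap%:E < 1)%E &
    forall i, sv1 (A i) `^ (q * d) <= kap * sv2 (A i) `^ ((q - 1) * d)].
Proof.
move=> Au bun; pose f i := sv1 (A i) `^ (q * d) / sv2 (A i) `^ ((q - 1) * d).
have s2 i : 0 < sv2 (A i) `^ ((q - 1) * d) by rewrite powR_gt0 // sv2_gt0.
have f0 i : 0 < f i by rewrite divr_gt0 // powR_gt0 // sv1_gt0.
have [i0 _ hi0] := @arg_maxP _ R L point xpredT f isT.
exists (f i0); split=> //.
- have := bun i0; rewrite -[sv1 (A i0) `^ _](@divfK _ (sv2 (A i0) `^ ((q - 1) * d))) ?gt_eqF //.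
  by rewrite -/(f i0) EFinM muleA -[ltRHS]mul1e lte_pmul2r ?lte_fin //.
- move=> i; have h : f i <= f i0 := hi0 i isT.
  by rewrite -(ler_pdivrMr _ _ (s2 i)); exact: h.
Qed.

Theorem theorem2 (R : realType) (L : finPointedType)
  (A : L -> 'M[R]_2) (t : L -> plane R) (F : set (plane R)) (d : R)
  (mu : probability (symbolic L) R)
  (A_nonsingular : forall i, A i \in unitmx)
  (A_contraction : forall i, linear_contraction (A i))
  (F_attractor : attractor (affine A t) F)
  (d_affinity : affinity_dim A = d%:E)
  (separation : forall i j, i != j ->
     (affine A t i @` F) `&` (affine A t j @` F) = set0)
  (positivity : forall i (j k : 'I_2), 0 < A i j k)
  (d_le1 : d <= 1)
  (mu_kaenmaki : kaenmaki_measure A d mu)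
  (bunched : exists2 q : R, 2 <= q & bunching A d q) :
  forall q : R, 0 <= q -> (q%:E < bunching_threshold A d)%E ->
    has_Lq_dim (pushforward mu (coding (affine A t)
                  : symbolic L -> g_sigma_algebraType (@open (plane R))))
               q d%:E /\
    d%:E = hausdorff_dim F.
Proof.
move=> q q0 q_lt.
have d0 := affinity_dim_ge0 d_affinity.
have [q' [q'2 bun] qq'] : exists2 q' : R, 2 <= q' /\ bunching A d q' & q < q'.
  have := q_lt; rewrite /bunching_threshold => /ereal_sup_gt[_ [q' hq' <-]].
  by rewrite lte_fin => ?; exists q'.
pose p := q' - 1.
have p1 : 1 <= p by rewrite /p lerBrDr (_ : 1 + 1 = 2).
have p0 : 0 < p by exact: lt_le_trans p1.
have p1E : p + 1 = q' by rewrite /p subrK.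
have [C1 C10 m_bounds] := kaenmaki_bounds d_le1 mu_kaenmaki.
have [C2 C20 m_mult] := kaenmaki_quasi_mult mu_kaenmaki.
have sum_sv1 n : \sum_(w <- words n) sv1 (word_mx A w) `^ d <= C1.
  rewrite -[leRHS]mulr1 -(sum_mass mu n) mulr_sumr; apply: ler_sum => w _.
  by rewrite -ler_pdivrMl //; case: (m_bounds w).
have [kap [kap0 gkap A_kap]] := bunching_constant A_nonsingular bun.
have A_kap' i : sv1 (A i) `^ (p * d + d) <= kap * sv2 (A i) `^ (p * d).
  have -> : p * d + d = q' * d by rewrite -p1E; ring.
  exact: A_kap.
have [K0 [th th1 hK0]] := uniform_stopping A_nonsingular kap0 gkap.
have pd0 : 0 <= p * d by rewrite mulr_ge0 // ltW.
have [CW _ distortion] := distortion_sum_bounded A_nonsingular positivity pd0 d0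
  kap0 A_kap' sum_sv1 th1 hK0.
have moments := @moment_bound R L A t F d mu A_nonsingular A_contraction F_attractor
  separation d0 C1 C2 C10 C20 m_bounds (fun u v => (m_mult u v).2) p CW p1 distortion.
split; last first.
  apply/eqP; rewrite eq_le; apply/andP; split.
    exact: (hausdorff_dim_ge A_nonsingular A_contraction F_attractor p0 moments).
  exact: (hausdorff_dim_le A_nonsingular A_contraction F_attractor d0 C10 sum_sv1).
have [Km Km0 mass_le] := sum_square_mass_le mu A_nonsingular A_contraction F_attractor.
have [Kc Kc0 count_le] := count_charged A_nonsingular A_contraction F_attractor d0 C10 m_bounds.
have /choice[J hJ] := fun delta => charged_squares mu A_nonsingular A_contraction F_attractor delta.
pose nu := square_mass A t mu.
pose xs delta := if 0 < delta then [seq nu delta x | x <- J delta] else [::].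
have xsE delta : 0 < delta -> xs delta = [seq nu delta x | x <- J delta] by rewrite /xs => ->.
have nu_gt0 delta x : 0 < delta -> x \in J delta -> 0 < nu delta x.
  move=> delta0; have [_ JP _] := hJ delta delta0.
  by rewrite JP => nx; rewrite lt_neqAle eq_sym nx square_mass_ge0.
have xs0 delta : {in xs delta, forall x, 0 < x}.
  rewrite /xs; case: ltP => // delta0 _ /mapP[x xJ ->]; exact: nu_gt0.
have xs1 delta : {in xs delta, forall x, x <= 1}.
  rewrite /xs; case: ltP => // delta0 _ /mapP[x xJ ->].
  exact: (square_mass_le1 mu A_nonsingular A_contraction F_attractor).
have mom1 delta : 0 < delta -> moment 1 (xs delta) = \sum_(x <- J delta) nu delta x.
  by move=> delta0; rewrite moment1 // xsE // big_map.
pose K := Num.max Km Kc.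
have K0' : 0 < K by rewrite lt_max Km0.
have mass_ge1 delta : 0 < delta -> delta < 1 -> 1 <= moment 1 (xs delta).
  by move=> delta0 _; rewrite mom1 //; case: (hJ delta delta0).
have mass_leK delta : 0 < delta -> delta < 1 -> moment 1 (xs delta) <= K.
  move=> delta0 _; rewrite mom1 //; have [uJ _ _] := hJ delta delta0.
  by rewrite (le_trans (mass_le _ _ delta0 uJ)) // le_max lexx.
have mass_eq1 : 0 < d -> forall delta, 0 < delta -> delta < 1 -> moment 1 (xs delta) = 1.
  move=> dpos delta delta0 delta1; apply/eqP; rewrite eq_le mass_ge1 // andbT mom1 //.
  have [uJ _ _] := hJ delta delta0.
  apply: (sum_square_mass_le1 A_nonsingular A_contraction F_attractor delta0 uJ) => j h.
  exact: (axis_line_null A_nonsingular A_contraction F_attractor separation positivity dpos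
    C10 C20 m_bounds (fun u v => (m_mult u v).1)).
have count_leK delta : 0 < delta -> delta < 1 -> (size (xs delta))%:R <= K * delta `^ (- d).
  move=> delta0 delta1; have [uJ _ _] := hJ delta delta0.
  rewrite xsE // size_map (le_trans (count_le _ _ delta0 delta1 uJ _)) //.
    by move=> x; exact: nu_gt0.
  by rewrite ler_wpM2r ?powR_ge0 // le_max lexx orbT.
have moment_leK s : s < d -> exists2 Ks : R, 0 < Ks &
  forall delta : R, 0 < delta -> delta < 1 -> moment (p + 1) (xs delta) <= Ks * delta `^ (p * s).
  move=> /moments[Ks Ks0 hKs]; exists Ks => // delta delta0 delta1.
  have [uJ _ _] := hJ delta delta0.
  by rewrite /moment xsE // big_map; exact: hKs.
have near_d (e : R) : 0 < e -> \forall delta \near 0^'+,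
    ((d - e)%:E <= Lq_ratio (pushforward mu (coding (affine A t)
                  : symbolic L -> g_sigma_algebraType (@open (plane R)))) q delta <= (d + e)%:E)%E.
  move=> e0; have qp : q <= p + 1 by rewrite p1E ltW.
  have [delta1 delta10 hdelta] := scale_exponent_near d0 p0 K0' xs0 xs1 mass_ge1 mass_leK
    mass_eq1 count_leK moment_leK q0 qp e0.
  near=> delta.
  have delta0 : 0 < delta by near: delta; exact: nbhs_right_gt.
  have [|dlt hx] := hdelta delta delta0; first by near: delta; exact: nbhs_right_lt.
  have [uJ JP mJ] := hJ delta delta0.
  rewrite (@Lq_ratio_finite R _ (nu delta) delta (J delta) uJ) //.
  - by rewrite -xsE // !lee_fin.
  - move=> x; exact: (prE mu (measurable_square mu A_nonsingular A_contraction F_attractor delta x)).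
  - by move=> x; exact: square_mass_ge0.
  - by move=> x; exact: (square_mass_le1 mu A_nonsingular A_contraction F_attractor).
  - by rewrite -xsE // mass_ge1.
by split; [exact: limf_esup_near|exact: limf_einf_near].
Unshelve. all: by end_near. Qed.
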